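(* There are Borel maps $\mathrm{LIM}:R_{dir}\to\Gamma$ and $\Psi_i:R_{dir}\to(\mathbb N^{\mathbb N})^{\mathbb N}$ ($i\in\mathbb N$) such that for every $s=((\gamma_i)_{i\in\mathbb N},(\Phi_i)_{i\in\mathbb N})\in R_{dir}$: $$C^*(\mathrm{LIM}(s))\simeq\lim_{i\to\infty}(C^*(\gamma_i),\hat\Phi_i),$$ for all $n\in\mathbb N$ we have $R_{hom}(\gamma_n,\mathrm{LIM}(s),\Psi_n(s))$, and the $*$-homomorphisms $\widehat{\Psi_n(s)}:C^*(\gamma_n)\to C^*(\mathrm{LIM}(s))$ satisfy $$\widehat{\Psi_{n+1}(s)}\circ\hat\Phi_n=\widehat{\Psi_n(s)}\qquad\text{for all } n\in\mathbb N.$$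
   Context: Let $H$ be a separable infinite-dimensional complex Hilbert space, $\mathcal B(H)$ with the Borel structure generated by the weakly open sets, $\Gamma=\mathcal B(H)^{\mathbb N}$ with the product Borel structure, and for $\gamma\in\Gamma$ let $C^*(\gamma)\subseteq\mathcal B(H)$ be the C$^*$-algebra generated by $\gamma$. $(\mathfrak p_j)_{j\in\mathbb N}$ enumerates the non-commutative $*$-polynomials without constant term in formal variables $X_k$ ($k\in\mathbb N$) with coefficients in $\mathbb Q(i)=\mathbb Q+i\mathbb Q$; $\mathfrak p_j(\gamma)$ is the evaluation at $X_k=\gamma_k$. A function $\Phi:\mathbb N\to\mathbb N^{\mathbb N}$ is a code for a $*$-homomorphism $C^*(\gamma)\to C^*(\gamma')$ if: (i) for each $m$ the sequence $a_{m,k}=\mathfrak p_{\Phi(m)(k)}(\gamma')$, $k\in\mathbb N$, is norm-Cauchy; write $a_m=\lim_k a_{m,k}$; and for all $m,n,k$ and $q\in\mathbb Q(i)$: (ii) $\mathfrak p_m(\gamma)+\mathfrak p_n(\gamma)=\mathfrak p_k(\gamma)$ implies $a_m+a_n=a_k$; $\mathfrak p_m(\gamma)=q\,\mathfrak p_n(\gamma)$ implies $a_m=q a_n$; (iii) $\mathfrak p_m(\gamma)\mathfrak p_n(\gamma)=\mathfrak p_k(\gamma)$ implies $a_ma_n=a_k$; (iv) $\mathfrak p_m(\gamma)^*=\mathfrak p_k(\gamma)$ implies $a_m^*=a_k$; (v) $\|a_m\|\le\|\mathfrak p_m(\gamma)\|$. $R_{hom}\subseteq\Gamma\times\Gamma\times(\mathbb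 N^{\mathbb N})^{\mathbb N}$ is the (Borel) set of $(\gamma,\gamma',\Phi)$ such that $\Phi$ is a code for a $*$-homomorphism $C^*(\gamma)\to C^*(\gamma')$. For $(\gamma,\gamma',\Phi)\in R_{hom}$, $\hat\Phi:C^*(\gamma)\to C^*(\gamma')$ is the unique $*$-homomorphism with $\hat\Phi(\mathfrak p_m(\gamma))=a_m$ for all $m$. $R_{dir}\subseteq\Gamma^{\mathbb N}\times((\mathbb N^{\mathbb N})^{\mathbb N})^{\mathbb N}$ is the (Borel) set of pairs $((\gamma_i)_{i},(\Phi_i)_{i})$ such that $R_{hom}(\gamma_i,\gamma_{i+1},\Phi_i)$ for all $i\in\mathbb N$. *)

(* Defs.v *)
From HB Require Import structures.
From mathcomp Require Import all_boot all_order all_algebra finmap.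
From mathcomp Require Import all_classical all_reals all_analysis.
From mathcomp Require Import sesquilinear complex.

Set Implicit Arguments.
Unset Strict Implicit.
Unset Printing Implicit Defensive.

Import Order.TTheory GRing.Theory Num.Theory.
Import numFieldNormedType.Exports.

Local Open Scope classical_set_scope.
Local Open Scope ring_scope.
Local Open Scope complex_scope.

(** The inner product is linear in the first argument. *)

HB.mixin Record isHilbert (R : realType) (H : Type)
    & CompleteNormedModule R[i] H := {
  inner : {dot H for (@Num.conj R[i])};
  inner_normE : forall x : H, inner x x = `|x| ^+ 2
}.

#[short(type="hilbertType")]
HB.structure Definition Hilbert (R : realType) :=
  {H of CompleteNormedModule R[i] H & isHilbert R H}.

Definition separable (T : topologicalType) : Prop :=
  exists2 D : set T, countable D & dense D.

Definition infinite_dimensional (K : pzRingType) (V : lmodType K) : Prop :=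
  ~ exists n (b : 'I_n -> V),
      forall x, exists c : 'I_n -> K, x = \sum_(i < n) c i *: b i.

(** The operations of a *-algebra, without the laws. *)

HB.mixin Record Lmodule_hasMulStar (K : pzRingType) V & GRing.Lmodule K V := {
  amul : V -> V -> V;
  astar : V -> V
}.

#[short(type="mulStarModType")]
HB.structure Definition MulStarModule (K : pzRingType) :=
  {V of GRing.Lmodule K V & Lmodule_hasMulStar K V}.

(** C*-algebras, not necessarily unital. *)

HB.mixin Record isCStarAlgebra (R : realType) V
    & CompleteNormedModule R[i] V & MulStarModule R[i] V := {
  amulA : forall x y z : V, amul x (amul y z) = amul (amul x y) z;
  amulDl : forall x y z : V, amul (x + y) z = amul x z + amul y z;
  amulDr : forall x y z : V, amul x (y + z) = amul x y + amul x z;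
  ascaleAl : forall (c : R[i]) (x y : V), c *: amul x y = amul (c *: x) y;
  ascaleAr : forall (c : R[i]) (x y : V), c *: amul x y = amul x (c *: y);
  astarK : forall x : V, astar (astar x) = x;
  astarD : forall x y : V, astar (x + y) = astar x + astar y;
  astarZ : forall (c : R[i]) (x : V), astar (c *: x) = Num.conj c *: astar x;
  astarM : forall x y : V, astar (amul x y) = amul (astar y) (astar x);
  anorm_mul : forall x y : V, `|amul x y| <= `|x| * `|y|;
  anorm_starM : forall x : V, `|amul (astar x) x| = `|x| ^+ 2
}.

#[short(type="cstarAlgType")]
HB.structure Definition CStarAlgebra (R : realType) :=
  {V of CompleteNormedModule R[i] V & MulStarModule R[i] V
      & isCStarAlgebra R V}.

(** [f] is a *-homomorphism from the *-subalgebra [A] of [U] to the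
    *-subalgebra [B] of [V]; its values outside [A] are irrelevant. *)
Definition star_hom_on (K : pzRingType) (U V : mulStarModType K)
    (A : set U) (B : set V) (f : U -> V) : Prop :=
  [/\ forall x, A x -> B (f x),
      forall x y, A x -> A y -> f (x + y) = f x + f y,
      forall (c : K) x, A x -> f (c *: x) = c *: f x,
      forall x y, A x -> A y -> f (amul x y) = amul (f x) (f y) &
      forall x, A x -> f (astar x) = astar (f x)].

Definition star_isomorphic (K : pzRingType) (U V : mulStarModType K)
    (A : set U) (B : set V) : Prop :=
  exists2 f : U -> V, star_hom_on A B f & set_bij A B f.

(** Inductive systems [A_0 -> A_1 -> ...] of *-subalgebras of [U], with
    connecting maps [phi], and their limits in the category of C*-algebras. *)
Section DirectLimit.
Context (R : realType) (U : mulStarModType R[i]).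
Variables (A : nat -> set U) (phi : nat -> U -> U).

Definition cocone (B : cstarAlgType R) (psi : nat -> U -> B) : Prop :=
  (forall n, star_hom_on (A n) [set: B] (psi n)) /\
  (forall n x, A n x -> psi n.+1 (phi n x) = psi n x).

Definition is_direct_limit (L : cstarAlgType R) (iota : nat -> U -> L) : Prop :=
  cocone iota /\
  forall (B : cstarAlgType R) (psi : nat -> U -> B), cocone psi ->
    exists! theta : L -> B,
      star_hom_on [set: L] [set: B] theta /\
      forall n x, A n x -> theta (iota n x) = psi n x.

Definition isomorphic_to_direct_limit (W : mulStarModType R[i]) (C : set W) :=
  exists (L : cstarAlgType R) (iota : nat -> U -> L),
    is_direct_limit iota /\ star_isomorphic C [set: L].
End DirectLimit.

Section BoundedOperators.
Context (R : realType) (H : hilbertType R).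

Definition bounded_op : {pred H -> H} :=
  fun f => `[< linear f /\
    exists M : R, forall x, `|f x| <= M%:C * `|x| >].

Record BH := MkBH { op :> H -> H ; _ : op \in bounded_op }.

HB.instance Definition _ := [isSub for op].
HB.instance Definition _ := [Choice of BH by <:].

Lemma bounded_op_submod_closed : submod_closed bounded_op.
Proof.
split=> [|c f g].
  apply/asboolP; split; first by move=> a x y; rewrite /= scaler0 addr0.
  by exists 0 => x; rewrite normr0 mul0r.
move=> /asboolP[lf [M Mf]] /asboolP[lg [N Ng]]; apply/asboolP; split.
  move=> a x y /=; rewrite !fctE /= lf lg !scalerDr !scalerA addrACA.
  by rewrite (mulrC c a).
have /complex_realP[r cr] := normr_real c.
exists (r * M + N) => x; rewrite !fctE.
apply: le_trans (ler_normD _ _) _.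
rewrite (rmorphD (real_complex R)) (rmorphM (real_complex R)) mulrDl lerD//.
by rewrite normrZ -mulrA cr ler_wpM2l// -cr.
Qed.

HB.instance Definition _ :=
  GRing.isSubmodClosed.Build R[i] (H -> H) bounded_op
    bounded_op_submod_closed.
HB.instance Definition _ := [SubChoice_isSubLmodule of BH by <:].

Lemma opP (T : BH) : linear T /\ exists M : R, forall x, `|T x| <= M%:C * `|x|.
Proof. by case: T => f /= /asboolP. Qed.

HB.instance Definition _ (T : BH) :=
  GRing.isLinear.Build R[i] H H *:%R (op T) (proj1 (opP T)).

Lemma op_comp_subproof (S T : BH) : (S \o T : H -> H) \in bounded_op.
Proof.
have [lS [M MS]] := opP S; have [lT [N NT]] := opP T; apply/asboolP; split.
  by move=> a x y; rewrite /= lT lS.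
exists (`|M| * N) => x /=; apply: le_trans (MS _) _.
apply: (@le_trans _ _ (`|M|%:C * `|T x|)).
  by rewrite ler_wpM2r// lecR ler_norm.
by rewrite (rmorphM (real_complex R)) -mulrA ler_wpM2l// lecR.
Qed.

Definition op_comp (S T : BH) : BH := MkBH (op_comp_subproof S T).

(** The adjoint; it exists by the Riesz representation theorem. *)
Definition adjoint (T : BH) : BH :=
  xget 0 [set S : BH | forall x y, inner (T x) y = inner x (S y)].

HB.instance Definition _ :=
  Lmodule_hasMulStar.Build R[i] BH op_comp adjoint.

(** The operator norm; [R[i]]-valued, as are all norms over [R[i]]. *)
Definition opnorm (T : BH) : R[i] :=
  (sup [set complex.Re `|T x| | x in [set x : H | `|x| <= 1]])%:C.

Lemma opnorm_ub1 (T : BH) x : `|x| <= 1 -> `|T x| <= opnorm T.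
Proof.
move=> x1; have [lT [M MT]] := opP T.
rewrite -[leLHS]RRe_real ?normr_real// /opnorm lecR.
apply: ub_le_sup; last by exists x.
exists `|M| => _ [z z1 <-].
rewrite -lecR RRe_real ?normr_real//.
apply: le_trans (MT z) _.
apply: (@le_trans _ _ (`|M|%:C * `|z|)).
  by rewrite ler_wpM2r// lecR ler_norm.
by rewrite ler_piMr// lecR.
Qed.

Lemma opnorm_ge0 (T : BH) : 0 <= opnorm T.
Proof.
by apply: le_trans (normr_ge0 (T 0)) (opnorm_ub1 _ _); rewrite normr0.
Qed.

Lemma opnorm_le (T : BH) (c : R[i]) :
  (forall x, `|x| <= 1 -> `|T x| <= c) -> opnorm T <= c.
Proof.
move=> Tc; have c0 : 0 <= c.
  by apply: le_trans (normr_ge0 (T 0)) (Tc _ _); rewrite normr0.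
have /complex_realP[M cM] := ger0_real c0.
rewrite {}cM in Tc c0 *; rewrite lecR; apply: ge_sup.
  by exists (complex.Re `|T 0|), 0 => //=; rewrite normr0.
by move=> _ [x x1 <-]; rewrite -lecR RRe_real ?normr_real// Tc.
Qed.

Lemma opnorm_triangle (S T : BH) : opnorm (S + T) <= opnorm S + opnorm T.
Proof.
apply: opnorm_le => x x1; apply: le_trans (ler_normD (S x) (T x)) _.
by rewrite lerD// opnorm_ub1.
Qed.

Lemma opnormZ (c : R[i]) (T : BH) : opnorm (c *: T) = `|c| * opnorm T.
Proof.
have leZ a S : opnorm (a *: S) <= `|a| * opnorm S.
  apply: opnorm_le => x x1; rewrite [leLHS](normrZ a (S x)).
  by rewrite ler_wpM2l// opnorm_ub1.
apply/eqP; rewrite eq_le leZ /=; have [->|c0] := eqVneq c 0.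
  by rewrite normr0 mul0r opnorm_ge0.
rewrite -ler_pdivlMl ?normr_gt0// -normfV; apply: le_trans (leZ _ _).
by rewrite scalerA mulVf// scale1r.
Qed.

Lemma opnorm_eq0 (T : BH) : opnorm T = 0 -> T = 0.
Proof.
move=> T0; apply/val_inj/funext => x /=.
apply/eqP; have [->|x0] := eqVneq x 0.
  by rewrite linear0.
have nx0 : `|x|^-1 != 0 by rewrite invr_eq0 normr_eq0.
have : `|T (`|x|^-1 *: x)| <= opnorm T.
  by apply: opnorm_ub1; rewrite normrZ normfV normr_id mulVf// normr_eq0.
rewrite T0 linearZ normr_le0 scaler_eq0 (negbTE nx0) /=.
by [].
Qed.

HB.instance Definition _ := Lmodule_isNormed.Build R[i] BH
  opnorm_triangle opnormZ opnorm_eq0.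

End BoundedOperators.

Arguments BH {R} H.

(** C*-subalgebras of [BH H]; [closed] refers to the norm topology. *)
Section GeneratedCStarAlgebra.
Context (R : realType) (H : hilbertType R).

Definition cstar_subalgebra (A : set (BH H)) : Prop :=
  [/\ A 0,
      forall S T, A S -> A T -> A (S + T),
      forall (c : R[i]) T, A T -> A (c *: T),
      forall S T, A S -> A T -> A (amul S T) &
      forall T, A T -> A (astar T)] /\ closed A.

Definition Cstar (gamma : nat -> BH H) : set (BH H) :=
  smallest cstar_subalgebra (range gamma).

End GeneratedCStarAlgebra.

(** *-polynomials without constant term: finitely supported families of
    coefficients in Q(i), indexed by the nonempty words [w.1 :: w.2]. The letter
    [(k, false)] stands for [X_k] and [(k, true)] for its adjoint. *)

Definition letter : choiceType := (nat * bool)%type.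
Definition word : choiceType := (letter * seq letter)%type.
Definition starpoly := {fsfun word -> rat[i] with 0}.

Definition Qi_embed (R : realType) (q : rat[i]) : R[i] :=
  ratr (complex.Re q) +i* ratr (complex.Im q).

Section Evaluation.
Context (R : realType) (H : hilbertType R) (gamma : nat -> BH H).

Definition eval_letter (l : letter) : BH H :=
  if l.2 then astar (gamma l.1) else gamma l.1.

Definition eval_word (w : word) : BH H :=
  foldl (fun T l => amul T (eval_letter l)) (eval_letter w.1) w.2.

Definition eval (P : starpoly) : BH H :=
  \sum_(w <- finsupp P) Qi_embed R (P w) *: eval_word w.

End Evaluation.

(** [p] enumerates the *-polynomials. *)
Section Codes.
Context (R : realType) (H : hilbertType R) (p : nat -> starpoly).
Implicit Types (gamma : nat -> BH H) (Phi : nat -> nat -> nat).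

Definition code_seq gamma' Phi (m : nat) : nat -> BH H :=
  fun k => eval gamma' (p (Phi m k)).

Definition code_lim gamma' Phi (m : nat) : BH H :=
  lim (code_seq gamma' Phi m @ \oo).

Definition Rhom gamma gamma' Phi : Prop :=
  let P m := eval gamma (p m) in
  let a := code_lim gamma' Phi in
  (forall m, cauchy (code_seq gamma' Phi m @ \oo)) /\
  forall m n k (q : rat[i]),
    [/\ P m + P n = P k -> a m + a n = a k,
        P m = Qi_embed R q *: P n -> a m = Qi_embed R q *: a n,
        amul (P m) (P n) = P k -> amul (a m) (a n) = a k,
        astar (P m) = P k -> astar (a m) = a k &
        `|a m| <= `|P m|].

(** The *-homomorphism [Cstar gamma -> Cstar gamma'] coded by [Phi]; when
    [Rhom gamma gamma' Phi] holds it is determined on [Cstar gamma]. *)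
Definition hat gamma gamma' Phi : BH H -> BH H :=
  xget (fun=> 0) [set f | star_hom_on (Cstar gamma) (Cstar gamma') f /\
    forall m, f (eval gamma (p m)) = code_lim gamma' Phi m].

End Codes.

Section WeakBorel.
Context (R : realType) (H : hilbertType R).

(** The weak operator topology is the initial topology for the maps
    [T |-> inner (T x) y]. *)
Definition matrix_coef (T : BH H) :
    prod_topology (fun _ : H * H => (R[i])^o : topologicalType) :=
  fun xy => inner (T xy.1) xy.2.

Definition BH_weak : topologicalType := initial_topology matrix_coef.

Definition BH_borel : measurableType _ := g_sigma_algebraType (@open BH_weak).

End WeakBorel.

Definition cylinders d (T : measurableType d) : set (set (nat -> T)) :=
  \bigcup_i preimage_set_system setT (fun u : nat -> T => u i) measurable.

(** [T^N] with the product sigma-algebra. *)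
Definition pow_nat d (T : measurableType d) : measurableType _ :=
  g_sigma_algebraType (@cylinders d T).

(** Borel maps on a subset [A], for the trace sigma-algebra on [A]. *)
Definition borel_on d d' (T : measurableType d) (T' : measurableType d')
    (A : set T) (f : A -> T') : Prop :=
  forall Y : set T', measurable Y ->
    exists2 X : set T, measurable X & f @^-1` Y = set_val @^-1` X.

Definition Gamma (R : realType) (H : hilbertType R) : measurableType _ :=
  pow_nat (BH_borel H).

Definition codes : measurableType _ := pow_nat (pow_nat nat).

Section Rdir.
Context (R : realType) (H : hilbertType R) (p : nat -> starpoly).

Definition Rdir : set (pow_nat (Gamma H) * pow_nat codes) :=
  [set s | forall i, Rhom p (s.1 i) (s.1 i.+1) (s.2 i)].

End Rdir.

Arguments Rdir {R} H p.

(* Main.v *)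
(** The limit is represented concretely by a measurable version of the GNS
    construction. Write [X_j(n,m)] for the image in stage [j] of the [m]-th
    *-polynomial of stage [n]. For every [(n,m)] choose seed vectors in [H] that
    nearly attain the norms [|X_j(n,m)|], and let words in the [X_j] act on the
    seeds. Along a subsequence of stages all the Gram matrices of these
    countably many vectors converge; the limit is a positive semidefinite form
    on finitely supported sequences, which Gram-Schmidt orthonormalization maps
    isometrically into [H], and the [X_j] induce operators [T(n,m)] on its
    closed range. As the seeds are nearly norming, [|T(n,m)|] is at least a
    fixed fraction of [lim_j |X_j(n,m)|], so that [T] is faithful on the limit.
    All the choices are first successes of countable searches, hence Borel.
    [LIM s] lists the [T(n,m)]; the code [Psi_n] then does not depend on [s], since
    it only names the variable [X_(n,m)].

    The universal property involves *-homomorphisms into arbitrary C*-algebras,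
    which must be shown to be contractive. If [a] is self-adjoint of norm less
    than [1], then [1 - a^2 = (1 - g)^2] with [g] self-adjoint and commuting with
    [a], so that the image of [a + i(1 - g)] is unitary, and the image of [a] is
    the real part of a unitary. *)

From HB Require Import structures.
From mathcomp Require Import all_boot all_order all_algebra finmap.
From mathcomp Require Import all_classical all_reals all_analysis.
From mathcomp Require Import sesquilinear complex ring lra.
Require Import Defs.

Set Implicit Arguments.
Unset Strict Implicit.
Unset Printing Implicit Defensive.

Import Order.TTheory GRing.Theory Num.Theory.
Import numFieldNormedType.Exports.

Local Open Scope classical_set_scope.
Local Open Scope ring_scope.
Local Open Scope complex_scope.

(** * Semi-inner products and limits of sequences *)

Section SemiInner.
Context (R : realType) (E : lmodType R[i]).

(** A lower norm bound up to a constant is enough for the limit. Cocones are contractive at every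
    stage, so the bound makes each of them factor through a bounded, densely defined relation, which
    extends by continuity. The constant is 4 = 2 * 2: a seed has norm at most 2 and attains at least
    half of the operator norm, which leaves room to take seeds from a countable dense set. Passing
    to a subsequence of stages is harmless, since the relations and bounds transferred to the limit
    hold at all late stages. A connecting map sends a *-polynomial of one stage only to a norm limit
    of *-polynomials of the next. Hence the *-polynomials of every stage get generators of their
    own, and compatibility of stages is recovered from distance estimates. [BH H] is not norm
    separable, so measurability is expressed through the vectors [T x], as pointwise limits of
    countably valued functions. Weakly open sets enter only where the given generators are read and
    where [LIM] is shown to be Borel. On finitely supported sequences a letter acts in the same way
    for all systems; only the semidefinite form varies. *)

Definition semi_inner (f : E -> E -> R[i]) : Prop :=
  [/\ forall (c : R[i]) x y z, f (c *: x + y) z = c * f x z + f y z,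
      forall x y, f x y = Num.conj (f y x) &
      forall x, 0 <= f x x].

Context (f : E -> E -> R[i]) (hf : semi_inner f).

Lemma semiDl x y z : f (x + y) z = f x z + f y z.
Proof. by have [fl _ _] := hf; rewrite -{1}(scale1r x) fl mul1r. Qed.

Lemma semi0l z : f 0 z = 0.
Proof. by apply: (addrI (f 0 z)); rewrite -semiDl !addr0. Qed.

Lemma semiZl c x z : f (c *: x) z = c * f x z.
Proof. by have [fl _ _] := hf; rewrite -(addr0 (c *: x)) fl semi0l addr0. Qed.

Lemma semiC x y : f x y = Num.conj (f y x).
Proof. by have [_ fC _] := hf. Qed.

Lemma semi_ge0 x : 0 <= f x x.
Proof. by have [_ _ f0] := hf. Qed.

Lemma semi0r z : f z 0 = 0.
Proof. by rewrite semiC semi0l conjC0. Qed.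

Lemma semiZr c x z : f x (c *: z) = Num.conj c * f x z.
Proof. by rewrite semiC semiZl rmorphM /= -semiC. Qed.

Lemma semiBl x y z : f (x - y) z = f x z - f y z.
Proof. by rewrite -scaleN1r semiDl semiZl mulN1r. Qed.

Lemma semiBr x y z : f x (y - z) = f x y - f x z.
Proof. by rewrite semiC semiBl rmorphB /= -!semiC. Qed.

Lemma semi_suml I (r : seq I) (P : pred I) (F : I -> E) y :
  f (\sum_(i <- r | P i) F i) y = \sum_(i <- r | P i) f (F i) y.
Proof. by elim/big_rec2: _ => [|i u v _ <-]; rewrite ?semi0l ?semiDl. Qed.

Lemma semi_sumr I (r : seq I) (P : pred I) (F : I -> E) y :
  f y (\sum_(i <- r | P i) F i) = \sum_(i <- r | P i) f y (F i).
Proof.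
by rewrite semiC semi_suml rmorph_sum; apply: eq_bigr => i _; rewrite [RHS]semiC.
Qed.

Lemma semi_CauchySchwarz x y : `|f x y| ^+ 2 <= f x x * f y y.
Proof.
have key u v (a b : R[i]) : 0 <= a * Num.conj a * f u u
    - a * Num.conj b * f u v - b * Num.conj a * f v u + b * Num.conj b * f v v.
  have := semi_ge0 (a *: u - b *: v).
  by rewrite semiBl !semiBr !semiZl !semiZr; congr (_ <= _); ring.
have key2 u v : 0 <= f v v * (f v v * f u u - f u v * Num.conj (f u v)).
  have vr : Num.conj (f v v) = f v v by rewrite -semiC.
  by have := key u v (f v v) (f u v); rewrite vr (semiC v u); congr (_ <= _); ring.
rewrite normCK -subr_ge0 (mulrC (f x x)).
have := semi_ge0 y; rewrite le_eqVlt => /predU1P[y0|y0]; last first.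
  by have := key2 x y; rewrite pmulr_rge0.
have := semi_ge0 x; rewrite le_eqVlt => /predU1P[x0|x0]; last first.
  have := key2 y x; rewrite pmulr_rge0// (semiC y x) conjCK.
  by rewrite (mulrC (_^*)) (mulrC (f y y)).
(* Both [f x x] and [f y y] vanish here, so neither instance of [key2] can be divided. The choice
   [a = 1], [b = f x y] leaves [-2 |f x y|^2 >= 0]. *)
have := key x y 1 (f x y).
rewrite -x0 -y0 (semiC y x) !mulr0 addr0 rmorph1 !mul1r mulr1 !sub0r.
by rewrite (mulrC (_^*)) -opprD !oppr_ge0 -mulr2n pmulrn_lle0.
Qed.

End SemiInner.

Section Inner.
Context (R : realType) (H : hilbertType R).
Implicit Types x y z : H.

Lemma innerDl x y z : inner (x + y) z = inner x z + inner y z.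
Proof. exact: linearDl. Qed.

Lemma innerDr x y z : inner x (y + z) = inner x y + inner x z.
Proof. exact: raddfD. Qed.

Lemma innerZl (c : R[i]) x y : inner (c *: x) y = c * inner x y.
Proof. exact: linearZl_LR. Qed.

Lemma innerZr (c : R[i]) x y : inner x (c *: y) = Num.conj c * inner x y.
Proof. by rewrite linearZr. Qed.

Lemma innerC x y : inner x y = Num.conj (inner y x).
Proof. by rewrite hermC expr0 mul1r. Qed.

Lemma innerBl x y z : inner (x - y) z = inner x z - inner y z.
Proof. exact: linearBl. Qed.

Lemma innerBr x y z : inner x (y - z) = inner x y - inner x z.
Proof. exact: raddfB. Qed.

Lemma inner0l x : inner 0 x = 0.
Proof. exact: linear0l. Qed.

Lemma inner0r x : inner x 0 = 0.
Proof. exact: raddf0. Qed.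

Lemma inner_suml I (r : seq I) (P : pred I) (f : I -> H) y :
  inner (\sum_(i <- r | P i) f i) y = \sum_(i <- r | P i) inner (f i) y.
Proof. exact: linear_sumlz. Qed.

Lemma inner_sumr I (r : seq I) (P : pred I) (f : I -> H) y :
  inner y (\sum_(i <- r | P i) f i) = \sum_(i <- r | P i) inner y (f i).
Proof. exact: raddf_sum. Qed.

Lemma inner_inj x y : (forall z, inner z x = inner z y) -> x = y.
Proof.
move=> xy; apply/eqP; rewrite -subr_eq0 -normr_eq0 -sqrf_eq0 -inner_normE.
by rewrite innerBr xy subrr.
Qed.

Lemma inner_semi : semi_inner (@inner R H).
Proof.
split=> [c x y z|x y|x]; first by rewrite innerDl innerZl.
- exact: innerC.
- by rewrite inner_normE exprn_ge0.
Qed.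

Lemma inner_le x y : `|inner x y| <= `|x| * `|y|.
Proof.
have := semi_CauchySchwarz inner_semi x y.
by rewrite !inner_normE -exprMn ler_pXn2r// nnegrE// mulr_ge0.
Qed.

Lemma parallelogram x y :
  `|x + y| ^+ 2 + `|x - y| ^+ 2 = 2 * `|x| ^+ 2 + 2 * `|y| ^+ 2.
Proof.
by rewrite -!inner_normE innerBl !innerBr innerDl !innerDr; ring.
Qed.

End Inner.

Section Limits.
Context (R : realType).
Notation C := R[i].
Implicit Types V W X : normedZmodType C.

(** Phrased by norms alone, so that the same lemmas serve scalars, vectors, operators and abstract
    C*-algebras. The tolerance is a complex number, which [0 < e] forces to be real. *)
Definition tends V (u : nat -> V) (l : V) : Prop :=
  forall e : C, 0 < e -> exists N, forall n, (N <= n)%N -> `|u n - l| < e.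

Lemma tends_cst V (l : V) : tends (fun=> l) l.
Proof. by move=> e e0; exists 0%N => n _; rewrite subrr normr0. Qed.

Lemma tends_evle V (u : nat -> V) (w : nat -> C) (l : V) :
  (exists N, forall n, (N <= n)%N -> `|u n - l| <= w n) -> tends w 0 ->
  tends u l.
Proof.
move=> [N uw] w0 e e0; have [M Mw] := w0 e e0; exists (maxn N M) => n.
rewrite geq_max => /andP[Nn Mn]; apply: le_lt_trans (uw _ Nn) _.
apply: le_lt_trans (Mw _ Mn); rewrite subr0 real_ler_norm// ger0_real//.
exact: le_trans (uw _ Nn).
Qed.

Lemma tends_le V (u : nat -> V) (w : nat -> C) (l : V) :
  (forall n, `|u n - l| <= w n) -> tends w 0 -> tends u l.
Proof. by move=> h; apply: tends_evle; exists 0%N => n _. Qed.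

Lemma tendsD V (u v : nat -> V) l m :
  tends u l -> tends v m -> tends (fun n => u n + v n) (l + m).
Proof.
move=> ul vm e e0; have e2 : 0 < e / 2 by rewrite divr_gt0.
have [N hN] := ul _ e2; have [M hM] := vm _ e2; exists (maxn N M) => n.
rewrite geq_max => /andP[/hN hn /hM hm]; rewrite opprD addrACA.
by apply: le_lt_trans (ler_normD _ _) _; rewrite (splitr e) ltrD.
Qed.

Lemma tends_dist V (u : nat -> V) l :
  tends u l -> tends (fun n => `|u n - l| : C) 0.
Proof.
by move=> ul e e0; have [N hN] := ul e e0; exists N => n /hN; rewrite subr0 normr_id.
Qed.

Lemma tends_norm V (u : nat -> V) l :
  tends u l -> tends (fun n => `|u n| : C) `|l|.
Proof.
move=> /tends_dist; apply: tends_le => n.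
exact: ler_dist_dist.
Qed.

Lemma tends_mul0 (c : C) (w : nat -> C) :
  tends w 0 -> tends (fun n => c * w n) 0.
Proof.
move=> w0 e e0; have c1 : 0 < `|c| + 1 by rewrite ltr_wpDl.
have [N hN] := w0 (e / (`|c| + 1)) (divr_gt0 e0 c1); exists N => n /hN.
rewrite !subr0 normrM ltr_pdivlMr// mulrC; apply: le_lt_trans.
by apply: ler_wpM2r => //; rewrite lerDl.
Qed.

(** Only additivity in each variable is asked for, not homogeneity, so that the statement covers the
    conjugate-linear slot of [inner] as well as products and scalar multiplication. *)
Lemma tends_bilin V W X (b : V -> W -> X) (K : C) (u : nat -> V) (v : nat -> W)
    l m :
  (forall x y z, b (x - y) z = b x z - b y z) ->
  (forall x y z, b x (y - z) = b x y - b x z) ->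
  (forall x y, `|b x y| <= K * `|x| * `|y|) -> 0 <= K ->
  tends u l -> tends v m -> tends (fun n => b (u n) (v n)) (b l m).
Proof.
move=> bl br bK K0 ul vm.
have [N hN] := vm 1 ltr01.
apply: (@tends_evle _ _
  (fun n => K * (`|m| + 1) * `|u n - l| + K * `|l| * `|v n - m|)).
  exists N => n /hN vn.
  have -> : b (u n) (v n) - b l m = b (u n - l) (v n) + b l (v n - m).
    by rewrite bl br addrA subrK.
  apply: le_trans (ler_normD _ _) _; apply: lerD; apply: le_trans (bK _ _) _.
    rewrite mulrAC ler_wpM2r// ler_wpM2l//.
    rewrite -{1}(subrK m (v n)) (addrC _ m); apply: le_trans (ler_normD _ _) _.
    by rewrite lerD2l ltW.
  by [].
rewrite -(addr0 0); apply: tendsD; apply: tends_mul0; exact: tends_dist.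
Qed.

Lemma tends_lin V W (f : V -> W) (K : C) (u : nat -> V) l :
  (forall x y, f (x - y) = f x - f y) ->
  (forall x, `|f x| <= K * `|x|) -> tends u l -> tends (f \o u) (f l).
Proof.
move=> fB fK ul; apply: (@tends_le _ _ (fun n => K * `|u n - l|)).
  by move=> n; rewrite /= -fB.
by apply: tends_mul0; exact: tends_dist.
Qed.

Lemma tendsN V (u : nat -> V) l : tends u l -> tends (fun n => - u n) (- l).
Proof.
move=> ul; apply: (@tends_lin _ _ -%R 1) ul => [x y|x]; first by rewrite opprD.
by rewrite normrN mul1r.
Qed.

Lemma tendsB V (u v : nat -> V) l m :
  tends u l -> tends v m -> tends (fun n => u n - v n) (l - m).
Proof. by move=> ul vm; apply: tendsD => //; exact: tendsN. Qed.

Lemma tendsM (u v : nat -> C) l m :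
  tends u l -> tends v m -> tends (fun n => u n * v n) (l * m).
Proof.
apply: (@tends_bilin _ _ _ *%R 1) => [x y z|x y z|x y|//].
- by rewrite mulrBl.
- by rewrite mulrBr.
- by rewrite mul1r normrM.
Qed.

Lemma tends_conj (u : nat -> C) l :
  tends u l -> tends (fun n => Num.conj (u n)) (Num.conj l).
Proof.
apply: (@tends_lin _ _ Num.conj 1) => [x y|x]; first by rewrite rmorphB.
by rewrite norm_conjC mul1r.
Qed.

Lemma tends_sum V I (r : seq I) (P : pred I) (u : I -> nat -> V) (l : I -> V) :
  (forall i, P i -> tends (u i) (l i)) ->
  tends (fun n => \sum_(i <- r | P i) u i n) (\sum_(i <- r | P i) l i).
Proof.
move=> ul; elim: r => [|i r IH].
  have -> : (fun n => \sum_(i <- [::] | P i) u i n) = fun=> 0.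
    by apply/funext => n; rewrite big_nil.
  by rewrite big_nil; exact: tends_cst.
have -> : (fun n => \sum_(j <- i :: r | P j) u j n) =
    fun n => (if P i then u i n else 0) + \sum_(j <- r | P j) u j n.
  by apply/funext => n; rewrite big_cons; case: (P i); rewrite ?add0r.
rewrite big_cons; have [Pi|Pi] := boolP (P i); first by apply: tendsD IH; exact: ul.
by rewrite -[X in tends _ X]add0r; apply: tendsD => //; exact: tends_cst.
Qed.

Lemma norm_small V (x : V) : (forall e : C, 0 < e -> `|x| <= e) -> x = 0.
Proof.
move=> h; apply/eqP; rewrite -normr_le0 real_leNgt ?ger0_real//.
apply/negP => x0; have := h (`|x| / 2) (divr_gt0 x0 (ltr0n _ 2)).
by rewrite ler_pdivlMr// ger_pMr// real_leNgt ?realn// ltr1n.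
Qed.

Lemma tends_normle V (u : nat -> V) l (c : C) :
  tends u l -> (exists N, forall n, (N <= n)%N -> `|u n| <= c) -> `|l| <= c.
Proof.
move=> ul [N uc]; have c0 : 0 <= c by apply: le_trans (uc N _).
rewrite real_leNgt ?ger0_real//; apply/negP => cl.
have lc : 0 < `|l| - c by rewrite subr_gt0.
have [M hM] := ul _ lc.
have := hM _ (leq_maxr N M); have := uc _ (leq_maxl N M).
set n := maxn N M => h1 h2.
have : `|l| < `|l|; last by rewrite ltxx.
rewrite -{1}(subrK (u n) l); apply: le_lt_trans (ler_normD _ _) _.
by rewrite distrC -(subrK c `|l|) ltr_leD.
Qed.

Lemma tends_unique V (u : nat -> V) l m : tends u l -> tends u m -> l = m.
Proof.
move=> ul um; apply/eqP; rewrite -subr_eq0; apply/eqP; apply: norm_small => e e0.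
apply: (@tends_normle _ (fun n => u n - u n)); last first.
  by exists 0%N => n _; rewrite subrr normr0 ltW.
exact: tendsB.
Qed.

Lemma tends_eq V (u v : nat -> V) l : tends u l -> u =1 v -> tends v l.
Proof. by move=> ul /funext <-. Qed.

Lemma tends_ler (u v : nat -> C) l m :
  tends u l -> tends v m -> (forall n, u n <= v n) -> l <= m.
Proof.
move=> ul vm uv; rewrite -subr_ge0.
have : forall n, `|v n - u n| = v n - u n.
  by move=> n; rewrite ger0_norm// subr_ge0.
have h := tendsB vm ul; have h2 := tends_norm h => /(_ _)/= E.
have -> : m - l = `|m - l|; last by [].
by apply: (tends_unique h); apply: tends_eq h2 _.
Qed.

Lemma tends_eveq V (u v : nat -> V) l :
  tends u l -> (exists N, forall n, (N <= n)%N -> u n = v n) -> tends v l.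
Proof.
move=> ul [N uv] e e0; have [M hM] := ul e e0; exists (maxn N M) => n.
by rewrite geq_max => /andP[Nn Mn]; rewrite -uv// hM.
Qed.

Lemma tends_sub V (u : nat -> V) l (r : nat -> nat) :
  (forall n, (n <= r n)%N) -> tends u l -> tends (u \o r) l.
Proof.
move=> rn ul e e0; have [N hN] := ul e e0; exists N => n Nn.
by apply: hN; exact: leq_trans (rn n).
Qed.

Lemma archi_inv (e : C) : 0 < e -> exists k : nat, k.+1%:R^-1 < e.
Proof.
move=> e0; have er := gtr0_real e0.
have eR : e = (complex.Re e)%:C by rewrite RRe_real.
have re0 : 0 < complex.Re e by rewrite -ltcR -eR.
have /archi_boundP : 0 <= (complex.Re e)^-1 by rewrite invr_ge0 ltW.
set k := Num.bound _ => hk; exists k.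
rewrite eR -(rmorph_nat (real_complex R)) -fmorphV ltcR.
rewrite invf_plt ?posrE//; apply: lt_trans hk _.
by rewrite ltr_nat.
Qed.

Lemma tends_inv : tends (fun n => n.+1%:R^-1 : C) 0.
Proof.
move=> e /archi_inv[k ke]; exists k => n kn.
rewrite subr0 ger0_norm ?invr_ge0//; apply: le_lt_trans ke.
by rewrite lef_pV2 ?posrE// ler_nat.
Qed.

Definition cauchys V (u : nat -> V) : Prop :=
  forall e : C, 0 < e -> exists N, forall m n, (N <= m)%N -> (N <= n)%N ->
    `|u m - u n| < e.

Lemma tends_cauchys V (u : nat -> V) l : tends u l -> cauchys u.
Proof.
move=> ul e e0; have e2 : 0 < e / 2 by rewrite divr_gt0.
have [N hN] := ul _ e2; exists N => m n /hN hm /hN hn.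
rewrite -(subrKA l); apply: le_lt_trans (ler_normD _ _) _.
by rewrite (splitr e) ltrD// distrC.
Qed.

End Limits.

Section LimitsTop.
Context (R : realType).

Lemma cvg_tends (V : normedModType R[i]) (u : nat -> V) (l : V) :
  (u @ \oo --> l) <-> tends u l.
Proof.
split=> [/cvgrPdist_lt h e e0|h].
  have [N _ hN] := h e e0; exists N => n Nn; rewrite distrC; exact: hN.
apply/cvgrPdist_lt => e e0; have [N hN] := h e e0; exists N => // n Nn.
by rewrite distrC; exact: hN.
Qed.

Lemma tends_scale (V : normedModType R[i]) (c : nat -> R[i]) d (u : nat -> V) x :
  tends c d -> tends u x -> tends (fun n => c n *: u n) (d *: x).
Proof.
apply: (@tends_bilin _ _ _ _ (fun a (b : V) => a *: b) 1) => [a b z|a b z|a b|//].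
- by rewrite scalerBl.
- by rewrite scalerBr.
- by rewrite mul1r normrZ.
Qed.

Lemma cauchy_cauchys (V : normedModType R[i]) (u : nat -> V) :
  cauchy (u @ \oo) <-> cauchys u.
Proof.
rewrite -cauchy_ballP; split=> h e e0.
  have [[A B] [[N _ NA] [M _ MB]] AB] := h e e0; exists (maxn N M) => m n.
  rewrite !geq_max => /andP[Nm _] /andP[_ Mn].
  have := AB (u m, u n) (conj (NA m Nm) (MB n Mn)).
  by rewrite /= -ball_normE.
have [N hN] := h e e0.
exists (u @` [set n | (N <= n)%N], u @` [set n | (N <= n)%N]) => /=.
  by split; exists N => // n Nn; exists n.
by move=> [_ _] /= [[m Nm <-] [n Nn <-]]; rewrite -ball_normE; exact: hN.
Qed.

Lemma Re_le (z : R[i]) : `|complex.Re z|%:C <= `|z|.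
Proof.
case: z => a b; rewrite normc_def /= lecR -sqrtr_sqr ler_wsqrtr//.
by rewrite lerDl sqr_ge0.
Qed.

Lemma Im_le (z : R[i]) : `|complex.Im z|%:C <= `|z|.
Proof.
case: z => a b; rewrite normc_def /= lecR -sqrtr_sqr ler_wsqrtr//.
by rewrite lerDr sqr_ge0.
Qed.

Lemma cauchysC_tends (u : nat -> R[i]) : cauchys u -> exists l, tends u l.
Proof.
have part (f : R[i] -> R) : (forall x y, f (x - y) = f x - f y) ->
    (forall x, `|f x|%:C <= `|x|) -> cauchys u ->
    exists l : R, tends (fun n => (f (u n))%:C) l%:C.
  move=> fB fle uc.
  have /cauchy_cvg/cvg_ex[l fl] : cauchy ((f \o u : nat -> R^o) @ \oo).
    rewrite -cauchy_ballP => e e0.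
    have [N hN] := uc e%:C ltac:(by rewrite ltcR).
    exists ((f \o u) @` [set n | (N <= n)%N], (f \o u) @` [set n | (N <= n)%N]) => /=.
      by split; exists N => // n Nn; exists n.
    move=> [_ _] /= [[m Nm <-] [n Nn <-]]; rewrite -ball_normE/=.
    by rewrite -ltcR -fB; apply: le_lt_trans (hN _ _ Nm Nn).
  exists l => e e0; have eR : e = (complex.Re e)%:C by rewrite RRe_real// gtr0_real.
  have re0 : 0 < complex.Re e by rewrite -ltcR -eR.
  have /cvgrPdist_lt/(_ _ re0)[N _ hN] := fl; exists N => n /hN.
  rewrite distrC -rmorphB /= => h; rewrite eR normc_def /= expr0n addr0.
  by rewrite sqrtr_sqr ltcR.
move=> uc.
have [a ha] := part (@complex.Re R) (fun x y => raddfB _ x y) Re_le uc.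
have [b hb] := part (@complex.Im R) (fun x y => raddfB _ x y) Im_le uc.
exists (a%:C + 'i * b%:C); apply: tends_eq (fun n => esym (complexE (u n))).
by apply: tendsD => //; apply: tendsM => //; exact: tends_cst.
Qed.

Lemma cauchys_tends (V : completeNormedModType R[i]) (u : nat -> V) :
  cauchys u -> exists l, tends u l.
Proof.
move=> /cauchy_cauchys/cauchy_cvg h; exists (lim (u @ \oo)).
exact/cvg_tends.
Qed.

End LimitsTop.

(** * The Riesz representation theorem and bounded operators *)

Section Riesz.
Context (R : realType) (H : hilbertType R).
Notation C := R[i].

Lemma tends_inner (u v : nat -> H) a b :
  tends u a -> tends v b -> tends (fun n => inner (u n) (v n)) (inner a b).
Proof.
apply: (@tends_bilin _ _ _ _ (@inner R H) 1) => [x y z|x y z|x y|//].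
- by rewrite innerBl.
- by rewrite innerBr.
- by rewrite mul1r inner_le.
Qed.

Lemma min_norm_orthogonal (x y : H) :
  (forall c : C, `|x| <= `|x + c *: y|) -> inner y x = 0.
Proof.
move=> hx; have [->|y0] := eqVneq y 0; first by rewrite inner0l.
have yy : 0 < inner y y by rewrite inner_normE exprn_gt0// normr_gt0.
set d := inner y x.
(* This coefficient subtracts from [x] its projection onto [y]. The squared norm drops by
   [|d|^2 / inner y y], which minimality forces to be 0. *)
have : `|x| ^+ 2 <= `|x + (- (Num.conj d / inner y y)) *: y| ^+ 2.
  by rewrite ler_pXn2r ?nnegrE.
rewrite -!inner_normE innerDl !innerDr !innerZl !innerZr (innerC x y) -/d.
have -> : Num.conj (- (Num.conj d / inner y y)) = - (d / inner y y).
  by rewrite rmorphN rmorphM fmorphV /= conjCK -innerC.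
set t := inner y y in yy *.
have -> : inner x x + - (d / t) * Num.conj d +
   (- (Num.conj d / t) * d + - (Num.conj d / t) * (- (d / t) * t)) =
   inner x x - d * Num.conj d / t.
  by field; rewrite gt_eqF.
rewrite lerBrDr gerDl pmulr_lle0 ?invr_gt0// -normCK => h.
apply/eqP; rewrite -normr_eq0 -sqrf_eq0 eq_le h /=.
by rewrite exprn_ge0.
Qed.

(** The representing vector is a multiple of the shortest vector [y] of the hyperplane [f = 1].
    Midpoints stay in the hyperplane, so by the parallelogram law a minimizing sequence is Cauchy;
    minimality makes its limit orthogonal to the kernel of [f]. *)
Theorem riesz (f : H -> C) (M : C) :
  (forall c x y, f (c *: x + y) = c * f x + f y) ->
  (forall x, `|f x| <= M * `|x|) ->
  exists y, forall x, f x = inner x y.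
Proof.
move=> fl fM.
have f0 : f 0 = 0.
  have := fl 1 0 0; rewrite scale1r addr0 mul1r.
  by move=> /esym/(canRL (addrK _)); rewrite subrr.
have fZ c x : f (c *: x) = c * f x by rewrite -[c *: x]addr0 fl f0 addr0.
have fD x y : f (x + y) = f x + f y by rewrite -{1}(scale1r x) fl mul1r.
have fB x y : f (x - y) = f x - f y by rewrite fD -scaleN1r fZ mulN1r.
have [[x1 fx1]|nf] := pselect (exists x, f x <> 0); last first.
  exists 0 => x; rewrite inner0r; apply/eqP/negPn/negP => /eqP fx.
  by apply: nf; exists x.
pose x0 := (f x1)^-1 *: x1.
have fx0 : f x0 = 1 by rewrite fZ mulVf//; apply/eqP.
pose q x := complex.Re (`|x : H| ^+ 2).
have qE x : `|x| ^+ 2 = (q x)%:C by rewrite RRe_real// ger0_real// exprn_ge0.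
have q0 x : 0 <= q x by rewrite -lecR -qE exprn_ge0.
pose D := [set q x | x in [set x | f x = 1]].
have Dlb : lbound D 0 by move=> _ [x _ <-].
have Dinf : has_inf D by split; [exists (q x0), x0|exists 0].
pose d := inf D.
have dq x : f x = 1 -> d <= q x by move=> fx; apply: ge_inf; [exists 0|exists x].
have /choice[x xP] n : exists x, f x = 1 /\ q x < d + n.+1%:R^-1.
  have [_ [x fx <-] qx] := @inf_adherent _ D n.+1%:R^-1 ltac:(by rewrite invr_gt0) Dinf.
  by exists x.
have qhalf u v : f u = 1 -> f v = 1 -> 4 * d <= q (u + v).
  move=> fu fv.
  have := dq (2^-1 *: (u + v)) ltac:(by rewrite fZ fD fu fv -mulr2n mulVf).
  rewrite -(@ler_pM2l _ (4 : R))// => h; apply: le_trans h _.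
  rewrite -lecR rmorphM /= -!qE normrZ exprMn.
  by rewrite normfV normr_nat mulrA rmorph_nat exprVn -natrX mulfV// mul1r.
have xc : cauchys x.
  (* For [m, n >= N] the parallelogram law gives [q (x m - x n) < 4 (d + 1/(N+1)) - 4 d], whence the
     4. *)
  move=> e e0; have e4 : 0 < e ^+ 2 / 4 by rewrite divr_gt0// exprn_gt0.
  have [N hN] := archi_inv e4; exists N => m n Nm Nn.
  rewrite -(@ltr_pXn2r _ 2)// ?nnegrE// ?ltW//.
  have := parallelogram (x m) (x n); rewrite !qE => hp.
  have hq := qhalf _ _ (proj1 (xP m)) (proj1 (xP n)).
  have qm := proj2 (xP m); have qn := proj2 (xP n).
  have km k : (N <= k)%N -> (k.+1%:R^-1 : R) <= N.+1%:R^-1.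
    by move=> Nk; rewrite lef_pV2 ?posrE// ler_nat.
  have {}qm := lt_le_trans qm (lerD (lexx d) (km _ Nm)).
  have {}qn := lt_le_trans qn (lerD (lexx d) (km _ Nn)).
  have {}hp : q (x m + x n) + q (x m - x n) = 2 * q (x m) + 2 * q (x n).
    by apply: complexI; rewrite !rmorphD !rmorphM /= rmorph_nat.
  have : q (x m - x n) < 4 * N.+1%:R^-1.
    move: hq qm qn hp; move: (q _) (q _) (q _) (q _) (N.+1%:R^-1) => a1 a2 a3 a4 t.
    by lra.
  rewrite -ltcR -qE rmorphM fmorphV !rmorph_nat => h; apply: lt_trans h _.
  by rewrite mulrC -ltr_pdivlMr.
have [y xy] := cauchys_tends xc.
have fy : f y = 1.
  apply: tends_unique (tends_lin fB fM xy) _.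
  by apply: tends_eq (tends_cst _) _ => n /=; rewrite (proj1 (xP n)).
have yd : `|y| ^+ 2 <= d%:C.
  have y2 : tends (fun n => `|x n| ^+ 2) (`|y| ^+ 2).
    by apply: tendsM; exact: tends_norm.
  have d2 : tends (fun n => (d + n.+1%:R^-1)%:C : C) d%:C.
    rewrite -[X in tends _ X]addr0; apply: (@tends_eq _ _ (fun n => d%:C + n.+1%:R^-1)).
      by apply: tendsD; [exact: tends_cst|exact: tends_inv].
    by move=> n; rewrite rmorphD fmorphV rmorph_nat.
  apply: tends_ler y2 d2 _ => n; rewrite qE lecR ltW//.
  exact: (proj2 (xP n)).
have ker_y z : f z = 0 -> inner z y = 0.
  move=> fz; apply: min_norm_orthogonal => c.
  rewrite -(@ler_pXn2r _ 2)// ?nnegrE//; apply: le_trans yd _.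
  by rewrite qE lecR dq// fD fZ fz mulr0 addr0.
have y0 : inner y y != 0.
  rewrite inner_normE sqrf_eq0 normr_eq0; apply/eqP => y0.
  by move: fy; rewrite y0 f0 => /esym/eqP; rewrite oner_eq0.
exists ((Num.conj (inner y y))^-1 *: y) => z.
have := ker_y (z - f z *: y) ltac:(by rewrite fB fZ fy mulr1 subrr).
rewrite innerBl innerZl innerZr => /eqP; rewrite subr_eq0 => /eqP ->.
by rewrite fmorphV /= conjCK mulrCA mulVf// mulr1.
Qed.

End Riesz.

(** A Cauchy filter contains sets [A n] of diameter below [1/(n+1)]. Points taken from their finite
    intersections form a Cauchy sequence, and its limit is a limit of the filter. *)
Lemma cauchys_complete (R : realType) (V : normedModType R[i]) :
  (forall u : nat -> V, cauchys u -> exists l, tends u l) ->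
  forall F : set_system V, ProperFilter F -> cauchy F -> cvg F.
Proof.
move=> Vc F FF /cauchy_ballP Fc.
have /choice[A AP] (n : nat) : exists A : set V, F A /\
    forall x y, A x -> A y -> `|x - y| < n.+1%:R^-1 :> R[i].
  have e0 : 0 < n.+1%:R^-1 :> R[i] by rewrite invr_gt0.
  have [[A B] [FA FB] AB] := Fc _ (divr_gt0 e0 (ltr0n _ 2)).
  exists (A `&` B); split; first exact: filterI.
  move=> x y [Ax Bx] [Ay By].
  have := AB (x, y) (conj Ax By); rewrite /= -ball_normE /=.
  by move=> /lt_trans; apply; rewrite ltr_pdivrMr// ltr_pMr// ltr1n.
have FA n : F (\bigcap_(k < n) A k).
  elim: n => [|n IH]; first by apply: filterS filterT => x _ k.
  apply: filterS (filterI IH (proj1 (AP n))) => x [xn xA] k /= kn.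
  by move: kn; rewrite ltnS leq_eqVlt => /predU1P[->//|kn]; exact: xn.
have /choice[u uP] n : exists x, (\bigcap_(k < n.+1) A k) x.
  exact: filter_ex (FA n.+1).
have uA k n : (k <= n)%N -> A k (u n) by move=> kn; apply: uP => /=.
have uc : cauchys u.
  move=> e /archi_inv[N Ne]; exists N => m n Nm Nn; apply: lt_trans Ne.
  by apply: (proj2 (AP N)); exact: uA.
have [l ul] := Vc u uc; apply/cvg_ex; exists l.
apply/cvgrPdist_lt => e e0; have e2 : 0 < e / 2 by rewrite divr_gt0.
have [N Ne] := archi_inv e2; have [M uM] := ul _ e2.
apply: filterS (proj1 (AP N)) => x Ax.
have := uM _ (leq_maxr N M); have := uA _ _ (leq_maxl N M).
move: (maxn N M) => n An un; rewrite -(subrKA (u n)) (splitr e).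
apply: le_lt_trans (ler_normD _ _) _; apply: ltrD; first by rewrite distrC.
by apply: lt_trans Ne; exact: (proj2 (AP N)).
Qed.

Section Operators.
Context (R : realType) (H : hilbertType R).
Notation C := R[i].
Implicit Types S T : BH H.

Lemma op_ext S T : (forall x, S x = T x) -> S = T.
Proof. by move=> /funext ST; exact: val_inj. Qed.

Lemma opDE S T x : (S + T) x = S x + T x. Proof. by []. Qed.
Lemma opBE S T x : (S - T) x = S x - T x. Proof. by []. Qed.
Lemma opZE (c : C) T x : (c *: T) x = c *: (T x). Proof. by []. Qed.
Lemma op0E x : (0 : BH H) x = 0. Proof. by []. Qed.
Lemma opME S T x : (amul S T) x = S (T x). Proof. by []. Qed.

Lemma op_sumE I (r : seq I) (P : pred I) (F : I -> BH H) x :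
  (\sum_(i <- r | P i) F i) x = \sum_(i <- r | P i) F i x.
Proof. by elim/big_rec2: _ => [//|i u v _ <-]; rewrite opDE. Qed.

Lemma op_le T x : `|T x| <= `|T| * `|x|.
Proof.
have [->|x0] := eqVneq x 0; first by rewrite linear0 !normr0 mulr0.
have nx0 : 0 < `|x| by rewrite normr_gt0.
rewrite -ler_pdivrMr// mulrC.
have -> : `|x|^-1 * `|T x| = `|T (`|x|^-1 *: x)|.
  by rewrite linearZ normrZ normfV normr_id.
by apply: opnorm_ub1; rewrite normrZ normfV normr_id mulVf// gt_eqF.
Qed.

Lemma op_norm_le T (c : C) : 0 <= c -> (forall x, `|T x| <= c * `|x|) -> `|T| <= c.
Proof.
move=> c0 Tc; apply: opnorm_le => x x1; apply: le_trans (Tc x) _.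
by rewrite ler_piMr.
Qed.

Definition mkop (f : H -> H) (M : C) (fl : linear f)
    (fM : forall x, `|f x| <= M * `|x|) : {T : BH H | op T = f}.
Proof.
have fb : f \in @bounded_op R H.
  apply/asboolP; split=> //; exists (complex.Re M).
  (* The bound [M] is only known to be real once a nonzero [x] is at hand, because then [M * |x|] is
     nonnegative. *)
  move=> x; have [->|x0] := eqVneq x 0.
    by rewrite -[X in f X](subrr 0) -scaleN1r addrC fl scaleN1r addNr !normr0 mulr0.
  suff /RRe_real -> : M \is Num.real by exact: fM.
  rewrite ger0_real//.
  by have := le_trans (normr_ge0 _) (fM x); rewrite pmulr_lge0// normr_gt0.
by exists (MkBH fb).
Defined.

Lemma tends_op T (u : nat -> H) l : tends u l -> tends (fun n => T (u n)) (T l).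
Proof. by apply: (@tends_lin _ _ _ T `|T|) => x *; [rewrite linearB|exact: op_le]. Qed.

Lemma tends_opE (u : nat -> BH H) T x : tends u T -> tends (fun n => u n x) (T x).
Proof.
apply: (@tends_lin _ _ _ (fun S : BH H => S x) `|x|) => // S.
by rewrite mulrC op_le.
Qed.

Lemma op_cauchys_tends (u : nat -> BH H) : cauchys u -> exists T, tends u T.
Proof.
move=> uc.
have /choice[f fP] x : exists y, tends (fun n => u n x) y.
  apply: cauchys_tends => e e0.
  have x1 : 0 < `|x| + 1 by rewrite ltr_wpDl.
  have [N hN] := uc (e / (`|x| + 1)) (divr_gt0 e0 x1); exists N => m n Nm Nn.
  rewrite -opBE; apply: le_lt_trans (op_le _ _) _.
  have := hN m n Nm Nn; rewrite ltr_pdivlMr//; apply: le_lt_trans.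
  by apply: ler_wpM2l => //; rewrite lerDl.
have fl : linear f.
  move=> c x y; apply: tends_unique (fP _) _.
  apply: (@tends_eq _ _ (fun n => c *: u n x + u n y)).
    apply: tendsD => //.
    apply: (@tends_lin _ _ _ (fun z : H => c *: z) `|c|) (fP x) => z *.
      by rewrite scalerBr.
    by rewrite normrZ.
  by move=> n; rewrite linearP.
have [N hN] := uc 1 ltr01.
(* The uniform estimate survives in the pointwise limit. It is used twice: at [K = N] to bound [f],
   and at late [K] to obtain convergence in norm. *)
have bnd (K : nat) (e : C) : (forall n, (K <= n)%N -> `|u n - u K| <= e) ->
    forall x, `|f x - u K x| <= e * `|x|.
  move=> h x; apply: (@tends_normle _ _ (fun n => u n x - u K x)).
    by apply: tendsB => //; exact: tends_cst.
  exists K => n Kn; rewrite -opBE; apply: le_trans (op_le _ _) _.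
  by apply: ler_wpM2r => //; exact: h.
have fM x : `|f x| <= (1 + `|u N|) * `|x|.
  rewrite -(subrK (u N x) (f x)); apply: le_trans (ler_normD _ _) _.
  rewrite mulrDl; apply: lerD; last exact: op_le.
  by apply: bnd => n Nn; rewrite ltW// hN.
have [T Tf] := mkop fl fM; exists T => e e0.
have e2 : 0 < e / 2 by rewrite divr_gt0.
have [K hK] := uc _ e2; exists K => n Kn.
apply: (@le_lt_trans _ _ (e / 2)); last by rewrite ltr_pdivrMr// ltr_pMr// ltr1n.
apply: op_norm_le; first exact: ltW.
move=> x; rewrite opBE distrC Tf; apply: bnd => m nm.
by rewrite ltW// hK// (leq_trans Kn).
Qed.

HB.instance Definition _ := Uniform_isComplete.Build (BH H)
  (cauchys_complete op_cauchys_tends).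

(** [adjoint] is a choice with default [0]; the Riesz theorem supplies a candidate, so the default
    never occurs. *)
Lemma adjointP T x y : inner (T x) y = inner x (astar T y).
Proof.
have : exists S : BH H, forall x y, inner (T x) y = inner x (S y).
  have /choice[f fP] z : exists w, forall x, inner (T x) z = inner x w.
    apply: (@riesz _ _ (fun x => inner (T x) z) (`|T| * `|z|)) => [c u v|u].
      by rewrite linearP innerDl innerZl.
    apply: le_trans (inner_le _ _) _; rewrite mulrAC ler_wpM2r//.
    exact: op_le.
  have fl : linear f.
    move=> c u v; apply: inner_inj => z.
    by rewrite -fP !innerDr !innerZr !fP.
  have fM z : `|f z| <= `|T| * `|z|.
    have [->|fz0] := eqVneq (f z) 0; first by rewrite normr0 mulr_ge0.
    have fz : 0 < `|f z| by rewrite normr_gt0.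
    rewrite -(ler_pM2r fz) -expr2 -inner_normE -fP.
    rewrite -[leLHS]ger0_norm ?fP ?inner_normE ?exprn_ge0//.
    rewrite -inner_normE -fP; apply: le_trans (inner_le _ _) _.
    rewrite mulrAC ler_wpM2r//; exact: op_le.
  have [S Sf] := mkop fl fM.
  by exists S => u v; rewrite Sf.
by move=> /(xgetPex (0 : BH H)); apply.
Qed.

Lemma adjoint_unique S T :
  (forall x y, inner (T x) y = inner x (S y)) -> astar T = S.
Proof.
by move=> h; apply: op_ext => y; apply: inner_inj => x; rewrite -adjointP h.
Qed.

Lemma adjointK T : astar (astar T) = T.
Proof.
by apply: adjoint_unique => x y; rewrite innerC -adjointP -innerC.
Qed.

Lemma adjoint_normle T : `|astar T| <= `|T|.
Proof.
apply: op_norm_le => // y.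
have [->|fz0] := eqVneq (astar T y) 0; first by rewrite normr0 mulr_ge0.
have fz : 0 < `|astar T y| by rewrite normr_gt0.
rewrite -(ler_pM2r fz) -expr2 -inner_normE -adjointP.
rewrite -[leLHS]ger0_norm; last by rewrite adjointP inner_normE exprn_ge0.
apply: le_trans (inner_le _ _) _; rewrite mulrAC ler_wpM2r//; exact: op_le.
Qed.

Lemma op_starM T : `|amul (astar T) T| = `|T| ^+ 2.
Proof.
have mle (S S' : BH H) : `|amul S S'| <= `|S| * `|S'|.
  apply: op_norm_le => [|x]; first by rewrite mulr_ge0.
  rewrite opME; apply: le_trans (op_le _ _) _.
  by rewrite -mulrA ler_wpM2l// op_le.
apply/eqP; rewrite eq_le; apply/andP; split.
  by apply: le_trans (mle _ _) _; rewrite expr2 ler_wpM2r// adjoint_normle.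
(* It now suffices to bound [T] by the square root of the norm of [T* T], which follows from
   [|T x|^2 = inner x (T* T x)] and Cauchy-Schwarz. *)
rewrite -[X in _ <= X]sqrtCK ler_pXn2r ?nnegrE ?sqrtC_ge0//.
apply: op_norm_le; first by rewrite sqrtC_ge0.
move=> x; rewrite -(@ler_pXn2r _ 2)// ?nnegrE ?mulr_ge0 ?sqrtC_ge0//.
rewrite exprMn sqrtCK -inner_normE adjointP -opME.
rewrite -[leLHS]ger0_norm; last by rewrite opME -adjointP inner_normE exprn_ge0.
by apply: le_trans (inner_le _ _) _; rewrite mulrC expr2 mulrA ler_wpM2r// op_le.
Qed.

End Operators.

Section OperatorCStar.
Context (R : realType) (H : hilbertType R).
Implicit Types S T U : BH H.

Fact op_amulA S T U : amul S (amul T U) = amul (amul S T) U.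
Proof. exact: op_ext. Qed.

Fact op_amulDl S T U : amul (S + T) U = amul S U + amul T U.
Proof. exact: op_ext. Qed.

Fact op_amulDr S T U : amul S (T + U) = amul S T + amul S U.
Proof. by apply: op_ext => x; rewrite opME !opDE linearD. Qed.

Fact op_ascaleAl (c : R[i]) S T : c *: amul S T = amul (c *: S) T.
Proof. exact: op_ext. Qed.

Fact op_ascaleAr (c : R[i]) S T : c *: amul S T = amul S (c *: T).
Proof. by apply: op_ext => x; rewrite opME !opZE linearZ. Qed.

Fact op_astarD S T : astar (S + T) = astar S + astar T.
Proof.
by apply: adjoint_unique => x y; rewrite !opDE innerDl innerDr !adjointP.
Qed.

Fact op_astarZ (c : R[i]) T : astar (c *: T) = Num.conj c *: astar T.
Proof.
by apply: adjoint_unique => x y; rewrite !opZE innerZl innerZr conjCK adjointP.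
Qed.

Fact op_astarM S T : astar (amul S T) = amul (astar T) (astar S).
Proof. by apply: adjoint_unique => x y; rewrite !opME !adjointP. Qed.

Fact op_norm_mul S T : `|amul S T| <= `|S| * `|T|.
Proof.
apply: op_norm_le => [|x]; first by rewrite mulr_ge0.
by rewrite opME; apply: le_trans (op_le _ _) _; rewrite -mulrA ler_wpM2l// op_le.
Qed.

HB.instance Definition _ := isCStarAlgebra.Build R (BH H)
  op_amulA op_amulDl op_amulDr op_ascaleAl op_ascaleAr (@adjointK R H)
  op_astarD op_astarZ op_astarM op_norm_mul (@op_starM R H).

End OperatorCStar.

(** * C*-algebras and automatic contractivity *)

Section CStarTheory.
Context (R : realType) (U : cstarAlgType R).
Implicit Types x y z : U.

Lemma amul0l x : amul 0 x = 0.
Proof. by apply: (addrI (amul 0 x)); rewrite -amulDl !addr0. Qed.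

Lemma amul0r x : amul x 0 = 0.
Proof. by apply: (addrI (amul x 0)); rewrite -amulDr !addr0. Qed.

Lemma amulNl x y : amul (- x) y = - amul x y.
Proof. by rewrite -scaleN1r -ascaleAl scaleN1r. Qed.

Lemma amulNr x y : amul x (- y) = - amul x y.
Proof. by rewrite -scaleN1r -ascaleAr scaleN1r. Qed.

Lemma amulBl x y z : amul (x - y) z = amul x z - amul y z.
Proof. by rewrite amulDl amulNl. Qed.

Lemma amulBr x y z : amul x (y - z) = amul x y - amul x z.
Proof. by rewrite amulDr amulNr. Qed.

Lemma astar0 : astar 0 = 0 :> U.
Proof. by rewrite -(scale0r 0) astarZ rmorph0 !scale0r. Qed.

Lemma astarN x : astar (- x) = - astar x.
Proof. by rewrite -scaleN1r astarZ rmorphN1 scaleN1r. Qed.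

Lemma astarB x y : astar (x - y) = astar x - astar y.
Proof. by rewrite astarD astarN. Qed.

Lemma astar_norm x : `|astar x| = `|x|.
Proof.
have le y : `|y| <= `|astar y|.
  have [->|y0] := eqVneq y 0; first by rewrite normr0.
  rewrite -(ler_pM2r (_ : 0 < `|y|)) ?normr_gt0// -expr2 -anorm_starM.
  exact: anorm_mul.
by apply/eqP; rewrite eq_le le andbT; have := le (astar x); rewrite astarK.
Qed.

Lemma tends_amul (u v : nat -> U) x y :
  tends u x -> tends v y -> tends (fun n => amul (u n) (v n)) (amul x y).
Proof.
apply: (@tends_bilin _ _ _ _ (@amul _ U) 1) => [a b c|a b c|a b|//].
- exact: amulBl.
- exact: amulBr.
- by rewrite mul1r anorm_mul.
Qed.

Lemma tends_astar (u : nat -> U) x : tends u x -> tends (astar \o u) (astar x).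
Proof.
apply: (@tends_lin _ _ _ (@astar _ U) 1) => [a b|a]; first exact: astarB.
by rewrite mul1r astar_norm.
Qed.

(** Closedness is sequential, which suits sets built from limits of sequences. On [BH H] it agrees
    with [cstar_subalgebra], by [cstar_subalgebraP]. *)
Definition star_closed (A : set U) : Prop :=
  [/\ A 0,
      forall S T, A S -> A T -> A (S + T),
      forall (c : R[i]) T, A T -> A (c *: T),
      forall S T, A S -> A T -> A (amul S T) &
      forall T, A T -> A (astar T)] /\
  forall u l, (forall n, A (u n)) -> tends u l -> A l.

End CStarTheory.

(** * Closed *-subalgebras as C*-algebras in their own right *)

Section Subalgebra.
Context (R : realType) (U : cstarAlgType R) (A : set U) (hA : star_closed A).

Definition subalg_pred : {pred U} := fun x => `[< A x >].

(** The universal property asks for a type, while [Cstar gamma] is a set. The proof [h] is a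
    parameter of the type so that the instances, which depend on closedness, can be attached to
    it. *)
Record subalg (h : star_closed A) :=
  MkSubalg { subalg_val : U ; _ : subalg_val \in subalg_pred }.

Local Notation W := (subalg hA).

HB.instance Definition _ := [isSub for @subalg_val hA].
HB.instance Definition _ := [Choice of W by <:].

Fact subalg_submod_closed : submod_closed subalg_pred.
Proof.
have [[A0 AD AZ _ _] _] := hA; split; first exact/asboolP.
by move=> c x y /asboolP Ax /asboolP Ay; apply/asboolP/AD => //; exact: AZ.
Qed.

HB.instance Definition _ :=
  GRing.isSubmodClosed.Build R[i] U subalg_pred subalg_submod_closed.
HB.instance Definition _ := [SubChoice_isSubLmodule of W by <:].

Lemma subalgP (x : W) : A (val x).
Proof. by case: x => x /= /asboolP. Qed.

Definition subalg_mk x (Ax : A x) : W := @MkSubalg hA x (asboolT Ax).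

Fact subalg_mulP (x y : W) : A (amul (val x) (val y)).
Proof. by have [[_ _ _ AM _] _] := hA; apply: AM; exact: subalgP. Qed.

Fact subalg_starP (x : W) : A (astar (val x)).
Proof. by have [[_ _ _ _ AS] _] := hA; apply: AS; exact: subalgP. Qed.

Definition subalg_mul (x y : W) : W := subalg_mk (subalg_mulP x y).

Definition subalg_star (x : W) : W := subalg_mk (subalg_starP x).

HB.instance Definition _ :=
  Lmodule_hasMulStar.Build R[i] W subalg_mul subalg_star.

Definition subalg_norm (x : W) : R[i] := `|val x|.

Fact subalg_normD (x y : W) :
  subalg_norm (x + y) <= subalg_norm x + subalg_norm y.
Proof. exact: ler_normD. Qed.

Fact subalg_normZ (c : R[i]) (x : W) :
  subalg_norm (c *: x) = `|c| * subalg_norm x.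
Proof. exact: normrZ. Qed.

Fact subalg_norm_eq0 (x : W) : subalg_norm x = 0 -> x = 0.
Proof. by move=> /eqP; rewrite normr_eq0 => /eqP x0; exact: val_inj. Qed.

HB.instance Definition _ := Lmodule_isNormed.Build R[i] W
  subalg_normD subalg_normZ subalg_norm_eq0.

Lemma subalg_normE (x : W) : `|x| = `|val x|. Proof. by []. Qed.

Fact subalg_cauchys_tends (u : nat -> W) : cauchys u -> exists l, tends u l.
Proof.
move=> uc; have [l ul] : exists l : U, tends (val \o u) l.
  exact: cauchys_tends.
have Al : A l by have [_ cA] := hA; apply: cA ul => n; exact: subalgP.
by exists (subalg_mk Al).
Qed.

HB.instance Definition _ := Uniform_isComplete.Build W
  (cauchys_complete subalg_cauchys_tends).

Fact subalg_amulA (x y z : W) : amul x (amul y z) = amul (amul x y) z.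
Proof. by apply: val_inj; exact: amulA. Qed.
Fact subalg_amulDl (x y z : W) : amul (x + y) z = amul x z + amul y z.
Proof. by apply: val_inj; exact: amulDl. Qed.
Fact subalg_amulDr (x y z : W) : amul x (y + z) = amul x y + amul x z.
Proof. by apply: val_inj; exact: amulDr. Qed.
Fact subalg_ascaleAl (c : R[i]) (x y : W) : c *: amul x y = amul (c *: x) y.
Proof. by apply: val_inj; exact: ascaleAl. Qed.
Fact subalg_ascaleAr (c : R[i]) (x y : W) : c *: amul x y = amul x (c *: y).
Proof. by apply: val_inj; exact: ascaleAr. Qed.
Fact subalg_astarK (x : W) : astar (astar x) = x.
Proof. by apply: val_inj; exact: astarK. Qed.
Fact subalg_astarD (x y : W) : astar (x + y) = astar x + astar y.
Proof. by apply: val_inj; exact: astarD. Qed.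
Fact subalg_astarZ (c : R[i]) (x : W) :
  astar (c *: x) = Num.conj c *: astar x.
Proof. by apply: val_inj; exact: astarZ. Qed.
Fact subalg_astarM (x y : W) : astar (amul x y) = amul (astar y) (astar x).
Proof. by apply: val_inj; exact: astarM. Qed.
Fact subalg_norm_mul (x y : W) : `|amul x y| <= `|x| * `|y|.
Proof. exact: anorm_mul. Qed.
Fact subalg_norm_starM (x : W) : `|amul (astar x) x| = `|x| ^+ 2.
Proof. exact: anorm_starM. Qed.

HB.instance Definition _ := isCStarAlgebra.Build R W
  subalg_amulA subalg_amulDl subalg_amulDr subalg_ascaleAl subalg_ascaleAr
  subalg_astarK subalg_astarD subalg_astarZ subalg_astarM
  subalg_norm_mul subalg_norm_starM.

End Subalgebra.

Section Contractive.
Context (R : realType).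
Notation C := R[i].

Let half : 2^-1 + 2^-1 = 1 :> C.
Proof. by rewrite [RHS](splitr 1) mul1r. Qed.

Lemma tends_geometric (r : C) : 0 <= r -> r < 1 -> tends (fun n => r ^+ n) 0.
Proof.
move=> r0 r1; have rE : r = (complex.Re r)%:C by rewrite RRe_real// ger0_real.
have s0 : 0 <= complex.Re r by rewrite -lecR -rE.
have s1 : complex.Re r < 1 by rewrite -ltcR -rE.
move=> e e0; have eE : e = (complex.Re e)%:C by rewrite RRe_real// gtr0_real.
have re0 : 0 < complex.Re e by rewrite -ltcR -eE.
have sc : `|complex.Re r : R^o| < 1 by rewrite ger0_norm.
have /cvgrPdist_lt/(_ _ re0)[N _ hN] := cvg_expr sc; exists N => n /hN.
rewrite sub0r normrN => h; rewrite subr0 rE eE -rmorphXn /= normc_def /=.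
by rewrite expr0n addr0 sqrtr_sqr ltcR.
Qed.

Section Sqrt.
Context (U : cstarAlgType R) (A : set U) (hA : star_closed A).

(** [1 - g] is a square root of [1 - a^2], the limit of the iteration
    [g := (a^2 + g^2) / 2], which is a contraction of the ball of radius [|a|]. *)
Lemma quasi_sqrt (a : U) : A a -> astar a = a -> `|a| < 1 ->
  exists g, [/\ A g, astar g = g, amul a g = amul g a &
    g + g = amul a a + amul g g].
Proof.
move=> Aa sa a1; have [[A0 AD AZ AM AS] Acl] := hA.
pose F (g : U) : U := 2^-1 *: (amul a a + amul g g).
pose u n := iter n F 0.
have h2 : (2^-1 : C) != 0 by rewrite invr_eq0.
have n2 : `|2^-1 : C| = 2^-1 by rewrite normfV normr_nat.
have uS n : u n.+1 = F (u n) by [].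
have uA n : A (u n) by elim: n => [//|n IH]; rewrite uS; apply/AZ/AD; exact: AM.
have us n : astar (u n) = u n.
  elim: n => [|n IH]; first exact: astar0.
  rewrite uS astarZ astarD !astarM IH sa; congr (_ *: _).
  by rewrite fmorphV rmorph_nat.
have uc n : amul a (u n) = amul (u n) a.
  elim: n => [|n IH]; first by rewrite amul0l amul0r.
  rewrite uS /F -ascaleAr -ascaleAl amulDl amulDr; congr (_ *: (_ + _)).
    by rewrite amulA.
  by rewrite amulA IH -amulA IH amulA.
have ule n : `|u n| <= `|a|.
  elim: n => [|n IH]; first by rewrite normr0.
  rewrite uS normrZ n2 ler_pdivrMl// mulr2n mulrDl mul1r.
  apply: le_trans (ler_normD _ _) _; apply: lerD.
    by apply: le_trans (anorm_mul _ _) _; rewrite ler_piMl// ltW.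
  apply: le_trans (anorm_mul _ _) _.
  by apply: le_trans (ler_wpM2r _ IH) _ => //; rewrite ler_piMr// (le_trans IH)// ltW.
(* One has [F x - F y = (x (x - y) + (x - y) y) / 2], whose norm is at most [|a| |x - y|] on the
   ball of radius [|a|]. *)
have ud n k : `|u (k + n)%N - u n| <= `|a| ^+ n.
  elim: n => [|n IH]; first by rewrite subr0 expr0; apply: le_trans (ule _) (ltW _).
  rewrite addnS !uS /F -scalerBr normrZ n2 ler_pdivrMl//.
  rewrite opprD addrACA subrr add0r.
  have -> : amul (u (k + n)%N) (u (k + n)%N) - amul (u n) (u n) =
    amul (u (k + n)%N) (u (k + n)%N - u n) + amul (u (k + n)%N - u n) (u n).
    by rewrite amulBl amulBr addrA subrK.
  apply: le_trans (ler_normD _ _) _; rewrite mulr2n mulrDl mul1r exprS.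
  apply: lerD; apply: le_trans (anorm_mul _ _) _.
    exact: ler_pM.
  by rewrite mulrC; exact: ler_pM.
have ucau : cauchys u.
  move=> e e0; have [N hN] := tends_geometric (normr_ge0 a) a1 (divr_gt0 e0 (ltr0n _ 2)).
  have {}hN : `|a| ^+ N < e / 2.
    by have := hN N (leqnn _); rewrite subr0 ger0_norm ?exprn_ge0.
  have uN m : (N <= m)%N -> `|u m - u N| < e / 2.
    by move=> Nm; apply: le_lt_trans hN; rewrite -(subnK Nm).
  exists N => m n /uN hm /uN hn; rewrite -(subrKA (u N)) (splitr e).
  apply: le_lt_trans (ler_normD _ _) _; apply: ltrD => //.
  by rewrite distrC.
have [g ug] := cauchys_tends ucau; exists g; split.
- exact: Acl ug.
- by apply: tends_unique (tends_astar ug) _; apply: tends_eq ug _ => n /=.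
- apply: tends_unique (tends_amul (tends_cst _) ug) _.
  exact: tends_eq (tends_amul ug (tends_cst a)) _.
- apply: (@tends_unique _ _ (fun n => u n.+1 + u n.+1)).
    have ug' : tends (fun n => u n.+1) g by exact: (tends_sub _ ug).
    exact: tendsD.
  apply: tends_eq (tendsD (tends_cst (amul a a)) (tends_amul ug ug)) _ => n.
  by rewrite uS /F -scalerDl half scale1r.
Qed.

End Sqrt.

Section Isometric.
Context (V : cstarAlgType R).

(** [c x + i (1 - d) x] and [c x - i (1 - d) x] have the norm of [x], because
    [c^2 + (1 - d)^2 = 1]. *)
Lemma quasi_unitary_le (c d x : V) : astar c = c -> astar d = d ->
  amul c d = amul d c -> d + d = amul c c + amul d d -> `|amul c x| <= `|x|.
Proof.
move=> sc sd cd dd; pose y := x - amul d x.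
(* Expand [|c x + e y|^2] by the C*-identity, where [y] stands for [(1 - d) x]. The two mixed terms
   agree because [c] and [d] commute, so they cancel by [e + conj e = 0]; what remains is
   [x* (c^2 + (1 - d)^2) x = x* x]. *)
have iso (e : C) : e * Num.conj e = 1 -> e + Num.conj e = 0 ->
    `|amul c x + e *: y| = `|x|.
  move=> e1 e0; apply/eqP; rewrite -(@eqrXn2 _ 2)// -!anorm_starM; apply/eqP.
  congr (`|_|); rewrite astarD astarZ amulDl !amulDr.
  rewrite -!ascaleAr -!ascaleAl scalerA e1 scale1r.
  have -> : amul (astar (amul c x)) y = amul (astar y) (amul c x).
    rewrite /y astarB !astarM sc sd amulBr amulBl -!amulA; congr (_ - _).
    by rewrite !amulA -(amulA _ c d) cd !amulA.
  rewrite (addrC (_ *: _) (amul _ _)) addrACA -scalerDl e0 scale0r addr0.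
  have h : amul (astar x) (amul c (amul c x)) + amul (astar x) (amul d (amul d x))
      = amul (astar x) (amul d x) + amul (astar x) (amul d x).
    by rewrite -amulDr -[RHS]amulDr (amulA c) (amulA d) -[in LHS]amulDl -dd -amulDl.
  rewrite /y astarB !astarM sc sd amulBl !amulBr -!amulA.
  rewrite opprB addrC addrA addrAC -!addrA addrA.
  by rewrite (addrC (amul _ (amul d (amul d _)))) h addKr subrK.
have iC : Num.conj ('i : C) = - 'i by rewrite conjCi.
have ii : 'i * Num.conj ('i : C) = 1 by rewrite iC mulrN -expr2 sqrCi opprK.
have h1 := iso 'i ii; have h2 := iso (- 'i).
have E : amul c x = 2^-1 *: ((amul c x + 'i *: y) + (amul c x + - 'i *: y)).
  by rewrite scaleNr addrACA subrr addr0 scalerDr -scalerDl half scale1r.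
rewrite {}E normrZ normfV normr_nat ler_pdivrMl//.
apply: le_trans (ler_normD _ _) _; rewrite h1 ?h2.
- by rewrite mulr2n mulrDl mul1r.
- by rewrite rmorphN /= mulrNN.
- by rewrite rmorphN /= iC opprK addNr.
- by rewrite iC subrr.
Qed.

End Isometric.

Section StarHom.
Context (U V : cstarAlgType R) (A : set U) (hA : star_closed A).
Context (B : set V) (f : U -> V) (hf : star_hom_on A B f).

Lemma star_hom_contractive x : A x -> `|f x| <= `|x|.
Proof.
have [[A0 AD AZ AM AS] Acl] := hA; have [_ fD fZ fM fS] := hf.
have unit_ball a : A a -> astar a = a -> `|a| < 1 -> `|f a| <= 1.
  move=> Aa sa a1; have [g [Ag sg ag gg]] := quasi_sqrt hA Aa sa a1.
  have sfa : astar (f a) = f a by rewrite -fS// sa.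
  (* [quasi_unitary_le] is applied to the vector [x = f a] itself. As [f a] is self-adjoint, this
     reads [|f a|^2 <= |f a|]. *)
  have le1 : `|amul (f a) (f a)| <= `|f a|.
    apply: (@quasi_unitary_le _ _ (f g)) => //.
    - by rewrite -fS// sg.
    - by rewrite -!fM// ag.
    - by rewrite -!fM// -!fD//; [rewrite gg|exact: AM|exact: AM].
  have [->|fa0] := eqVneq (f a) 0; first by rewrite normr0.
  rewrite -(ler_pM2r (_ : 0 < `|f a|)) ?normr_gt0// -expr2 mul1r.
  by rewrite -anorm_starM sfa.
have self_adjoint a : A a -> astar a = a -> `|f a| <= `|a|.
  move=> Aa sa; rewrite real_leNgt ?normr_real//; apply/negP => lt_a.
  have fa : 0 < `|f a| by exact: le_lt_trans lt_a.
  (* A number strictly between [|a|] and [|f a|]: dividing [a] by it gives an element of norm below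
     1 whose image has norm above 1. *)
  pose t := (`|a| + `|f a|) / 2.
  have t0 : 0 < t by rewrite divr_gt0// ltr_wpDl.
  have at_ : `|a| < t by rewrite ltr_pdivlMr// mulr_natr mulr2n ltrD2l.
  have tf : t < `|f a| by rewrite ltr_pdivrMr// mulr_natr mulr2n ltrD2r.
  have tr : Num.conj t^-1 = t^-1 by rewrite conj_Creal ?realV ?gtr0_real.
  have nt : `|t^-1| = t^-1 by rewrite ger0_norm// invr_ge0 ltW.
  have := unit_ball (t^-1 *: a) (AZ _ _ Aa).
  rewrite astarZ tr sa normrZ nt ltr_pdivrMl// mulr1 => /(_ erefl at_).
  by rewrite fZ// normrZ nt ler_pdivrMl// mulr1 real_leNgt ?gtr0_real// tf.
move=> Ax; rewrite -(@ler_pXn2r _ 2)// ?nnegrE// -!anorm_starM -fS// -fM//; last first.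
  exact: AS.
by apply: self_adjoint; [exact/AM/Ax/AS|rewrite astarM astarK].
Qed.

Lemma star_homN x : A x -> f (- x) = - f x.
Proof. by move=> Ax; have [_ _ fZ _ _] := hf; rewrite -scaleN1r fZ// scaleN1r. Qed.

Lemma star_closedB x y : A x -> A y -> A (x - y).
Proof.
have [[_ AD AZ _ _] _] := hA => Ax Ay; apply: AD => //.
by rewrite -scaleN1r; exact: AZ.
Qed.

Lemma star_homB x y : A x -> A y -> f (x - y) = f x - f y.
Proof.
move=> Ax Ay; have [_ fD _ _ _] := hf; have [[_ _ AZ _ _] _] := hA.
by rewrite fD// ?star_homN// -scaleN1r; exact: AZ.
Qed.

Lemma tends_star_hom (u : nat -> U) x :
  (forall n, A (u n)) -> tends u x -> tends (fun n => f (u n)) (f x).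
Proof.
move=> Au ux; have Ax : A x by have [_ Acl] := hA; exact: Acl ux.
apply: tends_le (tends_dist ux) => n.
by rewrite -star_homB//; apply: star_hom_contractive; exact: star_closedB.
Qed.

End StarHom.

End Contractive.

(** * Extension of *-homomorphisms from dense subsets *)

Section QiEmbed.
Context (R : realType).
Notation emb := (Qi_embed R).

Lemma Qi_embedD (x y : rat[i]) : emb (x + y) = emb x + emb y.
Proof. by case: x y => a b [c d]; rewrite /Qi_embed /= !rmorphD. Qed.

Lemma Qi_embedN (x : rat[i]) : emb (- x) = - emb x.
Proof. by case: x => a b; rewrite /Qi_embed /= !rmorphN. Qed.

Lemma Qi_embed0 : emb 0 = 0.
Proof. by rewrite /Qi_embed /= rmorph0. Qed.

Lemma Qi_embed1 : emb 1 = 1.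
Proof. by rewrite /Qi_embed /= rmorph1 rmorph0. Qed.

Lemma Qi_embedM (x y : rat[i]) : emb (x * y) = emb x * emb y.
Proof.
case: x y => a b [c d]; rewrite /Qi_embed /=.
by rewrite rmorphB rmorphD !rmorphM.
Qed.

Lemma Qi_embed_conj (x : rat[i]) :
  emb (complex.Re x -i* complex.Im x) = Num.conj (emb x).
Proof. by case: x => a b; rewrite /Qi_embed /= rmorphN. Qed.

Lemma Qi_dense (z : R[i]) : exists q : nat -> rat[i], tends (fun n => emb (q n)) z.
Proof.
have appr (a : R) (n : nat) : exists q : rat, `|ratr q - a| < n.+1%:R^-1.
  have h : a - n.+1%:R^-1 < a + n.+1%:R^-1.
    by rewrite ltrBlDr -addrA ltrDl -mulr2n pmulrn_lgt0// invr_gt0.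
  have [q] := rat_in_itvoo h; rewrite in_itv /= => /andP[h1 h2]; exists q.
  by rewrite ltr_distl h1 h2.
have /choice[p pP] := appr (complex.Re z).
have /choice[q qP] := appr (complex.Im z).
exists (fun n => p n +i* q n).
apply: (@tends_le _ _ _ (fun n => n.+1%:R^-1 + n.+1%:R^-1)); last first.
  by rewrite -(addr0 0); apply: tendsD; exact: tends_inv.
move=> n; have nE : (n.+1%:R^-1 : R[i]) = (n.+1%:R^-1)%:C.
  by rewrite fmorphV rmorph_nat.
have -> : emb (p n +i* q n) - z =
    (ratr (p n) - complex.Re z)%:C + 'i%C * (ratr (q n) - complex.Im z)%:C.
  by case: z {pP qP} => a b; simpc.
apply: le_trans (ler_normD _ _) _; rewrite normrM.
rewrite nE; apply: lerD; first by rewrite normc_def /= expr0n addr0 sqrtr_sqr lecR ltW.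
rewrite normc_def /= expr0n add0r expr1n sqrtr1 mul1r.
by rewrite normc_def /= expr0n addr0 sqrtr_sqr lecR ltW.
Qed.

End QiEmbed.

Section Graph.
Context (R : realType) (U V : cstarAlgType R) (G : U -> V -> Prop) (K : R[i]).
Hypothesis K0 : 0 <= K.
Hypothesis G0 : G 0 0.
Hypothesis GD : forall x y x' y', G x y -> G x' y' -> G (x + x') (y + y').
Hypothesis GZ : forall q x y, G x y -> G (Qi_embed R q *: x) (Qi_embed R q *: y).
Hypothesis GM : forall x y x' y', G x y -> G x' y' -> G (amul x x') (amul y y').
Hypothesis GS : forall x y, G x y -> G (astar x) (astar y).
Hypothesis GK : forall x y, G x y -> `|y| <= K * `|x|.

(** [G] is a relation because its pairs come from names (indices of *-polynomials, or elements of
    stages), several of which may name the same element. Single-valuedness is a consequence of the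
    bound [GK] applied to differences. *)
Definition graph_dom : set U :=
  [set x | exists u v, (forall n, G (u n) (v n)) /\ tends u x].

Definition graph_fun (x : U) : V :=
  xget 0 [set y | exists u v,
    [/\ forall n, G (u n) (v n), tends u x & tends v y]].

Let GB x y x' y' : G x y -> G x' y' -> G (x - x') (y - y').
Proof.
move=> Gx Gx'; apply: GD => //.
by have := GZ (- 1) Gx'; rewrite Qi_embedN Qi_embed1 !scaleN1r.
Qed.

(** By [GK] the values over a convergent sequence are Cauchy, and those over two sequences with the
    same limit differ by a null sequence. Hence the choice in [graph_fun] may be evaluated along any
    approximating sequence. *)
Lemma graph_funP u v x :
  (forall n, G (u n) (v n)) -> tends u x -> tends v (graph_fun x).
Proof.
move=> Guv ux.
have [y vy] : exists y, tends v y.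
  apply: cauchys_tends => e e0; have K1 : 0 < K + 1 by rewrite ltr_wpDl.
  have [N hN] := tends_cauchys ux (divr_gt0 e0 K1); exists N => m n Nm Nn.
  apply: le_lt_trans (GK (GB (Guv m) (Guv n))) _.
  have := hN m n Nm Nn; rewrite ltr_pdivlMr// mulrC; apply: le_lt_trans.
  by apply: ler_wpM2r => //; rewrite lerDl.
have : exists y, exists u v, [/\ forall n, G (u n) (v n), tends u x & tends v y].
  by exists y, u, v.
move=> /(xgetPex (0 : V)); rewrite -/(graph_fun x).
move=> [u' [v' [Guv' u'x v'y]]].
suff <- : y = graph_fun x by [].
apply/eqP; rewrite -subr_eq0; apply/eqP.
apply: (tends_unique (tendsB vy v'y)).
apply: (@tends_le _ _ _ (fun n => K * `|u n - u' n|)).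
  by move=> n; rewrite subr0; apply: GK; exact: GB.
apply: tends_mul0.
by have := tends_norm (tendsB ux u'x); rewrite subrr normr0.
Qed.

Lemma graph_fun_dom x y : G x y -> graph_dom x.
Proof. by move=> Gxy; exists (fun=> x), (fun=> y); split=> //; exact: tends_cst. Qed.

Lemma graph_funE x y : G x y -> graph_fun x = y.
Proof.
move=> Gxy; apply: (@tends_unique _ _ (fun=> y)); last exact: tends_cst.
by apply: (@graph_funP (fun=> x)) => //; exact: tends_cst.
Qed.

Lemma graph_fun_hom : star_hom_on graph_dom [set: V] graph_fun.
Proof.
split=> //.
- move=> x y [u [v [Guv ux]]] [u' [v' [Guv' uy]]].
  have vx := graph_funP Guv ux; have vy := graph_funP Guv' uy.
  apply: (@tends_unique _ _ (fun n => v n + v' n)); last exact: tendsD.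
  by apply: graph_funP (tendsD ux uy) => n; exact: GD.
- move=> c x [u [v [Guv ux]]]; have vx := graph_funP Guv ux.
  have [q qc] := Qi_dense c.
  apply: (@tends_unique _ _ (fun n => Qi_embed R (q n) *: v n)).
    by apply: graph_funP (tends_scale qc ux) => n; exact: GZ.
  exact: tends_scale.
- move=> x y [u [v [Guv ux]]] [u' [v' [Guv' uy]]].
  have vx := graph_funP Guv ux; have vy := graph_funP Guv' uy.
  apply: (@tends_unique _ _ (fun n => amul (v n) (v' n))); last exact: tends_amul.
  by apply: graph_funP (tends_amul ux uy) => n; exact: GM.
- move=> x [u [v [Guv ux]]]; have vx := graph_funP Guv ux.
  apply: (@tends_unique _ _ (astar \o v)); last exact: tends_astar.
  by apply: graph_funP (tends_astar ux) => n; exact: GS.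
Qed.

(** Scalars are reached through the density of Q(i), limits by a diagonal choice within [1/(n+1)].
    For a diagonal relation [G] the lemma says that the closure of a *-closed Q(i)-subspace is a
    C*-algebra. *)
Lemma graph_dom_closed : star_closed graph_dom.
Proof.
split; first split.
- exact: graph_fun_dom G0.
- move=> x y [u [v [Guv ux]]] [u' [v' [Guv' uy]]].
  exists (fun n => u n + u' n), (fun n => v n + v' n).
  by split; [move=> n; exact: GD|exact: tendsD].
- move=> c x [u [v [Guv ux]]]; have [q qc] := Qi_dense c.
  exists (fun n => Qi_embed R (q n) *: u n), (fun n => Qi_embed R (q n) *: v n).
  by split; [move=> n; exact: GZ|exact: tends_scale].
- move=> x y [u [v [Guv ux]]] [u' [v' [Guv' uy]]].
  exists (fun n => amul (u n) (u' n)), (fun n => amul (v n) (v' n)).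
  by split; [move=> n; exact: GM|exact: tends_amul].
- move=> x [u [v [Guv ux]]]; exists (astar \o u), (astar \o v).
  by split; [move=> n; exact: GS|exact: tends_astar].
move=> w l wdom wl.
have /choice[u uP] n : exists u, (exists v, G u v) /\ `|u - w n| < n.+1%:R^-1.
  have [u [v [Guv /(_ n.+1%:R^-1)[]]]] := wdom n; first by rewrite invr_gt0.
  by move=> N hN; exists (u N); split; [exists (v N)|exact: hN].
have /choice[v vP] n : exists v, G (u n) v by have [] := uP n.
exists u, v; split=> //; apply: (@tends_le _ _ _ (fun n => n.+1%:R^-1 + `|w n - l|)).
  move=> n; rewrite -(subrKA (w n)); apply: le_trans (ler_normD _ _) _.
  by rewrite lerD2r ltW//; have [] := uP n.
by rewrite -(addr0 0); apply: tendsD; [exact: tends_inv|exact: tends_dist].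
Qed.

Lemma graph_fun_in (B : set V) :
  (forall u l, (forall n, B (u n)) -> tends u l -> B l) ->
  (forall x y, G x y -> B y) -> forall x, graph_dom x -> B (graph_fun x).
Proof.
move=> Bcl GinB x [u [v [Guv ux]]].
by apply: Bcl (graph_funP Guv ux) => n; exact: GinB (Guv n).
Qed.

End Graph.

(** * Generated C*-algebras and evaluations of *-polynomials *)

Section Generated.
Context (R : realType) (H : hilbertType R).
Implicit Types (A : set (BH H)) (gamma : nat -> BH H).

Lemma closed_tends A : closed A ->
  forall u l, (forall n, A (u n)) -> tends u l -> A l.
Proof.
move=> Acl u l Au /cvg_tends ul; apply: Acl => B /ul [N _ hN].
by exists (u N); split=> //; apply: hN => /=.
Qed.

Lemma tends_closed A :
  (forall u l, (forall n, A (u n)) -> tends u l -> A l) -> closed A.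
Proof.
move=> Acl x clx.
have /choice[u uP] (n : nat) : exists y, A y /\ `|y - x| < n.+1%:R^-1.
  have e0 : 0 < n.+1%:R^-1 :> R[i] by rewrite invr_gt0.
  have [y [Ay]] := clx _ (nbhsx_ballx x _ e0).
  by rewrite -ball_normE /= distrC => xy; exists y.
apply: (Acl u) => [n|]; first by have [] := uP n.
apply: (@tends_le _ _ _ (fun n => n.+1%:R^-1)); last exact: tends_inv.
by move=> n; rewrite ltW//; have [] := uP n.
Qed.

Lemma cstar_subalgebraP A : cstar_subalgebra A <-> star_closed A.
Proof.
by split=> -[h cA]; split=> //; [exact: closed_tends|exact: tends_closed].
Qed.

Lemma Cstar_star_closed gamma : star_closed (Cstar gamma).
Proof.
apply/cstar_subalgebraP; split; last first.
  apply: tends_closed => u l Au ul A hA; have [[_ cA] _] := hA.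
  by apply: (closed_tends cA _ ul) => n; exact: Au.
split.
- by move=> A [[[]]].
- move=> S T hS hT A hA; have [[[_ AD _ _ _] _] _] := hA.
  by apply: AD; [exact: hS|exact: hT].
- by move=> c T hT A hA; have [[[_ _ AZ _ _] _] _] := hA; apply: AZ; exact: hT.
- move=> S T hS hT A hA; have [[[_ _ _ AM _] _] _] := hA.
  by apply: AM; [exact: hS|exact: hT].
- by move=> T hT A hA; have [[[_ _ _ _ AS] _] _] := hA; apply: AS; exact: hT.
Qed.

Lemma Cstar_gen gamma k : Cstar gamma (gamma k).
Proof. by move=> A [_]; apply; exists k. Qed.

Lemma Cstar_min gamma A : star_closed A -> (forall k, A (gamma k)) ->
  Cstar gamma `<=` A.
Proof.
move=> /cstar_subalgebraP hA gA; apply: smallest_sub => // _ [k _ <-]; exact: gA.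
Qed.

Section EvalList.

(** Formal sums in which words may repeat: closure of the evaluations under the algebraic operations
    becomes manipulation of lists. *)
Definition eval_list gamma (l : seq (rat[i] * word)) : BH H :=
  \sum_(cw <- l) Qi_embed R cw.1 *: eval_word gamma cw.2.

Lemma eval_sup gamma (P : starpoly) (S : {fset word}) : (finsupp P `<=` S)%fset ->
  eval gamma P = \sum_(w <- S) Qi_embed R (P w) *: eval_word gamma w.
Proof.
move=> PS; rewrite /eval (big_fset_incl _ PS)//= => w _ wP.
by rewrite fsfun_dflt// Qi_embed0 scale0r.
Qed.

Lemma eval_listP gamma (P : starpoly) : exists l, eval gamma P = eval_list gamma l.
Proof.
by exists [seq (P w, w) | w <- finsupp P]; rewrite /eval_list big_map.
Qed.

(** The order of the quantifiers matters: [P] serves all [gamma] at once, and through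
    [eval_variable] this makes the final codes the same for all systems. *)
Lemma eval_list_eval l : exists P, forall gamma, eval gamma P = eval_list gamma l.
Proof.
elim: l => [|[c w] l [P PE]].
  exists [fsfun] => gamma; rewrite /eval_list big_nil /eval.
  by rewrite finsupp0 big_seq_fset0.
pose S := (w |` finsupp P)%fset.
pose Q : starpoly := [fsfun v in S => P v + (if v == w then c else 0)].
exists Q => gamma.
have QS : (finsupp Q `<=` S)%fset by exact: finsupp_sub.
have PS : (finsupp P `<=` S)%fset by exact: fsubsetUr.
rewrite (eval_sup _ QS) /eval_list big_cons -/(eval_list gamma l) -PE (eval_sup _ PS).
rewrite (eq_big_seq (fun v => Qi_embed R (P v) *: eval_word gamma v +
   (if v == w then Qi_embed R c *: eval_word gamma w else 0))); last first.
  move=> v vS; rewrite fsfunE vS Qi_embedD scalerDl; congr (_ + _).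
  by case: eqP => [->//|_]; rewrite Qi_embed0 scale0r.
rewrite big_split /= addrC; congr (_ + _).
rewrite (bigD1_seq w) ?fset_uniq//= ?fset1U1// eqxx big1 ?addr0// => v /negPf ->.
by [].
Qed.

End EvalList.

Section Eval.
Variable gamma : nat -> BH H.

Definition evals : set (BH H) := range (eval gamma).

Lemma evalsP T : evals T <-> exists l, T = eval_list gamma l.
Proof.
split=> [[P _ <-]|[l ->]]; first exact: eval_listP.
by have [P PE] := eval_list_eval l; exists P.
Qed.

Lemma evals0 : evals 0.
Proof. by apply/evalsP; exists [::]; rewrite /eval_list big_nil. Qed.

Lemma evalsD S T : evals S -> evals T -> evals (S + T).
Proof.
move=> /evalsP[l ->] /evalsP[m ->]; apply/evalsP; exists (l ++ m).
by rewrite /eval_list big_cat.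
Qed.

Lemma evalsZ q T : evals T -> evals (Qi_embed R q *: T).
Proof.
move=> /evalsP[l ->]; apply/evalsP; exists [seq (q * cw.1, cw.2) | cw <- l].
rewrite /eval_list big_map scaler_sumr; apply: eq_bigr => cw _ /=.
by rewrite Qi_embedM scalerA.
Qed.

Lemma evals_word w : evals (eval_word gamma w).
Proof.
apply/evalsP; exists [:: (1, w)].
by rewrite /eval_list big_seq1 Qi_embed1 scale1r.
Qed.

Lemma evals_gen k : evals (gamma k).
Proof. exact: (evals_word ((k, false), [::])). Qed.

Lemma eval_word_cat v w :
  amul (eval_word gamma v) (eval_word gamma w) =
  eval_word gamma (v.1, v.2 ++ w.1 :: w.2).
Proof.
case: v w => a s [b t] /=; rewrite /eval_word /= foldl_cat /=.
elim/last_ind: t => [//|t c IH].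
by rewrite !foldl_rcons amulA IH.
Qed.

Lemma eval_word_star w : exists v, astar (eval_word gamma w) = eval_word gamma v.
Proof.
have let_star a : astar (eval_letter gamma a) = eval_letter gamma (a.1, ~~ a.2).
  by case: a => k [] /=; rewrite /eval_letter /= ?astarK.
case: w => a s; elim/last_ind: s => [|s b [v IH]].
  by exists ((a.1, ~~ a.2), [::]); rewrite /eval_word /= let_star.
exists ((b.1, ~~ b.2), v.1 :: v.2).
rewrite /eval_word /= foldl_rcons astarM let_star.
rewrite -[foldl _ _ _]/(eval_word gamma (a, s)) IH.
by rewrite -[eval_letter _ _]/(eval_word gamma ((b.1, ~~ b.2), [::])) eval_word_cat.
Qed.

Lemma evals_sum I (r : seq I) (F : I -> BH H) :
  (forall i, evals (F i)) -> evals (\sum_(i <- r) F i).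
Proof. by move=> EF; elim/big_rec: _ => [|i T _]; [exact: evals0|exact: evalsD]. Qed.

Lemma evalsM S T : evals S -> evals T -> evals (amul S T).
Proof.
move=> /evalsP[l ->] /evalsP[m ->].
have -> : amul (eval_list gamma l) (eval_list gamma m) = \sum_(v <- l) \sum_(w <- m)
    Qi_embed R (v.1 * w.1) *: eval_word gamma (v.2.1, v.2.2 ++ w.2.1 :: w.2.2).
  rewrite /eval_list; elim/big_rec2: _ => [|v T1 T2 _ <-]; first exact: amul0l.
  rewrite amulDl; congr (_ + _).
  elim/big_rec2: _ => [|w S1 S2 _ <-]; first exact: amul0r.
  by rewrite amulDr -ascaleAl -ascaleAr eval_word_cat scalerA Qi_embedM.
apply: evals_sum => v; apply: evals_sum => w; apply: evalsZ; exact: evals_word.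
Qed.

Lemma evalsS T : evals T -> evals (astar T).
Proof.
move=> /evalsP[l ->].
have -> : astar (eval_list gamma l) =
    \sum_(v <- l) Num.conj (Qi_embed R v.1) *: astar (eval_word gamma v.2).
  rewrite /eval_list; elim/big_rec2: _ => [|v T1 T2 _ <-]; first exact: astar0.
  by rewrite astarD astarZ.
apply: evals_sum => v; rewrite -Qi_embed_conj; apply: evalsZ.
by have [w ->] := eval_word_star v.2; exact: evals_word.
Qed.

Lemma evals_Cstar T : evals T -> Cstar gamma T.
Proof.
have [[A0 AD AZ AM AS] _] := Cstar_star_closed gamma.
have Alet a : Cstar gamma (eval_letter gamma a).
  by case: a => k [] /=; rewrite /eval_letter /=; [apply: AS|]; exact: Cstar_gen.
move=> /evalsP[l ->]; rewrite /eval_list.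
elim/big_rec: _ => [//|[c [a s]] S _ AS']; apply: AD => //; apply: AZ => /=.
rewrite /eval_word /=; elim/last_ind: s => [|s b IH]; first exact: Alet.
by rewrite foldl_rcons; apply: AM.
Qed.

(** The limits of evaluations form the domain of the closed diagonal relation over [evals]. This is
    a C*-algebra by [graph_dom_closed] and contains the generators, so minimality of [Cstar gamma]
    applies. *)
Lemma Cstar_evals T : Cstar gamma T ->
  exists u : nat -> BH H, (forall n, evals (u n)) /\ tends u T.
Proof.
pose G (S T : BH H) := S = T /\ evals S.
have Gcl : star_closed (graph_dom G).
  apply: (@graph_dom_closed _ _ _ G).
  - by split=> //; exact: evals0.
  - by move=> S S' T1 T2 [<- ES] [<- ET]; split=> //; exact: evalsD.
  - by move=> q S S' [<- ES]; split=> //; exact: evalsZ.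
  - by move=> S S' T1 T2 [<- ES] [<- ET]; split=> //; exact: evalsM.
  - by move=> S S' [<- ES]; split=> //; exact: evalsS.
move=> /(Cstar_min Gcl)[k|u [v [Guv uT]]].
  exists (fun=> gamma k), (fun=> gamma k).
  by split; [split=> //; exact: evals_gen|exact: tends_cst].
by exists u; split=> // n; have [] := Guv n.
Qed.

End Eval.

Lemma eval_variable k : exists P, forall gamma, eval gamma P = gamma k.
Proof.
have [P PE] := eval_list_eval [:: (1, ((k, false), [::]))]; exists P => gamma.
by rewrite PE /eval_list big_seq1 Qi_embed1 scale1r.
Qed.

End Generated.

(** * The *-homomorphism of a code *)

Section Hat.
Context (R : realType) (H : hilbertType R) (p : nat -> starpoly).
Hypothesis p_enum : forall P : starpoly, exists j, p j = P.
Implicit Types (gamma : nat -> BH H) (Phi : nat -> nat -> nat).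

Lemma evals_enum gamma T : evals gamma T <-> exists m, T = eval gamma (p m).
Proof.
split=> [[P _ <-]|[m ->]]; last by exists (p m).
by have [m <-] := p_enum P; exists m.
Qed.

Lemma Cstar_enum gamma T : Cstar gamma T ->
  exists m : nat -> nat, tends (fun n => eval gamma (p (m n))) T.
Proof.
move=> /Cstar_evals[u [Eu uT]].
have /choice[m mP] n : exists m, u n = eval gamma (p m) by exact/evals_enum.
by exists m; exact: tends_eq uT mP.
Qed.

Lemma code_lim_tends gamma' Phi m : cauchy (code_seq p gamma' Phi m @ \oo) ->
  tends (code_seq p gamma' Phi m) (code_lim p gamma' Phi m).
Proof. by move=> /cauchy_cvg h; apply/cvg_tends. Qed.

Lemma code_lim_eq gamma' Phi m T : tends (code_seq p gamma' Phi m) T ->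
  code_lim p gamma' Phi m = T.
Proof. by move=> /cvg_tends; exact: (cvg_lim (@norm_hausdorff _ _)). Qed.

Section HatSpec.
Context (gamma gamma' : nat -> BH H) (Phi : nat -> nat -> nat).
Hypothesis hR : Rhom p gamma gamma' Phi.

(** The pairs [(P m, a m)] form a relation to which the extension by continuity applies. The
    algebraic clauses of [Rhom] close it under the operations, with [p_enum] naming each result by
    an index; the norm clause is the bound with constant 1. *)
Let hatP : star_hom_on (Cstar gamma) (Cstar gamma') (hat p gamma gamma' Phi) /\
  forall m, hat p gamma gamma' Phi (eval gamma (p m)) = code_lim p gamma' Phi m.
Proof.
have [cau h] := hR; set a := code_lim p gamma' Phi in h *.
pose P m := eval gamma (p m).
pose G (x y : BH H) := exists m, x = P m /\ y = a m.
have ex T : evals gamma T -> exists m, T = P m by move=> /evals_enum.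
have EP m : evals gamma (P m) by apply/evals_enum; exists m.
have ale m : `|a m| <= `|P m| by have [] := h m 0 0 0.
have G0 : G 0 0.
  have [m mE] := ex _ (evals0 gamma); exists m; split=> //.
  by have := ale m; rewrite -mE normr0 normr_le0 => /eqP.
have GD x y x' y' : G x y -> G x' y' -> G (x + x') (y + y').
  move=> [m [-> ->]] [n [-> ->]].
  have [k kE] := ex _ (evalsD (EP m) (EP n)); exists k; split=> //.
  by have [/(_ kE)] := h m n k 0.
have GZ q x y : G x y -> G (Qi_embed R q *: x) (Qi_embed R q *: y).
  move=> [m [-> ->]]; have [k kE] := ex _ (evalsZ q (EP m)); exists k; split=> //.
  by have [_ /(_ (esym kE))] := h k m 0 q.
have GM x y x' y' : G x y -> G x' y' -> G (amul x x') (amul y y').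
  move=> [m [-> ->]] [n [-> ->]].
  have [k kE] := ex _ (evalsM (EP m) (EP n)); exists k; split=> //.
  by have [_ _ /(_ kE)] := h m n k 0.
have GS x y : G x y -> G (astar x) (astar y).
  move=> [m [-> ->]]; have [k kE] := ex _ (evalsS (EP m)); exists k; split=> //.
  by have [_ _ _ /(_ kE)] := h m 0 k 0.
have GK x y : G x y -> `|y| <= 1 * `|x|.
  by move=> [m [-> ->]]; rewrite mul1r.
have dom : Cstar gamma `<=` graph_dom G.
  move=> T /Cstar_enum[m mT]; exists (P \o m), (a \o m).
  by split=> // n; exists (m n).
have [_ fD fZ fM fS] := graph_fun_hom ler01 GD GZ GM GS GK.
have [_ Ccl] := Cstar_star_closed gamma'.
apply: (@xgetPex _ (fun=> 0) [set f | star_hom_on (Cstar gamma) (Cstar gamma') f /\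
    forall m, f (eval gamma (p m)) = a m]).
exists (graph_fun G); split; last first.
  by move=> m; apply: (@graph_funE _ _ _ G 1 ler01 GD GZ GK); exists m.
split=> [x /dom xd|x y /dom xd /dom yd|c x /dom xd|x y /dom xd /dom yd|x /dom xd].
- apply: (graph_fun_in ler01 GD GZ GK Ccl) xd => S T [m [_ ->]].
  apply: Ccl (code_lim_tends (cau m)) => n.
  by apply: evals_Cstar; apply/evals_enum; exists (Phi m n).
- exact: fD.
- exact: fZ.
- exact: fM.
- exact: fS.
Qed.

Lemma hat_hom : star_hom_on (Cstar gamma) (Cstar gamma') (hat p gamma gamma' Phi).
Proof. by have [] := hatP. Qed.

Lemma hat_eval m :
  hat p gamma gamma' Phi (eval gamma (p m)) = code_lim p gamma' Phi m.
Proof. by have [] := hatP. Qed.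

End HatSpec.

End Hat.

(** * A criterion for direct limits *)

Section DirectLimitCriterion.
Context (R : realType) (U W : cstarAlgType R).
Context (A : nat -> set U) (phi : nat -> U -> U) (D : set W) (psi : nat -> U -> W).
Context (K : R[i]).

Fixpoint iter_map n j : U -> U :=
  if j is j'.+1 then phi (n + j')%N \o iter_map n j' else id.

Hypothesis K0 : 0 <= K.
Hypothesis hA : forall n, star_closed (A n).
Hypothesis hD : star_closed D.
Hypothesis hphi : forall n, star_hom_on (A n) (A n.+1) (phi n).
Hypothesis hpsi : forall n, star_hom_on (A n) D (psi n).
Hypothesis psi_phi : forall n x, A n x -> psi n.+1 (phi n x) = psi n x.
Hypothesis psi_dense : forall y, D y -> exists u : nat -> W,
  (forall k, exists n x, A n x /\ u k = psi n x) /\ tends u y.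
Hypothesis psi_lower : forall n x, A n x -> forall e : R[i], 0 < e ->
  exists j, `|iter_map n j x| <= K * `|psi n x| + e.

Lemma iter_map_in n j x : A n x -> A (n + j)%N (iter_map n j x).
Proof.
move=> Ax; elim: j => [|j IH]; first by rewrite addn0.
by rewrite addnS; have [+ _ _ _ _] := hphi (n + j)%N; apply.
Qed.

Lemma iter_map_cocone (B : Type) (chi : nat -> U -> B) :
  (forall n x, A n x -> chi n.+1 (phi n x) = chi n x) ->
  forall n j x, A n x -> chi (n + j)%N (iter_map n j x) = chi n x.
Proof.
move=> h n j x Ax; elim: j => [|j IH]; first by rewrite addn0.
by rewrite addnS /= h//; exact: iter_map_in.
Qed.

Let L : cstarAlgType R := subalg hD.

Let toL (y : W) : L := insubd 0 y.

Let toLE y : D y -> val (toL y) = y.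
Proof. by move=> Dy; rewrite insubdK//; apply/asboolP. Qed.

Let toL_hom : star_hom_on D [set: L] toL.
Proof.
have [[_ DD DZ DM DS] _] := hD.
split=> //.
- move=> x y Dx Dy; apply: val_inj; rewrite [RHS]/= !toLE//; exact: DD.
- move=> c x Dx; apply: val_inj; rewrite [RHS]/= !toLE//; exact: DZ.
- move=> x y Dx Dy; apply: val_inj.
  rewrite [RHS]/= !toLE//; exact: DM.
- move=> x Dx; apply: val_inj; rewrite [RHS]/= !toLE//; exact: DS.
Qed.

Let iota n := toL \o psi n.

Let iota_val n x : A n x -> val (iota n x) = psi n x.
Proof. by move=> Ax; rewrite toLE//; have [+ _ _ _ _] := hpsi n; apply. Qed.

Let iota_hom n : star_hom_on (A n) [set: L] (iota n).
Proof.
have [fA fD fZ fM fS] := hpsi n; have [gA gD gZ gM gS] := toL_hom.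
split=> //= *; rewrite /iota /=.
- by rewrite fD// gD//; exact: fA.
- by rewrite fZ// gZ//; exact: fA.
- by rewrite fM// gM//; exact: fA.
- by rewrite fS// gS//; exact: fA.
Qed.

(** For a cocone [chi], contractivity at stage [n + j] gives [|chi n x| <= |iter_map n j x|], so
    [psi_lower] yields [|chi n x| <= K |psi n x|]. Hence [psi n x] determines [chi n x], and the
    resulting map extends from the dense union of the images. Uniqueness holds because any
    competitor is contractive as well, hence continuous. *)
Theorem direct_limit_criterion : isomorphic_to_direct_limit A phi D.
Proof.
exists L, iota; split; last first.
  exists toL => //; split=> //.
    by move=> x y /set_mem Dx /set_mem Dy /(congr1 val); rewrite !toLE.
  by move=> l _; exists (val l); [exact: subalgP|exact: valKd].
split.
  by split=> // n x Ax; rewrite /iota /= psi_phi.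
move=> B chi [hchi chi_phi].
have chi_le n x : A n x -> `|chi n x| <= K * `|psi n x|.
  move=> Ax; rewrite real_leNgt ?ger0_real ?mulr_ge0//; apply/negP => lt.
  have d0 : 0 < `|chi n x| - K * `|psi n x| by rewrite subr_gt0.
  have [j hj] := psi_lower Ax (divr_gt0 d0 (ltr0n _ 2)).
  have := star_hom_contractive (hA (n + j)%N) (hchi (n + j)%N) (iter_map_in j Ax).
  rewrite (iter_map_cocone chi_phi)// => /le_trans /(_ hj).
  rewrite -lerBlDl ler_pdivlMr// ger_pMr// => h.
  by have := lt_le_trans (ltr1n _ 2) h; rewrite ltxx.
have iota_phi n x : A n x -> iota n.+1 (phi n x) = iota n x.
  by move=> Ax; rewrite /iota /= psi_phi.
pose G (l : L) (b : B) := exists n x, [/\ A n x, l = iota n x & b = chi n x].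
have move_up n j x : A n x -> exists y, [/\ A (n + j)%N y,
    iota n x = iota (n + j)%N y & chi n x = chi (n + j)%N y].
  move=> Ax; exists (iter_map n j x).
  rewrite (iter_map_cocone iota_phi)// (iter_map_cocone chi_phi)//.
  by split=> //; exact: iter_map_in.
(* Elements of stages [n] and [m] are both moved to stage [n + m], so binary operations need to be
   checked within one stage only. *)
have common (Q : L -> B -> L -> B -> Prop) :
    (forall n x y, A n x -> A n y -> Q (iota n x) (chi n x) (iota n y) (chi n y)) ->
    forall l b l' b', G l b -> G l' b' -> Q l b l' b'.
  move=> hQ l b l' b' [n [x [Ax -> ->]]] [m [y [Ay -> ->]]].
  have [x' [Ax' -> ->]] := move_up n m x Ax.
  have [y' [Ay' -> ->]] := move_up m n y Ay.
  by rewrite (addnC m n) in Ay' *; exact: hQ.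
have G0 : G 0 0.
  have [[A0 _ _ _ _] _] := hA 0%N; have [_ _ iZ _ _] := iota_hom 0.
  have [_ _ cZ _ _] := hchi 0%N; exists 0%N, 0; split=> //.
  - by have := iZ 0 _ A0; rewrite !scale0r.
  - by have := cZ 0 _ A0; rewrite !scale0r.
have GD l b l' b' : G l b -> G l' b' -> G (l + l') (b + b').
  move: l b l' b'; apply: (common (fun l b l' b' => G (l + l') (b + b'))).
  move=> n x y Ax Ay; have [_ iD _ _ _] := iota_hom n; have [_ cD _ _ _] := hchi n.
  have [[_ AD _ _ _] _] := hA n.
  by exists n, (x + y); rewrite iD// cD//; split=> //; exact: AD.
have GM l b l' b' : G l b -> G l' b' -> G (amul l l') (amul b b').
  move: l b l' b'; apply: (common (fun l b l' b' => G (amul l l') (amul b b'))).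
  move=> n x y Ax Ay; have [_ _ _ iM _] := iota_hom n; have [_ _ _ cM _] := hchi n.
  have [[_ _ _ AM _] _] := hA n.
  by exists n, (amul x y); rewrite iM// cM//; split=> //; exact: AM.
have GZ q l b : G l b -> G (Qi_embed R q *: l) (Qi_embed R q *: b).
  move=> [n [x [Ax -> ->]]]; have [_ _ iZ _ _] := iota_hom n.
  have [_ _ cZ _ _] := hchi n; have [[_ _ AZ _ _] _] := hA n.
  by exists n, (Qi_embed R q *: x); rewrite iZ// cZ//; split=> //; exact: AZ.
have GS l b : G l b -> G (astar l) (astar b).
  move=> [n [x [Ax -> ->]]]; have [_ _ _ _ iS] := iota_hom n.
  have [_ _ _ _ cS] := hchi n; have [[_ _ _ _ AS] _] := hA n.
  by exists n, (astar x); rewrite iS// cS//; split=> //; exact: AS.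
have GK l b : G l b -> `|b| <= K * `|l|.
  by move=> [n [x [Ax -> ->]]]; rewrite subalg_normE iota_val//; exact: chi_le.
have dom l : graph_dom G l.
  have [u [uP ul]] := psi_dense (subalgP l).
  have /choice[w wP] k : exists w : L * B, G w.1 w.2 /\ val w.1 = u k.
    have [n [x [Ax ->]]] := uP k; exists (iota n x, chi n x).
    by split; [exists n, x|exact: iota_val].
  exists (fst \o w), (snd \o w); split=> [k|]; first by have [] := wP k.
  move=> e e0; have [N hN] := ul e e0; exists N => k /hN.
  by rewrite subalg_normE [val (_ - _)]/= ; have [_ <-] := wP k.
have domT : graph_dom G = [set: L] by rewrite eqEsubset; split.
have theta_hom := graph_fun_hom K0 GD GZ GM GS GK; rewrite domT in theta_hom.
exists (graph_fun G); split.
  split=> // n x Ax; apply: (@graph_funE _ _ _ G K K0 GD GZ GK).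
  by exists n, x.
move=> theta [theta_h thetaE]; apply/funext => l.
have [u [v [Guv ul]]] := dom l.
have TL : star_closed [set: L] by split.
apply: tends_unique (graph_funP K0 GD GZ GK Guv ul) _.
apply: tends_eq (tends_star_hom TL theta_h _ ul) _ => // n.
by have [m [x [Ax -> ->]]] := Guv n; rewrite thetaE.
Qed.

End DirectLimitCriterion.

(** * Gram-Schmidt orthonormalization of a semidefinite form *)

Section GramSchmidt.
Context (R : realType).
Notation C := R[i].
Notation E := {poly C}.
Context (f : E -> E -> C) (hf : semi_inner f).

(** [0^-1 = 0], so that a null vector is normalized to [0]. *)
Definition gs_normalize (r : E) : E := (sqrtC (f r r))^-1 *: r.

(** Polynomials serve as finitely supported sequences, with ['X^k] as the [k]-th basis vector. Each
    vector depends on all earlier ones, so the recursion carries a table of them; [gsE] recovers the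
    usual formula. *)
Fixpoint gs_table (k : nat) : nat -> E :=
  if k is k'.+1 then
    fun i => if i == k' then
        gs_normalize ('X^k' - \sum_(l < k') f 'X^k' (gs_table k' l) *: gs_table k' l)
      else gs_table k' i
  else fun=> 0.

Definition gs (k : nat) : E := gs_table k.+1 k.

Definition gs_rest (k : nat) : E := 'X^k - \sum_(l < k) f 'X^k (gs l) *: gs l.

Lemma gs_table_stable k l : (l < k)%N -> gs_table k l = gs l.
Proof.
elim: k => [//|k IH]; rewrite ltnS leq_eqVlt /= => /predU1P[->|lk].
  by rewrite /gs /= eqxx.
by rewrite ltn_eqF// IH.
Qed.

Lemma gsE k : gs k = gs_normalize (gs_rest k).
Proof.
rewrite {1}/gs /= eqxx; congr (gs_normalize (_ - _)).
by apply: eq_bigr => l _; rewrite gs_table_stable.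
Qed.

Lemma gs_size k : (size (gs k) <= k.+1)%N.
Proof.
elim/ltn_ind: k => k IH; rewrite gsE; apply: leq_trans (size_scale_leq _ _) _.
apply: leq_trans (size_polyD _ _) _; rewrite size_polyN size_polyXn geq_max leqnn.
rewrite andTb; apply: leq_trans (size_sum _ _ _) _.
apply/bigmax_leqP => l _; apply: leq_trans (size_scale_leq _ _) _.
by apply: leq_trans (IH _ (ltn_ord l)) _; rewrite ltnS ltnW.
Qed.

Definition null (x : E) := forall y, f x y = 0.

Lemma nullP x : f x x = 0 -> null x.
Proof.
move=> x0 y; apply/eqP; rewrite -normr_eq0 -sqrf_eq0 eq_le.
by have := semi_CauchySchwarz hf x y; rewrite x0 mul0r => ->; rewrite exprn_ge0.
Qed.

Lemma null_l x y z : null (x - y) -> f x z = f y z.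
Proof. by move=> /(_ z)/eqP; rewrite (semiBl hf) subr_eq0 => /eqP. Qed.

(** A basis vector that depends on earlier ones modulo null vectors yields [gs k = 0] rather than
    being skipped. The indices thus stay aligned with the basis, whatever the rank of the form. *)
Lemma gs_dich k :
  (f (gs k) (gs k) = 1 /\
   gs_rest k = sqrtC (f (gs_rest k) (gs_rest k)) *: gs k)
  \/ (gs k = 0 /\ null (gs_rest k)).
Proof.
rewrite !gsE /gs_normalize; set r := gs_rest k.
have [r0|r0] := eqVneq (f r r) 0.
  by right; split; [rewrite r0 sqrtC0 invr0 scale0r|exact: nullP].
have s0 : sqrtC (f r r) != 0 by rewrite sqrtC_eq0.
left; rewrite scalerA mulfV// scale1r; split=> //.
rewrite (semiZl hf) (semiZr hf) conj_Creal; last first.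
  by rewrite realV ger0_real// sqrtC_ge0 semi_ge0.
by rewrite mulrA -invfM -expr2 sqrtCK mulVf.
Qed.

Lemma gs_ortho_lt k l : (l < k)%N -> f (gs k) (gs l) = 0.
Proof.
elim/ltn_ind: k l => k IH l lk; rewrite gsE (semiZl hf); apply/eqP.
rewrite mulf_eq0; apply/orP; right; apply/eqP.
rewrite (semiBl hf) (semi_suml hf) (bigD1 (Ordinal lk))//= big1 => [|m ml].
  rewrite addr0 (semiZl hf).
  have [[-> _]|[-> _]] := gs_dich l; first by rewrite mulr1 subrr.
  by rewrite (semi0r hf) mul0r subrr.
rewrite (semiZl hf); have {}ml : (m : nat) != l by [].
have [lm|ml'|E] := ltngtP m l; last by rewrite E eqxx in ml.
- by rewrite (semiC hf (gs m)) IH// conjC0 mulr0.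
- by rewrite IH// mulr0.
Qed.

Lemma gs_ortho k l : k != l -> f (gs k) (gs l) = 0.
Proof.
move=> kl; have [lk|kl'|E] := ltngtP l k; last by rewrite E eqxx in kl.
- exact: gs_ortho_lt.
- by rewrite (semiC hf) gs_ortho_lt// conjC0.
Qed.

Lemma gs_monomial k : null ('X^k - \sum_(l < k.+1) f 'X^k (gs l) *: gs l).
Proof.
rewrite big_ord_recr /= opprD addrA -/(gs_rest k).
have fk : f 'X^k (gs k) = f (gs_rest k) (gs k).
  rewrite /gs_rest (semiBl hf) (semi_suml hf) big1 ?subr0// => l _.
  by rewrite (semiZl hf) gs_ortho ?mulr0// ltn_eqF.
have [[u1 rE]|[u0 rn]] := gs_dich k.
  rewrite fk {2}rE (semiZl hf) u1 mulr1 -rE subrr => y; exact: semi0l.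
by rewrite u0 scaler0 subr0.
Qed.

Lemma null0 : null 0. Proof. by move=> y; exact: semi0l. Qed.

Lemma nullD x y : null x -> null y -> null (x + y).
Proof. by move=> nx ny z; rewrite (semiDl hf) nx ny addr0. Qed.

Lemma nullZ c x : null x -> null (c *: x).
Proof. by move=> nx z; rewrite (semiZl hf) nx mulr0. Qed.

Lemma polyE n (x : E) : (size x <= n)%N -> x = \sum_(i < n) x`_i *: 'X^i.
Proof.
move=> xn; rewrite -(poly_def n (fun i => x`_i)); apply/polyP => i.
by rewrite coef_poly; case: ltnP => // ni; rewrite nth_default// (leq_trans xn).
Qed.

Lemma gs_late (x : E) k : (size x <= k)%N -> f x (gs k) = 0.
Proof.
move=> xk; rewrite (polyE xk) (semi_suml hf) big1// => i _; rewrite (semiZl hf).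
rewrite (null_l _ (gs_monomial i)) (semi_suml hf) big1 ?mulr0// => l _.
rewrite (semiZl hf) gs_ortho ?mulr0// ltn_eqF//.
by apply: leq_trans (ltn_ord l) _; exact: ltn_ord.
Qed.

(** The defect [F] is linear, so monomials suffice; for ['X^i] the terms beyond [i] vanish by
    [gs_late], and the rest is [gs_monomial]. *)
Lemma gs_expand n (x : E) : (size x <= n)%N ->
  null (x - \sum_(k < n) f x (gs k) *: gs k).
Proof.
pose F (y : E) : E := y - \sum_(k < n) f y (gs k) *: gs k.
have FD y z : F (y + z) = F y + F z.
  rewrite /F addrACA -opprD -big_split /=; congr (_ - _).
  by apply: eq_bigr => k _; rewrite (semiDl hf) scalerDl.
have FZ c y : F (c *: y) = c *: F y.
  rewrite /F scalerBr scaler_sumr; congr (_ - _).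
  by apply: eq_bigr => k _; rewrite (semiZl hf) scalerA.
have F0 : F 0 = 0 by rewrite -(scale0r 0) FZ !scale0r.
have mono (i : nat) : (i < n)%N -> null (F 'X^i).
  move=> ni; rewrite /F -(big_mkord predT (fun k => f 'X^i (gs k) *: gs k)).
  rewrite (big_cat_nat (leq0n i.+1) ni)//= big_mkord.
  have -> : \sum_(i.+1 <= k < n) f 'X^i (gs k) *: gs k = 0.
    rewrite big_nat_cond big1// => k; rewrite andbT => /andP[ik _].
    by rewrite gs_late ?scale0r// size_polyXn.
  by rewrite addr0; exact: gs_monomial.
move=> xn; rewrite -/(F x) (polyE xn).
elim/big_rec: _ => [|i y _ ny]; first by rewrite F0; exact: null0.
by rewrite FD FZ; apply: nullD => //; apply: nullZ; exact: mono.
Qed.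

Section Realize.
Context (H : hilbertType R) (e : nat -> H).
Hypothesis he : forall i j, inner (e i) (e j) = (i == j)%:R.

Definition realize (x : E) : H := \sum_(k < size x) f x (gs k) *: e k.

(** A truncated adjoint of [realize]: once [e] is orthonormal, [realize (coords N h)] is the
    projection of [h] onto the span of those [e k], [k < N], for which [gs k] is nonzero. *)
Definition coords (N : nat) (h : H) : E := \sum_(k < N) inner h (e k) *: gs k.

Lemma realizeE n (x : E) : (size x <= n)%N ->
  realize x = \sum_(k < n) f x (gs k) *: e k.
Proof.
move=> xn; rewrite /realize -!(big_mkord predT (fun k => f x (gs k) *: e k)).
rewrite (big_cat_nat (leq0n _) xn)//=.
have -> : \sum_(size x <= k < n) f x (gs k) *: e k = 0.
  rewrite big_nat_cond big1// => k; rewrite andbT => /andP[xk _].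
  by rewrite gs_late// scale0r.
by rewrite addr0.
Qed.

Lemma realizeD x y : realize (x + y) = realize x + realize y.
Proof.
have [xn yn] := (leq_maxl (size x) (size y), leq_maxr (size x) (size y)).
rewrite (realizeE (size_polyD x y)) (realizeE xn) (realizeE yn) -big_split /=.
by apply: eq_bigr => k _; rewrite (semiDl hf) scalerDl.
Qed.

Lemma realizeZ c x : realize (c *: x) = c *: realize x.
Proof.
rewrite (realizeE (size_scale_leq c x)) /realize scaler_sumr.
by apply: eq_bigr => k _; rewrite (semiZl hf) scalerA.
Qed.

Lemma realizeB x y : realize (x - y) = realize x - realize y.
Proof. by rewrite realizeD -scaleN1r realizeZ scaleN1r. Qed.

Lemma inner_realize x y : inner (realize x) (realize y) = f x y.
Proof.
have [xn yn] := (leq_maxl (size x) (size y), leq_maxr (size x) (size y)).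
rewrite (realizeE xn) (realizeE yn); set n := maxn _ _ in xn yn *.
rewrite (null_l _ (gs_expand xn)) (semi_suml hf) inner_suml.
apply: eq_bigr => k _; rewrite (semiZl hf) innerZl inner_sumr; congr (_ * _).
rewrite (bigD1 k)//= innerZr he eqxx mulr1 big1 ?addr0 -?(semiC hf)// => l lk.
rewrite innerZr he (_ : (k == l :> nat) = false) ?mulr0//.
by apply/negbTE; rewrite eq_sym.
Qed.

Lemma realize_norm x : `|realize x| ^+ 2 = f x x.
Proof. by rewrite -inner_normE inner_realize. Qed.

Lemma inner_realize_coords n (x : E) h : (size x <= n)%N ->
  inner (realize x) h = f x (coords n h).
Proof.
move=> xn; rewrite (realizeE xn) inner_suml (semi_sumr hf).
by apply: eq_bigr => k _; rewrite innerZl (semiZr hf) -innerC mulrC.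
Qed.

Lemma coords_size n h : (size (coords n h) <= n)%N.
Proof.
apply: leq_trans (size_sum _ _ _) _; apply/bigmax_leqP => k _.
by apply: leq_trans (size_scale_leq _ _) _; apply: leq_trans (gs_size k) _.
Qed.

Lemma inner_gs_coords n h k : (k < n)%N ->
  f (gs k) (coords n h) = Num.conj (inner h (e k)) * f (gs k) (gs k).
Proof.
move=> kn; rewrite (semi_sumr hf) (bigD1 (Ordinal kn))//= (semiZr hf) big1 ?addr0//.
by move=> l lk; rewrite (semiZr hf) gs_ortho ?mulr0// eq_sym.
Qed.

Lemma coords_inner m n h : (m <= n)%N ->
  f (coords m h) (coords n h) = f (coords m h) (coords m h).
Proof.
move=> mn; rewrite !(semi_suml hf); apply: eq_bigr => k _; rewrite !(semiZl hf).
by rewrite !inner_gs_coords//; apply: leq_trans mn.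
Qed.

Lemma inner_coords n h : inner (realize (coords n h)) h = f (coords n h) (coords n h).
Proof. by rewrite (inner_realize_coords _ (coords_size n h)). Qed.

Lemma coords_le n h : `|realize (coords n h)| <= `|h|.
Proof.
have [->|r0] := eqVneq (realize (coords n h)) 0; first by rewrite normr0.
rewrite -(ler_pM2r (_ : 0 < `|realize (coords n h)|)) ?normr_gt0// -expr2.
rewrite realize_norm -inner_coords mulrC.
rewrite -[leLHS]ger0_norm ?inner_le// inner_coords; exact: semi_ge0.
Qed.

Lemma coords_dist m n h : (m <= n)%N ->
  `|realize (coords n h) - realize (coords m h)| ^+ 2 =
  `|realize (coords n h)| ^+ 2 - `|realize (coords m h)| ^+ 2.
Proof.
move=> mn; have e1 := coords_inner h mn.
have e2 : f (coords n h) (coords m h) = f (coords m h) (coords m h).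
  by rewrite (semiC hf) e1 [RHS](semiC hf).
by rewrite -realizeB !realize_norm (semiBl hf) !(semiBr hf) e1 e2 subrr subr0.
Qed.

End Realize.

End GramSchmidt.

(** * Operators on [H] induced by bounded actions on finitely supported sequences *)

Section Represent.
Context (R : realType).
Notation C := R[i].
Notation E := {poly C}.

Lemma mono_cauchys (w : nat -> C) (B : C) :
  (forall m n, (m <= n)%N -> w m <= w n) -> (forall n, 0 <= w n) ->
  (forall n, w n <= B) -> cauchys w.
Proof.
move=> wm w0 wB; pose a n := complex.Re (w n).
have wE n : w n = (a n)%:C by rewrite RRe_real// ger0_real.
have BE : B = (complex.Re B)%:C.
  by rewrite RRe_real// ger0_real// (le_trans (w0 0%N)).
have am m n : (m <= n)%N -> a m <= a n by move=> /wm; rewrite !wE lecR.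
have supa : has_sup (range a).
  split; first by exists (a 0%N), 0%N.
  by exists (complex.Re B) => _ [n _ <-]; rewrite -lecR -wE -BE.
move=> e e0; have eE : e = (complex.Re e)%:C by rewrite RRe_real// gtr0_real.
have re0 : 0 < complex.Re e by rewrite -ltcR -eE.
have [_ [N _ <-] hN] := sup_adherent re0 supa.
have ub n : a n <= sup (range a) by apply: sup_ubound; [case: supa|exists n].
exists N => m n Nm Nn; rewrite !wE eE -rmorphB /= normc_def /= expr0n addr0.
rewrite sqrtr_sqr ltcR ltr_distl.
have := am _ _ Nm; have := am _ _ Nn; have := ub m; have := ub n.
move: (a m) (a n) (a N) (sup _) (complex.Re e) hN => p q r s t h1 h2 h3 h4 h5.
by apply/andP; split; lra.
Qed.

Context (f : E -> E -> C) (hf : semi_inner f).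
Context (H : hilbertType R) (e : nat -> H).
Hypothesis he : forall i j, inner (e i) (e j) = (i == j)%:R.

Notation realize := (realize f e).
Notation coords := (coords f e).

Lemma coordsP n c h g : coords n (c *: h + g) = c *: coords n h + coords n g.
Proof.
rewrite /coords scaler_sumr -big_split /=; apply: eq_bigr => k _.
by rewrite innerDl innerZl scalerDl scalerA.
Qed.

Lemma coords_cauchys h : cauchys (fun n => realize (coords n h)).
Proof.
have cw : cauchys (fun n => `|realize (coords n h)| ^+ 2).
  apply: (@mono_cauchys _ (`|h| ^+ 2)) => [m n mn|n|n].
  - by rewrite -subr_ge0 -(coords_dist hf he h mn) exprn_ge0.
  - by rewrite exprn_ge0.
  - by rewrite ler_pXn2r ?nnegrE// (coords_le hf he).
move=> d d0; have [N hN] := cw (d ^+ 2) (exprn_gt0 2 d0); exists N.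
have key m n : (N <= m)%N -> (m <= n)%N ->
    `|realize (coords n h) - realize (coords m h)| < d.
  move=> Nm mn; rewrite -(@ltr_pXn2r _ 2)// ?nnegrE// ?ltW// (coords_dist hf he h mn).
  apply: le_lt_trans (hN n m (leq_trans Nm mn) Nm).
  by rewrite real_ler_norm// rpredB// ger0_real// exprn_ge0.
move=> m n Nm Nn; case: (leqP m n) => [mn|/ltnW nm].
  by rewrite distrC; exact: key.
exact: key.
Qed.

(** This determines [T] on all of [H]: a linear action induces 0 on the orthogonal complement of the
    range of [realize]. Identities between such operators can therefore be checked on [E] modulo
    null vectors. *)
Definition represents (act : E -> E) (T : BH H) : Prop :=
  forall h, tends (fun n => realize (act (coords n h))) (T h).

Definition bounded_act (act : E -> E) (M : C) : Prop :=
  (forall c x y, act (c *: x + y) = c *: act x + act y) /\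
  forall x, f (act x) (act x) <= M ^+ 2 * f x x.

Lemma bounded_act_le act M x : 0 <= M -> bounded_act act M ->
  `|realize (act x)| <= M * `|realize x|.
Proof.
move=> M0 [_ aM]; rewrite -(@ler_pXn2r _ 2) ?nnegrE ?mulr_ge0//.
by rewrite exprMn !(realize_norm hf he).
Qed.

Lemma bounded_actB act M x y : bounded_act act M -> act (x - y) = act x - act y.
Proof. by move=> [al _]; rewrite addrC -scaleN1r al scaleN1r addrC. Qed.

Lemma represents_ex act M : 0 <= M -> bounded_act act M ->
  exists T, represents act T.
Proof.
move=> M0 aM; have [al _] := aM.
have ale x := bounded_act_le x M0 aM.
have /choice[g gP] h : exists y, tends (fun n => realize (act (coords n h))) y.
  apply: cauchys_tends => d d0; have M1 : 0 < M + 1 by rewrite ltr_wpDl.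
  have [N hN] := coords_cauchys h (divr_gt0 d0 M1); exists N => m n Nm Nn.
  rewrite -(realizeB hf) -(bounded_actB _ _ aM).
  apply: le_lt_trans (ale _) _; have := hN m n Nm Nn.
  rewrite -(realizeB hf) ltr_pdivlMr// mulrC; apply: le_lt_trans.
  by apply: ler_wpM2r => //; rewrite lerDl.
have gl : linear g.
  move=> c x y; apply: tends_unique (gP _) _.
  apply: tends_eq (tendsD (tends_scale (tends_cst c) (gP x)) (gP y)) _ => n.
  by rewrite coordsP al (realizeD hf) (realizeZ hf).
have gM x : `|g x| <= M * `|x|.
  apply: tends_normle (gP x) _; exists 0%N => n _.
  by apply: le_trans (ale _) _; apply: ler_wpM2l => //; exact: (coords_le hf he).
by have [T TE] := mkop gl gM; exists T => h; rewrite TE.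
Qed.

(** For [n >= size x] the vector [coords n (realize x)] differs from [x] by a null vector, and a
    bounded action preserves null vectors. *)
Lemma represents_realize act M T x : 0 <= M -> bounded_act act M ->
  represents act T -> T (realize x) = realize (act x).
Proof.
move=> M0 aM aT; apply: tends_unique (aT _) _.
apply: tends_eveq (tends_cst _) _; exists (size x) => n xn.
apply/eqP; rewrite -subr_eq0 -(realizeB hf) -(bounded_actB _ _ aM) -normr_le0.
apply: le_trans (bounded_act_le _ M0 aM) _.
suff -> : realize (x - coords n (realize x)) = 0 by rewrite normr0 mulr0.
apply/eqP; rewrite -normr_eq0 -sqrf_eq0 (realize_norm hf he); apply/eqP.
have := gs_expand hf xn; set y := \sum_(k < n) _ => nxy.
suff -> : coords n (realize x) = y by exact: nxy.
apply: eq_bigr => k _; congr (_ *: _).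
rewrite (realizeE hf _ xn) inner_suml (bigD1 k)//= innerZl he eqxx mulr1.
rewrite big1 ?addr0// => l lk.
by rewrite innerZl he (_ : (l == k :> nat) = false) ?mulr0//; exact/negbTE.
Qed.

Lemma represents_dist act act' K T T' : 0 <= K ->
  represents act T -> represents act' T' ->
  (forall x, f (act x - act' x) (act x - act' x) <= K ^+ 2 * f x x) ->
  `|T - T'| <= K.
Proof.
move=> K0 aT aT' h; apply: op_norm_le => // x; rewrite opBE.
apply: tends_normle (tendsB (aT x) (aT' x)) _; exists 0%N => n _.
rewrite -(realizeB hf).
apply: (@le_trans _ _ (K * `|realize (coords n x)|)); last first.
  by apply: ler_wpM2l => //; exact: (coords_le hf he).
by rewrite -(@ler_pXn2r _ 2) ?nnegrE ?mulr_ge0// exprMn !(realize_norm hf he).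
Qed.

Lemma realize_null x : null f x -> realize x = 0.
Proof.
by move=> nx; apply/eqP; rewrite -normr_eq0 -sqrf_eq0 (realize_norm hf he) nx.
Qed.

Lemma represents_eq act act' T T' : represents act T -> represents act' T' ->
  (forall x, null f (act x - act' x)) -> T = T'.
Proof.
move=> aT aT' h; apply/eqP; rewrite -subr_eq0 -normr_le0.
by apply: (@represents_dist _ _ 0 _ _ _ aT aT') => // x; rewrite h expr0n mul0r.
Qed.

Lemma represents0 : represents (fun=> 0) 0.
Proof.
move=> h; apply: tends_eq (tends_cst _) _ => n.
by rewrite op0E realize_null//; exact: null0.
Qed.

Lemma representsD a b S T : represents a S -> represents b T ->
  represents (fun x => a x + b x) (S + T).
Proof.
move=> aS bT h; apply: tends_eq (tendsD (aS h) (bT h)) _ => n.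
by rewrite (realizeD hf).
Qed.

Lemma representsZ c a T : represents a T -> represents (fun x => c *: a x) (c *: T).
Proof.
move=> aT h; apply: tends_eq (tends_scale (tends_cst c) (aT h)) _ => n.
by rewrite (realizeZ hf).
Qed.

Lemma representsM a b M S T : 0 <= M -> bounded_act a M ->
  represents a S -> represents b T -> represents (a \o b) (amul S T).
Proof.
move=> M0 aM aS bT h; rewrite opME.
apply: tends_eq (tends_op S (bT h)) _ => n.
by rewrite (represents_realize _ M0 aM aS).
Qed.

Lemma represents_star a b S T : represents a S -> represents b T ->
  (forall x y, f (a x) y = f x (b y)) -> astar S = T.
Proof.
move=> aS bT ab; apply: adjoint_unique => h g.
have coordsQ y n (x : E) : (size x <= n)%N -> f x (coords n y) = inner (realize x) y.
  by move=> xn; rewrite (inner_realize_coords _ _ _ xn).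
have step n : inner (realize (a (coords n h))) g =
    inner (realize (coords n h)) (T g).
  pose x := coords n h.
  have h1 := tends_inner (tends_cst (realize x)) (bT g).
  apply: tends_unique _ h1; apply: tends_eveq (tends_cst _) _.
  exists (size (a x)) => m am.
  by rewrite (inner_realize hf he) -ab (coordsQ _ _ _ am).
have lim1 := tends_inner (aS h) (tends_cst g).
(* The limit [q] of the projections of [h] may replace [h], because [T g] is a limit of vectors in
   the range of [realize] and these do not distinguish [h] from [q]. *)
have lim2 : tends (fun n => inner (realize (coords n h)) (T g)) (inner h (T g)).
  have [q hq] := cauchys_tends (coords_cauchys h).
  have -> : inner h (T g) = inner q (T g).
    apply: tends_unique (tends_inner (tends_cst h) (bT g)) _.
    apply: tends_eq (tends_inner (tends_cst q) (bT g)) _ => m.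
    have h4 := tends_inner hq (tends_cst (realize (b (coords m g)))).
    apply: tends_unique h4 _; apply: tends_eveq (tends_cst _) _.
    exists (size (b (coords m g))) => n bn.
    by rewrite [LHS]innerC -(coordsQ _ n)// (inner_realize hf he) [RHS](semiC hf).
  exact: tends_inner hq (tends_cst _).
by apply: tends_unique lim1 _; apply: tends_eq lim2 _ => n; rewrite step.
Qed.

End Represent.

(** * Strong measurability *)

Section Least.

Definition least (P : nat -> Prop) : nat :=
  xget 0%N [set n | P n /\ forall m, (m < n)%N -> ~ P m].

Lemma least_spec (P : nat -> Prop) : (exists n, P n) ->
  P (least P) /\ forall m, (m < least P)%N -> ~ P m.
Proof.
move=> [n Pn]; suff : exists n, P n /\ forall m, (m < n)%N -> ~ P m.
  exact: (@xgetPex _ 0%N [set n | P n /\ forall m, (m < n)%N -> ~ P m]).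
elim/ltn_ind: n Pn => n IH Pn.
have [[m [mn Pm]]|h] := pselect (exists m, (m < n)%N /\ P m); first exact: IH Pm.
by exists n; split=> // m mn Pm; apply: h; exists m.
Qed.

Lemma leastP (P : nat -> Prop) : (exists n, P n) -> P (least P).
Proof. by move=> /least_spec[]. Qed.

(** The second alternative is the default of an unsuccessful search. Covering it makes the fibres of
    a search Borel even where nothing is found. *)
Lemma least_eq (P : nat -> Prop) n : least P = n <->
  (P n /\ forall m, (m < n)%N -> ~ P m) \/ (n = 0%N /\ forall m, ~ P m).
Proof.
split.
  move=> <-; have [Pex|nP] := pselect (exists n, P n).
    by left; exact: least_spec.
  right; split=> [|m Pm]; last by apply: nP; exists m.
  by apply: xgetPN => m [Pm _]; apply: nP; exists m.
move=> [[Pn hn]|[-> nP]]; last by apply: xgetPN => m [Pm _]; exact: (nP m).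
have [Pl hl] := least_spec (ex_intro _ n Pn).
have [ln|nl|//] := ltngtP (least P) n; first by case: (hn _ ln).
by case: (hl _ nl).
Qed.

End Least.

Section Borel.
Context (R : realType) (S : Type) (bor : set (set S)).
Hypothesis hbor : sigma_algebra [set: S] bor.
Notation C := R[i].
Implicit Types P Q : S -> Prop.

Lemma bor_eq P Q : bor [set s | P s] -> (forall s, P s <-> Q s) -> bor [set s | Q s].
Proof.
move=> bP PQ; have <- // : [set s | P s] = [set s | Q s].
by apply/seteqP; split=> s /PQ.
Qed.

Lemma borN P : bor [set s | P s] -> bor [set s | ~ P s].
Proof.
move=> bP; have [_ hC _] := hbor; have := hC _ bP.
by rewrite setTD => h; exact: (bor_eq (P := ~` [set s | P s]) h).
Qed.

Lemma bor_ex (P : nat -> S -> Prop) : (forall n, bor [set s | P n s]) ->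
  bor [set s | exists n, P n s].
Proof.
move=> bP; have [_ _ hU] := hbor; have := hU _ bP.
move=> h; apply: (bor_eq (P := \bigcup_n [set s | P n s]) h) => s.
by split=> [[n _ Pn]|[n Pn]]; exists n.
Qed.

Lemma bor_all (P : nat -> S -> Prop) : (forall n, bor [set s | P n s]) ->
  bor [set s | forall n, P n s].
Proof.
move=> bP; apply: bor_eq (borN (bor_ex (fun n => borN (bP n)))) _ => s.
split=> [h n|h [n]]; last by apply.
by apply: contrapT => nP; apply: h; exists n.
Qed.

Lemma bor_cst (P : Prop) : bor [set s | P].
Proof.
have [h0 _ _] := hbor; have b0 : bor [set s | False].
  exact: (bor_eq (P := set0) h0).
have [p|np] := pselect P.
  by apply: bor_eq (borN b0) _ => s; split=> // _ [].
by apply: bor_eq b0 _ => s; split.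
Qed.

Lemma bor_and P Q : bor [set s | P s] -> bor [set s | Q s] ->
  bor [set s | P s /\ Q s].
Proof.
move=> bP bQ; have := @bor_all (fun n => if n is 0%N then P else Q).
move=> b; apply: bor_eq (b _) _ => [[|n]//|s]; split=> [h|[p q] [|n]//].
by split; [exact: (h 0%N)|exact: (h 1%N)].
Qed.

Lemma bor_or P Q : bor [set s | P s] -> bor [set s | Q s] ->
  bor [set s | P s \/ Q s].
Proof.
move=> bP bQ; apply: bor_eq (borN (bor_and (borN bP) (borN bQ))) _ => s.
split=> [h|[p|q] [np nq]//]; apply: contrapT => npq; apply: h; split=> [p|q]; apply: npq.
  by left.
by right.
Qed.

Lemma bor_imp P Q : bor [set s | P s] -> bor [set s | Q s] ->
  bor [set s | P s -> Q s].
Proof.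
move=> bP bQ; apply: bor_eq (bor_or (borN bP) bQ) _ => s.
split=> [[np|q] //|h]; have [p|np] := pselect (P s); last by left.
by right; exact: h.
Qed.

Definition nmeas (n : S -> nat) : Prop := forall k, bor [set s | n s = k].

(** Substituting a measurable index costs only a countable union over its values; this is how the
    results of searches are fed into later constructions. *)
Lemma nmeas_glue (n : S -> nat) (P : nat -> S -> Prop) : nmeas n ->
  (forall k, bor [set s | P k s]) -> bor [set s | P (n s) s].
Proof.
move=> nm bP; apply: bor_eq (bor_ex (fun k => bor_and (nm k) (bP k))) _ => s.
by split=> [[k [<-]]//|p]; exists (n s).
Qed.

Lemma nmeas_cst k : nmeas (fun=> k).
Proof. by move=> m; exact: bor_cst. Qed.

Lemma nmeas_fglue (n : S -> nat) (m : nat -> S -> nat) : nmeas n ->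
  (forall k, nmeas (m k)) -> nmeas (fun s => m (n s) s).
Proof.
move=> nm mm k; apply: (nmeas_glue (P := fun j s => m j s = k)) => // j.
exact: mm.
Qed.

Lemma nmeas_comp (g : nat -> nat) n : nmeas n -> nmeas (g \o n).
Proof.
move=> nm; apply: (nmeas_fglue (m := fun k _ => g k)) => // k.
exact: nmeas_cst.
Qed.

Lemma nmeas_comp2 (g : nat -> nat -> nat) m n : nmeas m -> nmeas n ->
  nmeas (fun s => g (m s) (n s)).
Proof.
move=> mm nm; apply: (nmeas_fglue (m := fun k s => g k (n s))) => // k.
exact: nmeas_comp.
Qed.

Lemma nmeas_least (P : nat -> S -> Prop) : (forall n, bor [set s | P n s]) ->
  nmeas (fun s => least (P^~ s)).
Proof.
move=> bP k; pose Q s := (P k s /\ forall m, (m < k)%N -> ~ P m s) \/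
  (k = 0%N /\ forall m, ~ P m s).
apply: (@bor_eq Q) => [|s]; last by rewrite /Q -(least_eq (P^~ s)).
apply: bor_or; apply: bor_and => //.
- by apply: bor_all => m; apply: bor_imp; [exact: bor_cst|exact: borN].
- exact: bor_cst.
- by apply: bor_all => m; exact: borN.
Qed.

(** Pointwise limits of countably valued measurable functions: this notion is
    preserved by continuous maps without reference to a sigma-algebra on [V]. *)
Definition smeas (V : normedZmodType C) (f : S -> V) : Prop :=
  exists (d : nat -> V) (n : nat -> S -> nat), (forall r, nmeas (n r)) /\
    forall s, tends (fun r => d (n r s)) (f s).

Section Strong.
Implicit Types V W X : normedZmodType C.

Lemma smeas_nat V (d : nat -> V) n : nmeas n -> smeas (fun s => d (n s)).
Proof. by move=> nm; exists d, (fun=> n); split=> // s; exact: tends_cst. Qed.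

Lemma smeas_cst V (x : V) : smeas (fun=> x).
Proof. exact: (smeas_nat (fun=> x) (nmeas_cst 0)). Qed.

Lemma smeas_eq V (f g : S -> V) : smeas f -> f =1 g -> smeas g.
Proof. by move=> fm /funext <-. Qed.

Lemma smeas_comp V W (F : V -> W) (f : S -> V) :
  (forall u l, tends u l -> tends (F \o u) (F l)) -> smeas f ->
  smeas (fun s => F (f s)).
Proof.
move=> Fc [d [n [nm df]]]; exists (F \o d), n; split=> // s; exact: Fc (df s).
Qed.

Definition unpair (k : nat) : nat * nat := odflt (0, 0)%N (choice.unpickle k).

Lemma pairK p : unpair (choice.pickle p) = p.
Proof. by rewrite /unpair choice.pickleK. Qed.

Lemma smeas_comp2 V W X (F : V -> W -> X) (f : S -> V) (g : S -> W) :
  (forall u v l m, tends u l -> tends v m ->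
    tends (fun n => F (u n) (v n)) (F l m)) -> smeas f -> smeas g ->
  smeas (fun s => F (f s) (g s)).
Proof.
move=> Fc [d [n [nm df]]] [e [m [mm eg]]].
exists (fun k => F (d (unpair k).1) (e (unpair k).2)).
exists (fun r s => choice.pickle (n r s, m r s)); split=> [r|s].
  by apply: (nmeas_comp2 (fun a b => choice.pickle (a, b))).
by apply: tends_eq (Fc _ _ _ _ (df s) (eg s)) _ => r; rewrite pairK.
Qed.

Lemma smeas_glue V (n : S -> nat) (f : nat -> S -> V) : nmeas n ->
  (forall k, smeas (f k)) -> smeas (fun s => f (n s) s).
Proof.
move=> nm /choice[d /choice[m fP]].
exists (fun k => d (unpair k).1 (unpair k).2).
exists (fun r s => choice.pickle (n s, m (n s) r s)); split=> [r|s].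
  apply: (nmeas_comp2 (fun a b => choice.pickle (a, b))) => //.
  by apply: (nmeas_fglue (m := fun k s => m k r s)) => // k; have [] := fP k.
have [_ /(_ s)] := fP (n s).
by move=> h; apply: tends_eq h _ => r; rewrite pairK.
Qed.

(** A strict inequality for the limit amounts to a weak inequality with some margin [1/(k+1)] for
    all late approximants, a countable condition on their natural-number indices. *)
Lemma bor_norm_lt V (f : S -> V) (c : C) : smeas f -> bor [set s | `|f s| < c].
Proof.
move=> [d [n [nm df]]].
pose Q k N s := forall r, (N <= r)%N -> `|d (n r s)| <= c - k.+1%:R^-1.
have bQ k N : bor [set s | Q k N s].
  apply: bor_all => r; apply: bor_imp; first exact: bor_cst.
  apply: (nmeas_glue (P := fun j s => `|d j| <= c - k.+1%:R^-1)) => // j.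
  exact: bor_cst.
apply: bor_eq (bor_ex (fun k => bor_ex (bQ k))) _ => s; split=> [[k [N h]]|lt].
  apply: le_lt_trans (tends_normle (df s) (ex_intro _ N h)) _.
  by rewrite ltrBlDr ltrDl invr_gt0.
have d0 : 0 < (c - `|f s|) / 2 by rewrite divr_gt0// subr_gt0.
have [k kd] := archi_inv d0; have [N hN] := df s _ d0.
exists k, N => r /hN h; rewrite -(subrK (f s) (d _)).
apply: le_trans (ler_normD _ _) _; rewrite lerBrDr.
apply: (@le_trans _ _ ((c - `|f s|) / 2 + `|f s| + (c - `|f s|) / 2)).
  by apply: lerD; [rewrite lerD2r|]; exact: ltW.
by rewrite addrAC -splitr subrK.
Qed.

Lemma bor_norm_le V (f : S -> V) (c : C) : smeas f -> bor [set s | `|f s| <= c].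
Proof.
move=> fm; apply: bor_eq (bor_all (fun k => bor_norm_lt (c + k.+1%:R^-1) fm)) _.
move=> s; split=> [h|h k]; last first.
  by apply: le_lt_trans h _; rewrite ltrDl invr_gt0.
have cr : c \is Num.real.
  have := ger0_real (le_trans (normr_ge0 _) (ltW (h 0%N))).
  by rewrite invr1 => c1; rewrite -[c](addrK 1) rpredB// rpred1.
rewrite real_leNgt ?normr_real//; apply/negP => lt.
have d0 : 0 < `|f s| - c by rewrite subr_gt0.
have [k kd] := archi_inv d0.
have := lt_trans (h k) (_ : c + k.+1%:R^-1 < `|f s|).
by rewrite -ltrBrDl ltxx => /(_ kd).
Qed.

(** Nonnegative scalars, so that both sides are their own norms. *)
Lemma bor_le (f g : S -> C) : smeas f -> smeas g -> (forall s, 0 <= f s) ->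
  (forall s, 0 <= g s) -> bor [set s | f s <= g s].
Proof.
move=> fm gm f0 g0.
pose c k : C := Qi_embed R (odflt 0 (choice.unpickle k : option rat) )%:C.
pose P s := exists k, 0 <= c k /\ (`|g s| <= c k /\ ~ (`|f s| <= c k)).
have bP : bor [set s | P s].
  apply: bor_ex => k; apply: bor_and; first exact: bor_cst.
  by apply: bor_and; [|apply: borN]; exact: bor_norm_le.
apply: bor_eq (borN bP) _ => s; rewrite /P; split=> [h|fg [k [c0]]].
  rewrite real_leNgt ?ger0_real//; apply/negP => lt; apply: h.
  have fE : f s = (complex.Re (f s))%:C by rewrite RRe_real// ger0_real.
  have gE : g s = (complex.Re (g s))%:C by rewrite RRe_real// ger0_real.
  have ltR : complex.Re (g s) < complex.Re (f s) by rewrite -ltcR -fE -gE.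
  have [q] := rat_in_itvoo ltR; rewrite in_itv /= => /andP[gq qf].
  have cE : c (choice.pickle q) = (ratr q)%:C.
    by rewrite /c choice.pickleK /= /Qi_embed /= rmorph0.
  exists (choice.pickle q); rewrite cE !ger0_norm// gE fE !lecR; split.
    by apply: ltW; apply: le_lt_trans gq; rewrite -lecR -gE.
  split; first exact: ltW.
  by apply/negP; rewrite -ltNge.
rewrite !ger0_norm//; move=> [gc]; apply; exact: le_trans gc.
Qed.

(** For each [k] take the first approximant of [f k] within [1/(k+1)]. The search is measurable, so
    the diagonal sequence is again countably valued and converges to [g]. *)
Lemma smeas_lim V (f : nat -> S -> V) (g : S -> V) : (forall k, smeas (f k)) ->
  (forall s, tends (fun k => f k s) (g s)) -> smeas g.
Proof.
move=> fm fg; have fm' := fm; move: fm' => /choice[d /choice[m fP]].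
pose Q k r s := `|d k (m k r s) - f k s| < k.+1%:R^-1.
have bQ k r : bor [set s | Q k r s].
  apply: bor_norm_lt; have [mm _] := fP k.
  apply: (@smeas_comp2 _ _ _ (fun x y => x - y)) => //.
    by move=> *; exact: tendsB.
  exact: smeas_nat.
exists (fun k => d (unpair k).1 (unpair k).2).
pose n k s := m k (least (Q k ^~ s)) s.
exists (fun k s => choice.pickle (k, n k s)); split=> [k|s].
  apply: (nmeas_comp (fun a => choice.pickle (k, a))).
  apply: (nmeas_fglue (m := fun r s => m k r s)); first exact: nmeas_least.
  by have [] := fP k.
have close k : `|d k (n k s) - f k s| < k.+1%:R^-1.
  apply: (@leastP (Q k ^~ s)); have [_ /(_ s k.+1%:R^-1)[|N hN]] := fP k.
    by rewrite invr_gt0.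
  by exists N; exact: hN.
have h0 : tends (fun k => d k (n k s) - f k s) 0.
  apply: (@tends_le _ _ _ (fun k => k.+1%:R^-1)); last exact: tends_inv.
  by move=> k; rewrite subr0 ltW.
have := tendsD h0 (fg s); rewrite add0r => h.
by apply: tends_eq h _ => k; rewrite pairK subrK.
Qed.

Lemma smeas_dense V (d : nat -> V) (f : S -> V) :
  (forall x (e : C), 0 < e -> exists n, `|x - d n| < e) ->
  (forall n k, bor [set s | `|f s - d n| < k.+1%:R^-1]) -> smeas f.
Proof.
move=> dd bf; pose Q k n s := `|f s - d n| < k.+1%:R^-1 :> C.
exists d, (fun k s => least (Q k ^~ s)); split=> [k|s].
  by apply: nmeas_least => n; exact: bf.
apply: (@tends_le _ _ _ (fun k => k.+1%:R^-1)); last exact: tends_inv.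
move=> k; rewrite distrC ltW//.
by apply: (@leastP (Q k ^~ s)); apply: dd; rewrite invr_gt0.
Qed.

Lemma smeasD V (f g : S -> V) : smeas f -> smeas g -> smeas (fun s => f s + g s).
Proof. by apply: (@smeas_comp2 _ _ _ (fun x y => x + y)) => *; exact: tendsD. Qed.

Lemma smeasB V (f g : S -> V) : smeas f -> smeas g -> smeas (fun s => f s - g s).
Proof. by apply: (@smeas_comp2 _ _ _ (fun x y => x - y)) => *; exact: tendsB. Qed.

Lemma smeasM (f g : S -> C) : smeas f -> smeas g -> smeas (fun s => f s * g s).
Proof. by apply: smeas_comp2 => *; exact: tendsM. Qed.

Lemma smeas_conj (f : S -> C) : smeas f -> smeas (fun s => Num.conj (f s)).
Proof. by apply: smeas_comp => *; exact: tends_conj. Qed.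

Lemma smeas_norm V (f : S -> V) : smeas f -> smeas (fun s => `|f s| : C).
Proof. by apply: (@smeas_comp _ _ Num.norm) => *; exact: tends_norm. Qed.

Lemma smeas_sum V I (r : seq I) (P : pred I) (f : I -> S -> V) :
  (forall i, P i -> smeas (f i)) -> smeas (fun s => \sum_(i <- r | P i) f i s).
Proof.
move=> fm; elim: r => [|i r IH].
  by apply: smeas_eq (smeas_cst 0) _ => s; rewrite big_nil.
have [Pi|Pi] := boolP (P i).
  by apply: smeas_eq (smeasD (fm i Pi) IH) _ => s; rewrite big_cons Pi.
by apply: smeas_eq IH _ => s; rewrite big_cons (negbTE Pi).
Qed.

Lemma smeas_mulCl (c : C) (f : S -> C) : smeas f -> smeas (fun s => c * f s).
Proof. by move=> fm; apply: smeasM => //; exact: smeas_cst. Qed.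

End Strong.

Lemma smeasZ (V : normedModType C) (c : S -> C) (f : S -> V) :
  smeas c -> smeas f -> smeas (fun s => c s *: f s).
Proof.
apply: (@smeas_comp2 _ _ _ (fun a (x : V) => a *: x)) => *; exact: tends_scale.
Qed.

End Borel.

(** * Linear maps given by their values on monomials *)

Section LinearExtension.
Context (R : realType) (W : lmodType R[i]) (g : nat -> W).

Definition lin_ext (x : {poly R[i]}) : W := \sum_(i < size x) x`_i *: g i.

Lemma lin_extE n (x : {poly R[i]}) : (size x <= n)%N ->
  lin_ext x = \sum_(i < n) x`_i *: g i.
Proof.
move=> xn; rewrite /lin_ext -!(big_mkord predT (fun i => x`_i *: g i)).
rewrite (big_cat_nat (leq0n _) xn)//=.
have -> : \sum_(size x <= i < n) x`_i *: g i = 0.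
  rewrite big_nat_cond big1// => i; rewrite andbT => /andP[xi _].
  by rewrite nth_default ?scale0r.
by rewrite addr0.
Qed.

Lemma lin_extP c (x y : {poly R[i]}) : lin_ext (c *: x + y) = c *: lin_ext x + lin_ext y.
Proof.
pose n := maxn (size x) (size y).
have [xn yn] := (leq_maxl (size x) (size y), leq_maxr (size x) (size y)).
have zn : (size (c *: x + y)%R <= n)%N.
  apply: leq_trans (size_polyD _ _) _; rewrite geq_max yn andbT.
  exact: leq_trans (size_scale_leq _ _) xn.
rewrite (lin_extE zn) (lin_extE xn) (lin_extE yn) scaler_sumr -big_split /=.
by apply: eq_bigr => i _; rewrite coefD coefZ scalerDl scalerA.
Qed.

Lemma lin_extXn k : lin_ext 'X^k = g k.
Proof.
rewrite (@lin_extE k.+1) ?size_polyXn// big_ord_recr /= coefXn eqxx scale1r.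
by rewrite big1 ?add0r// => i _; rewrite coefXn ltn_eqF// scale0r.
Qed.

End LinearExtension.

Lemma lin_ext_comp (R : realType) (V W : lmodType R[i]) (g : nat -> V)
    (F : V -> W) x :
  (forall c x y, F (c *: x + y) = c *: F x + F y) ->
  F (lin_ext g x) = lin_ext (F \o g) x.
Proof.
move=> Fl; have F0 : F 0 = 0.
  have := Fl (- 1) 0 0; rewrite scaler0 addr0 scaleN1r => h.
  by rewrite h addNr.
rewrite /lin_ext; elim/big_rec2: _ => // i u v _ <-.
by rewrite Fl.
Qed.

(** * Measurable families of vectors and operators *)

Section BorelHilbert.
Context (R : realType) (H : hilbertType R) (d : nat -> H).
Notation C := R[i].
Notation E := {poly C}.
Hypothesis d_dense : forall x (e : C), 0 < e -> exists n, `|x - d n| < e.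

Lemma dense_tends (x : H) : exists n : nat -> nat, tends (fun k => d (n k)) x.
Proof.
have /choice[n nP] k : exists n, `|x - d n| < k.+1%:R^-1.
  by apply: d_dense; rewrite invr_gt0.
exists n; apply: (@tends_le _ _ _ (fun k => k.+1%:R^-1)); last exact: tends_inv.
by move=> k; rewrite distrC ltW.
Qed.

Lemma norm_le_dense (h : H) (c : C) : 0 <= c ->
  (`|h| <= c <-> forall m, `|inner h (d m)| <= c * `|d m|).
Proof.
move=> c0; split=> [hc m|hd].
  by apply: le_trans (inner_le _ _) _; rewrite ler_wpM2r.
have [->|h0] := eqVneq h 0; first by rewrite normr0.
have [n nh] := dense_tends h.
have key : `|inner h h| <= c * `|h|.
  apply: tends_ler (tends_norm (tends_inner (tends_cst h) nh)) _ (fun k => hd (n k)).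
  exact: tendsM (tends_cst c) (tends_norm nh).
rewrite -(ler_pM2r (_ : 0 < `|h|)) ?normr_gt0// -expr2 -inner_normE.
by rewrite -[leLHS]ger0_norm// inner_normE exprn_ge0.
Qed.

Lemma op_norm_le_dense (T : BH H) (c : C) : 0 <= c ->
  (`|T| <= c <-> forall m, `|T (d m)| <= c * `|d m|).
Proof.
move=> c0; split=> [Tc m|Td].
  by apply: le_trans (op_le _ _) _; rewrite ler_wpM2r.
apply: op_norm_le => // x; have [n nx] := dense_tends x.
apply: tends_ler (tends_norm (tends_op T nx)) _ (fun k => Td (n k)).
exact: tendsM (tends_cst c) (tends_norm nx).
Qed.

Context (S : Type) (bor : set (set S)).
Hypothesis hbor : sigma_algebra [set: S] bor.
Notation nmeas := (nmeas bor).
Notation smeas := (smeas bor).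

Lemma smeas_inner (f g : S -> H) : smeas f -> smeas g ->
  smeas (fun s => inner (f s) (g s)).
Proof. by apply: (smeas_comp2 hbor) => *; exact: tends_inner. Qed.

(** Pettis' argument: by [norm_le_dense], lying in a closed ball is a countable conjunction of
    conditions on inner products, and [smeas_dense] needs only balls around dense points. *)
Lemma smeas_weak (f : S -> H) : (forall y, smeas (fun s => inner (f s) y)) ->
  smeas f.
Proof.
move=> fw; apply: (smeas_dense hbor d_dense) => n k.
have le_bor (c : C) : 0 <= c -> bor [set s | `|f s - d n| <= c].
  move=> c0; apply: (bor_eq (P := fun s =>
    forall m, `|inner (f s - d n) (d m)| <= c * `|d m|)).
    apply: (bor_all hbor) => m; apply: (bor_norm_le hbor).
    apply: smeas_eq (smeasB hbor (fw (d m)) (smeas_cst hbor (inner (d n) (d m)))) _.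
    by move=> s; rewrite innerBl.
  by move=> s; rewrite (norm_le_dense _ c0).
(* The open ball is a union of closed balls of radii [c j]; the guard [0 <= c j] discards the
   indices for which the radius is negative. *)
pose c j : C := k.+1%:R^-1 - j.+1%:R^-1.
apply: (bor_eq (P := fun s => exists j, 0 <= c j /\ `|f s - d n| <= c j)).
  apply: (bor_ex hbor) => j; have [cj|cj] := boolP (0 <= c j).
    by apply: (bor_and hbor); [exact: bor_cst|exact: le_bor].
  apply: (bor_eq (P := fun=> False)); first exact: (bor_cst hbor).
  by move=> s; split=> // -[].
move=> s; split=> [[j [_ h]]|h].
  by apply: le_lt_trans h _; rewrite ltrBlDr ltrDl invr_gt0.
have h0 : 0 < k.+1%:R^-1 - `|f s - d n| by rewrite subr_gt0.
have [j hj] := archi_inv h0; exists j.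
have le : `|f s - d n| <= c j by rewrite lerBrDr -lerBrDl ltW.
by split=> //; apply: le_trans le.
Qed.

(** Measurability for the strong operator topology. In infinite dimension [BH H] is not norm
    separable, so [smeas] for the operator norm would be too restrictive. *)
Definition opmeas (X : S -> BH H) : Prop := forall x, smeas (fun s => X s x).

Lemma opmeas_weak (X : S -> BH H) :
  (forall x y, smeas (fun s => inner (X s x) y)) -> opmeas X.
Proof. by move=> Xw x; apply: smeas_weak => y. Qed.

Lemma opmeas_apply (X : S -> BH H) (f : S -> H) : opmeas X -> smeas f ->
  smeas (fun s => X s (f s)).
Proof.
move=> Xm [e [n [nm ef]]].
apply: (smeas_lim hbor (f := fun r s => X s (e (n r s)))) => [r|s].
  exact: (smeas_glue hbor (f := fun k s => X s (e k))).
exact: tends_op.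
Qed.

Lemma opmeas_cst (T : BH H) : opmeas (fun=> T).
Proof. by move=> x; exact: smeas_cst. Qed.

Lemma opmeasM (X Y : S -> BH H) : opmeas X -> opmeas Y ->
  opmeas (fun s => amul (X s) (Y s)).
Proof. by move=> Xm Ym x; exact: (opmeas_apply Xm (Ym x)). Qed.

Lemma opmeasB (X Y : S -> BH H) : opmeas X -> opmeas Y ->
  opmeas (fun s => X s - Y s).
Proof. by move=> Xm Ym x; exact: (smeasB hbor (Xm x) (Ym x)). Qed.

Lemma opmeasZ (c : C) (X : S -> BH H) : opmeas X -> opmeas (fun s => c *: X s).
Proof. by move=> Xm x; exact: (smeasZ hbor (smeas_cst hbor c) (Xm x)). Qed.

Lemma opmeasS (X : S -> BH H) : opmeas X -> opmeas (fun s => astar (X s)).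
Proof.
move=> Xm; apply: opmeas_weak => x y.
apply: smeas_eq (smeas_conj (smeas_inner (Xm y) (smeas_cst hbor x))) _.
by move=> s; rewrite adjointP -innerC.
Qed.

Lemma opmeas_glue (n : S -> nat) (X : nat -> S -> BH H) : nmeas n ->
  (forall k, opmeas (X k)) -> opmeas (fun s => X (n s) s).
Proof.
move=> nm Xm x; apply: (smeas_glue hbor (f := fun k s => X k s x)) => // k.
exact: Xm.
Qed.

Lemma opmeas_lim (X : nat -> S -> BH H) (Y : S -> BH H) : (forall k, opmeas (X k)) ->
  (forall s, tends (fun k => X k s) (Y s)) -> opmeas Y.
Proof.
move=> Xm XY x; apply: (smeas_lim hbor (f := fun k s => X k s x)) => [k|s].
  exact: Xm.
exact: tends_opE.
Qed.

Lemma opmeas_eq (X Y : S -> BH H) : opmeas X -> X =1 Y -> opmeas Y.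
Proof. by move=> Xm /funext <-. Qed.

Lemma bor_opnorm_lt (X : S -> BH H) (c : C) : opmeas X -> bor [set s | `|X s| < c].
Proof.
move=> Xm; pose c' k : C := c - k.+1%:R^-1.
apply: (bor_eq (P := fun s => exists k,
  0 <= c' k /\ forall m, `|X s (d m)| <= c' k * `|d m|)).
  apply: (bor_ex hbor) => k; apply: (bor_and hbor); first exact: bor_cst.
  by apply: (bor_all hbor) => m; exact: (bor_norm_le hbor).
move=> s; split=> [[k [c0 /(op_norm_le_dense _ c0) h]]|h].
  by apply: le_lt_trans h _; rewrite ltrBlDr ltrDl invr_gt0.
have h0 : 0 < c - `|X s| by rewrite subr_gt0.
have [k hk] := archi_inv h0; exists k.
have le : `|X s| <= c' k by rewrite lerBrDr -lerBrDl ltW.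
have c0 : 0 <= c' k by apply: le_trans le.
by split=> //; apply/op_norm_le_dense.
Qed.

Section InvSqrt.

Definition nonneg_rat (k : nat) : C :=
  if k is k'.+1 then (ratr `|odflt 0 (choice.unpickle k' : option rat)|)%:C else 0.

Lemma nonneg_rat_ge0 k : 0 <= nonneg_rat k.
Proof. by case: k => [|k] //=; rewrite lecR ler0q. Qed.

(** A nonnegative rational [q] with [q^2 z] close to [1] is close to
    [z^(-1/2)]; at [z = 0] there is none, and [least] falls back to index [0]. *)
Lemma smeas_invsqrt (f : S -> C) : smeas f -> (forall s, 0 <= f s) ->
  smeas (fun s => (sqrtC (f s))^-1).
Proof.
move=> fm f0; pose Q r m s := `|nonneg_rat m ^+ 2 * f s - 1| < r.+1%:R^-1.
exists nonneg_rat, (fun r s => least (Q r ^~ s)); split=> [r|s].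
  apply: (nmeas_least hbor) => m; apply: (bor_norm_lt hbor).
  by apply: (smeasB hbor); [exact: (smeas_mulCl hbor)|exact: smeas_cst].
have [z0|z0] := eqVneq (f s) 0.
  rewrite z0 sqrtC0 invr0; apply: (@tends_eq _ _ (fun=> 0)); first exact: tends_cst.
  move=> r; suff -> : least (Q r ^~ s) = 0%N by [].
  apply/least_eq; right; split=> // m; rewrite /Q z0 mulr0 sub0r normrN normr1.
  by apply/negP; rewrite le_gtF// invf_le1 ?ler1n ?ltr0n.
pose t := sqrtC (f s).
have t0 : 0 < t by rewrite sqrtC_gt0 lt_neqAle eq_sym z0 f0.
have fE : f s = t ^+ 2 by rewrite sqrtCK.
have ex r : exists m, Q r m s.
  have tE : t = (complex.Re t)%:C by rewrite RRe_real// gtr0_real.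
  set u := complex.Re t in tE; have u0 : 0 < u by rewrite -ltcR -tE.
  (* For [1 < w < 1 + e] with [e <= 1/4] one gets [w^2 - 1 < 2 e + e^2 < 4 e = 1/(r+1)]; here [w] is
     the candidate [q] times the square root [u]. *)
  pose e : R := (4 * r.+1%:R)^-1.
  have e0 : 0 < e by rewrite invr_gt0 mulr_gt0.
  have e1 : e <= 4^-1.
    by rewrite /e invfM ler_piMr ?invr_ge0// invf_le1// ler1n.
  have lt : u^-1 < u^-1 * (1 + e) by rewrite ltr_pMr ?invr_gt0// ltrDl.
  have [q] := rat_in_itvoo lt; rewrite in_itv /= => /andP[q1 q2].
  have q0 : 0 < q by rewrite -(ltr0q R); apply: lt_trans q1; rewrite invr_gt0.
  exists (choice.pickle q).+1; rewrite /Q /= choice.pickleK /= (gtr0_norm q0).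
  have w1 : 1 < ratr q * u by rewrite -ltr_pdivrMr// mul1r.
  have w2 : ratr q * u < 1 + e by rewrite -ltr_pdivlMr// mulrC.
  have -> : (r.+1%:R^-1 : C) = (4 * e)%:C.
    rewrite /e invfM mulrA mulfV// mul1r fmorphV rmorph_nat//.
  rewrite fE tE -exprMn -rmorphM -rmorphXn -(rmorph1 (real_complex R)) -rmorphB /=.
  rewrite normc_def /= expr0n addr0 sqrtr_sqr ltcR.
  move: (ratr q * u) w1 w2 => w w1 w2; rewrite ger0_norm.
    by nra.
  by nra.
apply: (@tends_le _ _ _ (fun r => t^-1 * r.+1%:R^-1)); last first.
  by apply: tends_mul0; exact: tends_inv.
move=> r; have := leastP (ex r); set m := least _; rewrite /Q => h; rewrite fE in h.
have q0 := nonneg_rat_ge0 m; set q := nonneg_rat m in q0 h *.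
rewrite -/t ler_pdivlMl//.
have -> : t * `|q - t^-1| = `|t * q - 1|.
  by rewrite -{1}(gtr0_norm t0) -normrM mulrBr mulfV// gt_eqF.
(* The second factor is at least 1, so the search criterion also bounds [t * q - 1]. *)
have f1 : q ^+ 2 * t ^+ 2 - 1 = (t * q - 1) * (t * q + 1) by ring.
rewrite f1 normrM in h; apply: le_trans (ltW h).
rewrite ler_peMr// ger0_norm; first by rewrite lerDr mulr_ge0// ltW.
by rewrite addr_ge0// mulr_ge0// ltW.
Qed.

End InvSqrt.

End BorelHilbert.

(** * Measurable dependence of Gram-Schmidt on the form *)

Section BorelGramSchmidt.
Context (R : realType) (S : Type) (bor : set (set S)).
Hypothesis hbor : sigma_algebra [set: S] bor.
Notation C := R[i].
Notation E := {poly C}.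
Notation smeas := (smeas bor).

(** The bound on the degree is uniform in [s], so that linear and sesquilinear expressions become
    fixed finite sums of measurable terms. *)
Definition pmeas (P : S -> E) : Prop :=
  (exists N, forall s, (size (P s) <= N)%N) /\ forall i, smeas (fun s => (P s)`_i).

Lemma pmeas_cst (x : E) : pmeas (fun=> x).
Proof. by split=> [|i]; [exists (size x)|exact: (smeas_cst hbor)]. Qed.

Lemma pmeasD (P Q : S -> E) : pmeas P -> pmeas Q -> pmeas (fun s => P s + Q s).
Proof.
move=> [[N PN] Pm] [[M QM] Qm]; split=> [|i].
  exists (maxn N M) => s; apply: leq_trans (size_polyD _ _) _.
  by rewrite geq_max !leq_max PN QM orbT.
apply: smeas_eq (smeasD hbor (Pm i) (Qm i)) _ => s.
by rewrite coefD.
Qed.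

Lemma pmeasZ (c : S -> C) (P : S -> E) : smeas c -> pmeas P ->
  pmeas (fun s => c s *: P s).
Proof.
move=> cm [[N PN] Pm]; split=> [|i].
  by exists N => s; apply: leq_trans (size_scale_leq _ _) _.
by apply: smeas_eq (smeasM hbor cm (Pm i)) _ => s; rewrite coefZ.
Qed.

Lemma pmeas_sum n (P : nat -> S -> E) : (forall k, (k < n)%N -> pmeas (P k)) ->
  pmeas (fun s => \sum_(k < n) P k s).
Proof.
elim: n => [|n IH] Pm.
  suff -> : (fun s => \sum_(k < 0) P k s) = fun=> 0 by exact: pmeas_cst.
  by apply/funext => s; rewrite big_ord0.
have -> : (fun s => \sum_(k < n.+1) P k s) =
    fun s => \sum_(k < n) P k s + P n s.
  by apply/funext => s; rewrite big_ord_recr.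
by apply: pmeasD; [apply: IH => k kn; apply: Pm; exact: ltnW|exact: Pm].
Qed.

Lemma pmeasB (P Q : S -> E) : pmeas P -> pmeas Q -> pmeas (fun s => P s - Q s).
Proof.
move=> Pm Qm; have -> : (fun s => P s - Q s) = fun s => P s + (-1) *: Q s.
  by apply/funext => s; rewrite scaleN1r.
by apply: pmeasD => //; apply: pmeasZ => //; exact: (smeas_cst hbor).
Qed.

Lemma pmeas_lin_ext (g : nat -> E) (P : S -> E) : pmeas P ->
  pmeas (fun s => lin_ext g (P s)).
Proof.
move=> [[N PN] Pm].
have -> : (fun s => lin_ext g (P s)) = fun s => \sum_(i < N) (P s)`_i *: g i.
  by apply/funext => s; rewrite (lin_extE _ (PN s)).
apply: (pmeas_sum (P := fun i s => (P s)`_i *: g i)) => k _.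
by apply: pmeasZ => //; exact: pmeas_cst.
Qed.

Context (f : S -> E -> E -> C).
Hypothesis hf : forall s, semi_inner (f s).
Hypothesis fm : forall k l, smeas (fun s => f s 'X^k 'X^l).

Lemma smeas_form (P Q : S -> E) : pmeas P -> pmeas Q ->
  smeas (fun s => f s (P s) (Q s)).
Proof.
move=> [[N PN] Pm] [[M QM] Qm].
apply: (smeas_eq (f := fun s => \sum_(i < N) \sum_(j < M)
    (P s)`_i * (Num.conj (Q s)`_j * f s 'X^i 'X^j))).
  apply: (smeas_sum hbor) => i _; apply: (smeas_sum hbor) => j _.
  apply: (smeasM hbor) => //; apply: (smeasM hbor) => //.
  exact: smeas_conj.
move=> s; rewrite [in RHS](polyE (PN s)) (semi_suml (hf s)).
apply: eq_bigr => i _; rewrite (semiZl (hf s)) [in RHS](polyE (QM s)).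
rewrite (semi_sumr (hf s)) mulr_sumr; apply: eq_bigr => j _.
by rewrite (semiZr (hf s)).
Qed.

Lemma pmeas_gs k : pmeas (fun s => gs (f s) k).
Proof.
elim/ltn_ind: k => k IH.
have rm : pmeas (fun s => gs_rest (f s) k).
  apply: pmeasB; first exact: pmeas_cst.
  apply: (pmeas_sum (P := fun l s => f s 'X^k (gs (f s) l) *: gs (f s) l)) => l lk.
  apply: pmeasZ; last exact: IH.
  by apply: smeas_form; [exact: pmeas_cst|exact: IH].
have -> : (fun s => gs (f s) k) = fun s => (sqrtC (f s (gs_rest (f s) k)
    (gs_rest (f s) k)))^-1 *: gs_rest (f s) k.
  by apply/funext => s; rewrite gsE.
apply: pmeasZ => //; apply: (smeas_invsqrt hbor); first exact: smeas_form.
by move=> s; exact: semi_ge0.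
Qed.

Context (H : hilbertType R) (e : nat -> H).

Lemma smeas_realize (P : S -> E) : pmeas P ->
  smeas (fun s => realize (f s) e (P s)).
Proof.
move=> Pm; have [[N PN] _] := Pm.
apply: (smeas_eq (f := fun s => \sum_(k < N) f s (P s) (gs (f s) k) *: e k)).
  apply: (smeas_sum hbor) => k _; apply: (smeasZ hbor).
    by apply: smeas_form => //; exact: pmeas_gs.
  exact: (smeas_cst hbor).
by move=> s; rewrite (realizeE (hf s) _ (PN s)).
Qed.

Lemma opmeas_represents (g : nat -> E) (T : S -> BH H) :
  (forall s, represents (f s) e (lin_ext g) (T s)) -> opmeas bor T.
Proof.
move=> Tg h; apply: (smeas_lim hbor
  (f := fun n s => realize (f s) e (lin_ext g (coords (f s) e n h)))) => [n|s].
  apply: smeas_realize; apply: pmeas_lin_ext.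
  apply: (pmeas_sum (P := fun k s => inner h (e k) *: gs (f s) k)) => k _.
  apply: pmeasZ; first exact: (smeas_cst hbor).
  exact: pmeas_gs.
exact: Tg.
Qed.

End BorelGramSchmidt.

(** * The limit of the Gram matrices *)

Section Selection.
Context (R : realType) (S : Type) (bor : set (set S)).
Hypothesis hbor : sigma_algebra [set: S] bor.
Notation C := R[i].

Definition unbounded (A : nat -> Prop) := forall N, exists j, (N <= j)%N /\ A j.

Definition ratC (k : nat) : C := (ratr (odflt 0 (choice.unpickle k : option rat)))%:C.

(** Compactness of [[-B, B]] gives a cluster point of [x] along [A]; a rational close enough to it
    is approached by infinitely many terms. *)
Lemma unbounded_ball (A : nat -> Prop) (x : nat -> R) (B : R) (k : nat) :
  unbounded A -> (forall j, `|x j| <= B) ->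
  exists q, unbounded (fun j => A j /\ `|(x j)%:C - ratC q| < k.+1%:R^-1).
Proof.
move=> Au xB; have /choice[r rP] := Au.
have comp : compact (`[- B, B]%classic : set R) by exact: segment_compact.
pose y n := x (r n).
have yB : ((y @ \oo) `[- B, B]%classic).
  by exists 0%N => // n _ /=; rewrite in_itv /= -ler_norml; exact: xB.
have [z [_ zc]] := comp (y @ \oo) _ yB.
pose e : R := (4 * k.+1%:R)^-1.
have e0 : 0 < e by rewrite invr_gt0 mulr_gt0.
have lt : z < z + e by rewrite ltrDl.
have [q] := rat_in_itvoo lt; rewrite in_itv /= => /andP[q1 q2].
exists (choice.pickle q) => N.
have fN : (y @ \oo) (y @` [set n | (N <= n)%N]) by exists N => // n Nn; exists n.
have [_ [[n Nn <-]]] := zc _ _ fN (nbhsx_ballx z e e0).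
rewrite -ball_normE /= /y => zy; exists (r n); have [nr Ar] := rP n.
split; first exact: leq_trans nr.
split=> //; rewrite /ratC choice.pickleK /= -rmorphB normc_def /= expr0n addr0.
have -> : (k.+1%:R^-1 : C) = (4 * e)%:C.
  by rewrite /e invfM mulrA mulfV// mul1r fmorphV rmorph_nat.
rewrite sqrtr_sqr ltcR; move: zy; rewrite ltr_norml => /andP[h1 h2].
by rewrite ltr_norml; apply/andP; split; lra.
Qed.

Context (x : S -> nat -> nat -> R).
Hypothesis xm : forall j k, smeas bor (fun s => (x s j k)%:C).
Hypothesis xB : forall s k, exists B, forall j, `|x s j k| <= B.

Definition refine (A : nat -> Prop) s t q j : Prop :=
  A j /\ `|(x s j (unpair t).1)%:C - ratC q| < (unpair t).2.+1%:R^-1.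

(** A Borel form of the diagonal subsequence argument. Step [t], read as a pair [(k, i)], keeps the
    stages at which the [k]-th sequence is within [1/(i+1)] of one rational, the first for which
    infinitely many stages survive. The sets decrease and every pair occurs, so picking from them
    successively makes every sequence Cauchy. *)
Fixpoint nest (t : nat) (s : S) : nat -> Prop :=
  if t is t'.+1 then
    refine (nest t' s) s t' (least (fun q => unbounded (refine (nest t' s) s t' q)))
  else fun=> True.

Definition select (s : S) (t : nat) : nat :=
  least (fun j => (t <= j)%N /\ nest t s j).

Lemma nest_unbounded t s : unbounded (nest t s).
Proof.
elim: t => [N|t IH]; first by exists N.
apply: (@leastP (fun q => unbounded (refine (nest t s) s t q))).
have [B hB] := xB s (unpair t).1; exact: unbounded_ball IH hB.
Qed.

Lemma bor_nest t j : bor [set s | nest t s j].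
Proof.
elim: t j => [|t IH] j; first exact: (bor_cst hbor).
have br q i : bor [set s | refine (nest t s) s t q i].
  apply: (bor_and hbor) => //; apply: (bor_norm_lt hbor).
  by apply: (smeasB hbor) => //; exact: (smeas_cst hbor).
apply: (nmeas_glue hbor (P := fun q s => refine (nest t s) s t q j)) => //.
apply: (nmeas_least hbor) => q; apply: (bor_all hbor) => N.
by apply: (bor_ex hbor) => i; apply: (bor_and hbor) => //; exact: (bor_cst hbor).
Qed.

Lemma nmeas_select t : nmeas bor (select^~ t).
Proof.
apply: (nmeas_least hbor (P := fun j s => (t <= j)%N /\ nest t s j)) => j.
by apply: (bor_and hbor); [exact: (bor_cst hbor)|exact: bor_nest].
Qed.

Lemma selectP s t : (t <= select s t)%N /\ nest t s (select s t).
Proof. exact: (leastP (nest_unbounded t s t)). Qed.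

Lemma nest_le s t t' j : (t <= t')%N -> nest t' s j -> nest t s j.
Proof.
move=> tt; rewrite -(subnKC tt); elim: (t' - t)%N => [|n IH]; first by rewrite addn0.
by rewrite addnS => -[/IH].
Qed.

Lemma select_cauchys s k : cauchys (fun t => (x s (select s t) k)%:C : C).
Proof.
move=> e e0; have [i ie] := archi_inv (divr_gt0 e0 (ltr0n _ 2)).
pose t0 := choice.pickle (k, i).
exists t0.+1 => m n tm tn.
have close m' : (t0.+1 <= m')%N -> exists q, 
    `|(x s (select s m') k)%:C - ratC q| < i.+1%:R^-1 /\
    q = least (fun q => unbounded (refine (nest t0 s) s t0 q)).
  move=> tm'; have [_ /(nest_le tm')[_]] := selectP s m'.
  by rewrite pairK /= => h; eexists; split; [exact: h|].
have [q [h1 qE]] := close _ tm; have [q' [h2 qE']] := close _ tn.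
rewrite -(subrKA (ratC q)) (splitr e); apply: le_lt_trans (ler_normD _ _) _.
apply: ltrD; first exact: lt_trans ie.
by rewrite distrC qE -qE'; exact: lt_trans ie.
Qed.

End Selection.

Definition evtl (P : nat -> Prop) : Prop := exists N, forall j, (N <= j)%N -> P j.

(** * The GNS construction for bounded sequences of operators *)

Section AsymptoticRepresentation.
Context (R : realType) (H : hilbertType R) (d e : nat -> H).
Notation C := R[i].
Notation E := {poly C}.
Hypothesis d_dense : forall x (eps : C), 0 < eps -> exists n, `|x - d n| < eps.
Hypothesis he : forall i j, inner (e i) (e j) = (i == j)%:R.
Context (S : Type) (bor : set (set S)).
Hypothesis hbor : sigma_algebra [set: S] bor.
Context (X : S -> nat -> nat -> BH H) (M : S -> nat -> C).
Hypothesis Xm : forall a j, opmeas bor (fun s => X s a j).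
Hypothesis XM : forall s a j, `|X s a j| <= M s a.

(** The second clause is [|T| <= 2 |T (d n)|] tested on the dense vectors, which makes the search
    for a seed Borel. The two factors 2 leave room to replace a nearly norming unit vector by a
    nearby [d n]. *)
Definition is_seed (T : BH H) (n : nat) : Prop :=
  `|d n| <= 2 /\ forall m, `|T (d m)| <= 2 * `|T (d n)| * `|d m|.

Lemma is_seed_le T n : is_seed T n -> `|T| <= 2 * `|T (d n)|.
Proof. by move=> [_ h]; apply/(op_norm_le_dense d_dense); rewrite ?mulr_ge0. Qed.

Lemma is_seed_ex T : exists n, is_seed T n.
Proof.
suff [n [dn Tn]] : exists n, `|d n| <= 2 /\ `|T| <= 2 * `|T (d n)|.
  exists n; split=> // m; apply: le_trans (op_le _ _) _.
  by rewrite ler_wpM2r.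
have [T0|T0] := eqVneq T 0.
  have [n hn] := d_dense 0 (ltr0n C 2); exists n; split.
    by rewrite ltW//; move: hn; rewrite sub0r normrN.
  by rewrite T0 normr0 mulr_ge0.
have nT : 0 < `|T| by rewrite normr_gt0.
have [x hx] : exists x, `|T| / 2 * `|x| < `|T x|.
  apply: contrapT => h; have : `|T| <= `|T| / 2.
    apply: op_norm_le => [|x]; first by rewrite divr_ge0.
    rewrite real_leNgt ?normr_real ?realM ?realV ?normr_real ?realn//.
    by apply/negP => hx; apply: h; exists x.
  by rewrite ler_pdivlMr// ger_pMr// real_leNgt ?realn// ltr1n.
have x0 : 0 < `|x|.
  by rewrite normr_gt0; apply/eqP => x0; move: hx; rewrite x0 linear0 !normr0 mulr0 ltxx.
pose y := `|x|^-1 *: x.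
have y1 : `|y| = 1 by rewrite normrZ normfV normr_id mulVf// gt_eqF.
have Ty : 0 < `|T y| - `|T| / 2.
  rewrite subr_gt0 linearZ normrZ normfV normr_id ltr_pdivlMl// mulrC.
  by [].
have [n ny] := dense_tends d_dense y.
have [N1 h1] := tends_norm ny ltr01.
have [N2 h2] := tends_norm (tends_op T ny) Ty.
have {}h1 := h1 _ (leq_maxl N1 N2); have {}h2 := h2 _ (leq_maxr N1 N2).
exists (n (maxn N1 N2)); split.
  rewrite -[X in X <= _](subrK `|y|) y1 -[2]/(1 + 1) lerD2r.
  by apply: le_trans (ltW h1); rewrite y1 real_ler_norm// realB ?normr_real ?real1.
rewrite -ler_pdivrMl// mulrC ltW//.
have : `|T y| - `|T (d (n (maxn N1 N2)))| < `|T y| - `|T| / 2.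
  by apply: le_lt_trans h2; rewrite distrC real_ler_norm// realB ?normr_real.
by rewrite ltrD2l ltrN2.
Qed.

Definition seed s t j : H := d (least (is_seed (X s t j))).

Lemma seedP s t j : is_seed (X s t j) (least (is_seed (X s t j))).
Proof. exact: leastP (is_seed_ex _). Qed.

Lemma smeas_seed t j : smeas bor (fun s => seed s t j).
Proof.
apply: (smeas_nat d); apply: (nmeas_least hbor (P := fun n s => is_seed (X s t j) n)) => n.
apply: (bor_and hbor); first exact: (bor_cst hbor).
apply: (bor_all hbor) => m; apply: (bor_le hbor) => [||s|s].
- exact: smeas_norm (Xm t j (d m)).
- apply: (smeasM hbor); last exact: (smeas_cst hbor).
  by apply: (smeas_mulCl hbor); exact: smeas_norm (Xm t j (d n)).
- exact: normr_ge0.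
- by rewrite !mulr_ge0.
Qed.

(** The index of [(w, t)] stands for the word [w] applied to the seed of [t]. *)
Definition vec_index k : seq nat * nat :=
  odflt ([::], 0%N) (choice.unpickle k : option (seq nat * nat)).

Definition vec s j k : H :=
  foldr (fun a v => X s a j v) (seed s (vec_index k).2 j) (vec_index k).1.

Definition push a k := choice.pickle (a :: (vec_index k).1, (vec_index k).2).

Lemma vec_push s j a k : vec s j (push a k) = X s a j (vec s j k).
Proof.
suff E : vec_index (push a k) = (a :: (vec_index k).1, (vec_index k).2).
  by rewrite /vec E.
by rewrite {1}/vec_index /push choice.pickleK.
Qed.

Lemma smeas_vec j k : smeas bor (fun s => vec s j k).
Proof.
rewrite /vec; elim: (vec_index k).1 => [|a w IH] /=; first exact: smeas_seed.
exact: (opmeas_apply hbor (Xm a j) IH).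
Qed.

Lemma vec_bounded s k : exists B : C, 0 <= B /\ forall j, `|vec s j k| <= B.
Proof.
rewrite /vec; elim: (vec_index k).1 => [|a w [B [B0 hB]]] /=.
  by exists 2; split=> // j; have [] := seedP s (vec_index k).2 j.
have M0 : 0 <= M s a by apply: le_trans (XM s a 0%N).
exists (M s a * B); split=> [|j]; first exact: mulr_ge0.
by apply: le_trans (op_le _ _) _; exact: ler_pM.
Qed.

Definition ev s j : E -> H := lin_ext (vec s j).

(** Prefixing a letter to a word involves neither [s] nor the stage; [ev s j] intertwines it with
    [X s a j]. In the limit only the form depends on [s], as [opmeas_represents] requires. *)
Definition word_act a : E -> E := lin_ext (fun k => 'X^(push a k)).

Lemma evP s j c x y : ev s j (c *: x + y) = c *: ev s j x + ev s j y.
Proof. exact: lin_extP. Qed.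

Lemma ev0 s j : ev s j 0 = 0.
Proof. by rewrite /ev /lin_ext size_poly0 big_ord0. Qed.

Lemma evZ s j c x : ev s j (c *: x) = c *: ev s j x.
Proof. by rewrite -[c *: x]addr0 evP ev0 addr0. Qed.

Lemma evD s j x y : ev s j (x + y) = ev s j x + ev s j y.
Proof. by rewrite -[x in LHS]scale1r evP scale1r. Qed.

Lemma evB s j x y : ev s j (x - y) = ev s j x - ev s j y.
Proof. by rewrite evD -scaleN1r evZ scaleN1r. Qed.

Lemma ev_word_act s j a x : ev s j (word_act a x) = X s a j (ev s j x).
Proof.
rewrite /word_act (lin_ext_comp _ _ (evP s j)) /ev (lin_ext_comp _ _ (linearP (X s a j))).
by apply: eq_bigr => k _; rewrite /= lin_extXn vec_push.
Qed.

(** An index [2 i + b] stands for the real ([b = 1]) or imaginary ([b = 0]) part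
    of the Gram matrix entry [unpair i]. *)
Definition gram_part (k : nat) (z : C) : R :=
  if odd k then complex.Re z else complex.Im z.

Definition gram_index k : nat * nat := unpair k./2.

Definition gram_entry s j k : C :=
  inner (vec s j (gram_index k).1) (vec s j (gram_index k).2).

Definition gram_seq s j k : R := gram_part k (gram_entry s j k).

Lemma gram_part_le k z : `|gram_part k z|%:C <= `|z|.
Proof. by rewrite /gram_part; case: odd; [exact: Re_le|exact: Im_le]. Qed.

Lemma gram_seq_meas j k : smeas bor (fun s => (gram_seq s j k)%:C).
Proof.
apply: (@smeas_comp _ _ _ _ _ (fun z : C => (gram_part k z)%:C)).
  move=> u l; apply: (@tends_lin _ _ _ (fun z : C => (gram_part k z)%:C) 1).
    by move=> x y; rewrite /gram_part -rmorphB; case: odd; rewrite raddfB.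
  move=> x; rewrite mul1r normc_def /= expr0n addr0 sqrtr_sqr.
  exact: gram_part_le.
by apply: (smeas_inner hbor); exact: smeas_vec.
Qed.

Lemma gram_seq_bounded s k : exists B, forall j, `|gram_seq s j k| <= B.
Proof.
have [B1 [B10 h1]] := vec_bounded s (gram_index k).1.
have [B2 [B20 h2]] := vec_bounded s (gram_index k).2.
exists (complex.Re (B1 * B2)) => j; rewrite -lecR RRe_real; last first.
  by rewrite ger0_real// mulr_ge0.
apply: le_trans (gram_part_le _ _) _; apply: le_trans (inner_le _ _) _.
exact: ler_pM.
Qed.

(** All the Gram matrices converge along this sequence of stages. *)
Definition selected s t : nat := select gram_seq s t.

Lemma selected_ge s t : (t <= selected s t)%N.
Proof. by have [] := selectP gram_seq_bounded s t. Qed.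

Lemma gram_tends s k l : exists z,
  tends (fun t => inner (vec s (selected s t) k) (vec s (selected s t) l)) z.
Proof.
pose i := choice.pickle (k, l).
have part b := select_cauchys gram_seq_bounded s (b + i.*2).
have iE (b : bool) : gram_index (b + i.*2) = (k, l).
  by rewrite /gram_index half_bit_double pairK.
have [x hx] := cauchysC_tends (part true).
have [y hy] := cauchysC_tends (part false).
exists (x + 'i%C * y).
apply: tends_eq (tendsD hx (tendsM (tends_cst 'i%C) hy)) _ => t.
rewrite /gram_seq /gram_entry !iE /gram_part !oddD odd_double /=.
by rewrite -complexE.
Qed.

Lemma lim_form_tends s x y : exists z,
  tends (fun t => inner (ev s (selected s t) x) (ev s (selected s t) y)) z.
Proof.
have /choice[G hG] k : exists g : nat -> C, forall l,
    tends (fun t => inner (vec s (selected s t) k) (vec s (selected s t) l)) (g l).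
  by have /choice[g gP] := gram_tends s k; exists g.
exists (\sum_(k < size x) \sum_(l < size y) x`_k * (Num.conj y`_l * G k l)).
apply: (@tends_eq _ _ (fun t => \sum_(k < size x) \sum_(l < size y)
    x`_k * (Num.conj y`_l * inner (vec s (selected s t) k) (vec s (selected s t) l)))).
  apply: tends_sum => k _; apply: tends_sum => l _.
  by apply: tendsM; [exact: tends_cst|apply: tendsM => //; exact: tends_cst].
move=> t; rewrite /ev /lin_ext inner_suml; apply: eq_bigr => k _.
rewrite innerZl inner_sumr mulr_sumr; apply: eq_bigr => l _.
by rewrite innerZr.
Qed.

Definition lim_form s x y : C := xget 0
  [set z | tends (fun t => inner (ev s (selected s t) x) (ev s (selected s t) y)) z].

Lemma lim_formP s x y :
  tends (fun t => inner (ev s (selected s t) x) (ev s (selected s t) y)) (lim_form s x y).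
Proof. exact: (xgetPex 0 (lim_form_tends s x y)). Qed.

Lemma lim_form_norm s x :
  tends (fun t => `|ev s (selected s t) x| ^+ 2) (lim_form s x x).
Proof. by apply: tends_eq (lim_formP s x x) _ => t; rewrite inner_normE. Qed.

Lemma lim_form_semi s : semi_inner (lim_form s).
Proof.
split=> [c x y z|x y|x].
- apply: tends_unique (lim_formP s _ _) _.
  apply: tends_eq (tendsD (tendsM (tends_cst c) (lim_formP s x z)) (lim_formP s y z)) _ => t.
  by rewrite evP innerDl innerZl.
- apply: tends_unique (lim_formP s _ _) _.
  by apply: tends_eq (tends_conj (lim_formP s y x)) _ => t; rewrite -innerC.
- apply: tends_ler (tends_cst 0) (lim_form_norm s x) _ => t; exact: exprn_ge0.
Qed.

(** Selected stages tend to infinity, so an estimate valid from some stage on passes to the limit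
    form. All algebraic relations except the adjoint, and all upper bounds, are transferred by this
    lemma. *)
Lemma lim_form_le s x y (K : C) : 0 <= K ->
  evtl (fun j => `|ev s j x| <= K * `|ev s j y|) ->
  lim_form s x x <= K ^+ 2 * lim_form s y y.
Proof.
move=> K0 [N hN].
have := tends_ler (tends_sub (fun n => leq_addr N n) (lim_form_norm s x))
  (tendsM (tends_cst (K ^+ 2)) (tends_sub (fun n => leq_addr N n) (lim_form_norm s y))).
apply=> n /=; rewrite -exprMn ler_pXn2r ?nnegrE ?mulr_ge0//; apply: hN.
by apply: leq_trans (selected_ge s _); exact: leq_addl.
Qed.

Lemma lim_form_null s z : evtl (fun j => ev s j z = 0) -> null (lim_form s) z.
Proof.
move=> [N hN]; apply: (nullP (lim_form_semi s)); apply/eqP; rewrite eq_le.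
rewrite (semi_ge0 (lim_form_semi s)) andbT.
have -> : 0 = 0 ^+ 2 * lim_form s z z by rewrite expr0n mul0r.
by apply: lim_form_le => //; exists N => j /hN ->; rewrite !normr0 mulr0.
Qed.

Lemma lim_form_meas k l : smeas bor (fun s => lim_form s 'X^k 'X^l).
Proof.
apply: (smeas_lim hbor
  (f := fun t s => inner (vec s (selected s t) k) (vec s (selected s t) l))).
  move=> t; apply: (smeas_glue hbor (n := selected^~ t)
    (f := fun j s => inner (vec s j k) (vec s j l))).
    exact: (nmeas_select hbor gram_seq_meas).
  by move=> j; apply: (smeas_inner hbor); exact: smeas_vec.
by move=> s; apply: tends_eq (lim_formP s 'X^k 'X^l) _ => t; rewrite /ev !lin_extXn.
Qed.

Lemma word_act_bounded s a : bounded_act (lim_form s) (word_act a) (M s a).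
Proof.
split=> [c x y|x]; first exact: lin_extP.
apply: lim_form_le; first exact: le_trans (XM s a 0%N).
exists 0%N => j _; rewrite ev_word_act; apply: le_trans (op_le _ _) _.
by apply: ler_wpM2r => //; exact: XM.
Qed.

(** A faithful representation of the [X_j a] modulo those tending to [0], as
    in the GNS construction for a limit of vector states. *)
Theorem asymptotic_representation : exists T : S -> nat -> BH H,
  [/\ forall a, opmeas bor (fun s => T s a),
      forall s a b c, evtl (fun j => X s a j + X s b j = X s c j) ->
        T s a + T s b = T s c,
      forall s a b z, evtl (fun j => X s a j = z *: X s b j) -> T s a = z *: T s b,
      forall s a b c, evtl (fun j => amul (X s a j) (X s b j) = X s c j) ->
        amul (T s a) (T s b) = T s c &
      forall s a b, evtl (fun j => astar (X s a j) = X s b j) ->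
        astar (T s a) = T s b] /\
  [/\ forall s a K, 0 <= K -> evtl (fun j => `|X s a j| <= K) -> `|T s a| <= K,
      forall s a b K, 0 <= K -> evtl (fun j => `|X s a j - X s b j| <= K) ->
        `|T s a - T s b| <= K &
      forall s a K, 0 <= K -> evtl (fun j => K <= `|X s a j|) -> K <= 4 * `|T s a|].
Proof.
have M0 s a : 0 <= M s a by apply: le_trans (XM s a 0%N).
have /choice[T hT] s : exists T, forall a, represents (lim_form s) e (word_act a) (T a).
  have /choice[T TP] := fun a =>
    represents_ex (lim_form_semi s) he (M0 s a) (word_act_bounded s a).
  by exists T.
exists T; split; split.
- by move=> a; exact: (opmeas_represents hbor lim_form_semi lim_form_meas (hT^~ a)).
- move=> s a b c [N hN].
  apply: (represents_eq (lim_form_semi s) he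
    (representsD (lim_form_semi s) (hT s a) (hT s b)) (hT s c)).
  move=> x; apply: lim_form_null; exists N => j Nj.
  by rewrite evB evD !ev_word_act -hN// opDE subrr.
- move=> s a b z [N hN].
  apply: (represents_eq (lim_form_semi s) he (hT s a)
    (representsZ (lim_form_semi s) z (hT s b))).
  move=> x; apply: lim_form_null; exists N => j Nj.
  by rewrite evB evZ !ev_word_act hN// opZE subrr.
- move=> s a b c [N hN].
  apply: (represents_eq (lim_form_semi s) he (representsM (lim_form_semi s) he (M0 s a)
    (word_act_bounded s a) (hT s a) (hT s b)) (hT s c)).
  move=> x; apply: lim_form_null; exists N => j Nj.
  by rewrite evB /= !ev_word_act -hN// opME subrr.
- move=> s a b [N hN].
  apply: (represents_star (lim_form_semi s) he (hT s a) (hT s b)) => x y.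
  apply: tends_unique (lim_formP s _ _) _; apply: tends_eveq (lim_formP s _ _) _.
  exists N => t Nt; rewrite !ev_word_act -hN ?adjointP//.
  exact: leq_trans Nt (selected_ge s t).
- move=> s a K K0 [N hN]; rewrite -[T s a]subr0.
  apply: (represents_dist (lim_form_semi s) he K0 (hT s a)
    (represents0 (lim_form_semi s) he)).
  move=> x; rewrite subr0; apply: lim_form_le => //; exists N => j Nj.
  by rewrite ev_word_act; apply: le_trans (op_le _ _) _; rewrite ler_wpM2r// hN.
- move=> s a b K K0 [N hN].
  apply: (represents_dist (lim_form_semi s) he K0 (hT s a) (hT s b)) => x.
  apply: lim_form_le => //; exists N => j Nj; rewrite evB !ev_word_act -opBE.
  by apply: le_trans (op_le _ _) _; rewrite ler_wpM2r// hN.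
move=> s a K K0 [N hN].
(* The empty word on the seed of [a]: its realization [v] has norm at most 2, while
   [|T s a v| >= K / 2] because the seed attains half of each norm [|X s a j|]. This gives the
   factor 4. *)
pose k := choice.pickle ([::] : seq nat, a).
have vk j : vec s j k = seed s a j by rewrite /vec /k /vec_index choice.pickleK.
pose v := realize (lim_form s) e 'X^k.
have v2 : `|v| <= 2.
  rewrite -(@ler_pXn2r _ 2) ?nnegrE// (realize_norm (lim_form_semi s) he).
  apply: tends_ler (lim_form_norm s _) (tends_cst _) _ => t.
  rewrite /ev lin_extXn vk ler_pXn2r ?nnegrE//.
  by have [] := seedP s a (selected s t).
have Tv : K / 2 <= `|T s a v|.
  rewrite (represents_realize (lim_form_semi s) he _ (M0 s a)
    (word_act_bounded s a) (hT s a)).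
  rewrite -(@ler_pXn2r _ 2) ?nnegrE ?divr_ge0// (realize_norm (lim_form_semi s) he).
  apply: tends_ler (tends_cst _) (tends_sub (fun n => leq_addr N n) (lim_form_norm s _)) _.
  move=> n /=; rewrite ev_word_act /ev lin_extXn vk ler_pXn2r ?nnegrE ?divr_ge0//.
  rewrite ler_pdivrMr// mulrC.
  apply: le_trans (is_seed_le (seedP s a (selected s (n + N)))).
  by apply: hN; apply: leq_trans (selected_ge s _); exact: leq_addl.
have : K / 2 <= `|T s a| * 2.
  apply: le_trans Tv _; apply: le_trans (op_le _ _) _.
  by rewrite ler_wpM2l.
by rewrite ler_pdivrMr// -mulrA -natrM mulrC.
Qed.

End AsymptoticRepresentation.

(** * The weak Borel structure *)

Section Sequences.
Context (R : realType) (H : hilbertType R).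
Notation C := R[i].

Lemma separable_dense_seq : separable H -> exists d : nat -> H,
  forall x (eps : C), 0 < eps -> exists n, `|x - d n| < eps.
Proof.
move=> [D /countable_injP[g ginj] Dd].
pose d n := xget 0 [set x | D x /\ g x = n].
exists d => x eps e0.
have [y [xy Dy]] : (ball x eps `&` D) !=set0.
  by apply: Dd; [exists x; exact: ballxx|exact: ball_open].
exists (g y); suff -> : d (g y) = y by move: xy; rewrite -ball_normE.
have : exists z, D z /\ g z = g y by exists y.
move=> /(xgetPex (0 : H)) [Dz gz].
by apply: ginj => //; exact/mem_set.
Qed.

Definition orthonormal_seq (l : seq H) : Prop := forall i j,
  (i < size l)%N -> (j < size l)%N -> inner (nth 0 l i) (nth 0 l j) = (i == j)%:R.

Lemma orthonormal_extend (l : seq H) : infinite_dimensional H ->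
  orthonormal_seq l ->
  exists y, inner y y = 1 /\ forall i, (i < size l)%N -> inner y (nth 0 l i) = 0.
Proof.
move=> Hinf lo; pose P (x : H) := \sum_(i < size l) inner x (nth 0 l i) *: nth 0 l i.
have [x Px] : exists x, x <> P x.
  apply: contrapT => h; apply: Hinf; exists (size l), (fun i => nth 0 l i) => x.
  exists (fun i => inner x (nth 0 l i)); apply: contrapT => hx; apply: h.
  by exists x.
have r0 : x - P x != 0 by rewrite subr_eq0; apply/eqP.
have ro i : (i < size l)%N -> inner (x - P x) (nth 0 l i) = 0.
  move=> il; rewrite innerBl inner_suml (bigD1 (Ordinal il))//= innerZl lo// eqxx.
  rewrite mulr1 big1 ?addr0 ?subrr// => j ji; rewrite innerZl lo//.
  by rewrite (_ : (j == i :> nat) = false) ?mulr0//; exact/negbTE.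
exists (`|x - P x|^-1 *: (x - P x)); split.
  rewrite inner_normE normrZ normfV normr_id mulVf ?expr1n//.
  by rewrite normr_eq0.
by move=> i il; rewrite innerZl ro// mulr0.
Qed.

Lemma orthonormal_ex : infinite_dimensional H ->
  exists e : nat -> H, forall i j, inner (e i) (e j) = (i == j)%:R.
Proof.
move=> Hinf.
have /choice[f fP] l : exists y, orthonormal_seq l ->
    inner y y = 1 /\ forall i, (i < size l)%N -> inner y (nth 0 l i) = 0.
  have [lo|nlo] := pselect (orthonormal_seq l); last by exists 0.
  by have [y hy] := orthonormal_extend Hinf lo; exists y.
pose el n := iter n (fun l => rcons l (f l)) [::].
have elS n : el n.+1 = rcons (el n) (f (el n)) by [].
have es n : size (el n) = n by elim: n => [//|n IH]; rewrite elS size_rcons IH.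
pose e n := f (el n).
have en n i : (i < n)%N -> nth 0 (el n) i = e i.
  elim: n => [//|n IH]; rewrite elS nth_rcons es ltnS leq_eqVlt => /predU1P[->|lt].
    by rewrite ltnn eqxx.
  by rewrite lt IH.
have eo n : orthonormal_seq (el n).
  elim: n => [|n IH] i j; first by rewrite es.
  have [f1 f2] := fP _ IH.
  rewrite elS size_rcons es !ltnS !nth_rcons es => ile jle.
  have [iltn|ni] := ltnP i n; have [jltn|nj] := ltnP j n.
  - by apply: IH; rewrite es.
  - have -> : j = n by apply/eqP; rewrite eqn_leq jle.
    by rewrite eqxx innerC f2 ?es// conjC0 ltn_eqF.
  - have -> : i = n by apply/eqP; rewrite eqn_leq ile.
    by rewrite eqxx f2 ?es// gtn_eqF.
  - have -> : i = n by apply/eqP; rewrite eqn_leq ile.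
    have -> : j = n by apply/eqP; rewrite eqn_leq jle.
    by rewrite eqxx f1.
exists e => i j; pose n := (maxn i j).+1.
rewrite -(@en n i) ?ltnS ?leq_maxl// -(@en n j) ?ltnS ?leq_maxr// eo//.
  by rewrite es ltnS leq_maxl.
by rewrite es ltnS leq_maxr.
Qed.

End Sequences.

Section WeakTopology.
Context (R : realType) (H : hilbertType R).
Notation C := R[i].

Lemma weak_open_coef (x y : H) (q : C) (r : C) :
  @open (BH_weak H) [set T : BH_weak H | `|inner ((T : BH H) x) y - q| < r].
Proof.
pose B : set (C^o) := [set z | `|z - q| < r].
have oB : open B.
  rewrite openE => z Bz; have e0 : 0 < r - `|z - q| by rewrite subr_gt0.
  apply/nbhs_ballP; exists (r - `|z - q|) => // w; rewrite -ball_normE /= => zw.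
  rewrite /B /= -(subrKA z); apply: le_lt_trans (ler_normD _ _) _.
  by rewrite distrC -ltrBrDr.
have oP : @open (prod_topology (fun _ : H * H => (C^o : topologicalType)))
    (@proj _ (fun _ : H * H => (C^o : topologicalType)) (x, y) @^-1` B).
  by apply: open_comp => // g _; exact: proj_continuous.
by exists (@proj _ (fun _ : H * H => (C^o : topologicalType)) (x, y) @^-1` B).
Qed.

Lemma weak_open_tends (U : set (BH H)) (T : BH H) (u : nat -> BH H) :
  @open (BH_weak H) U -> U T ->
  (forall x y, tends (fun n => inner (u n x) y) (inner (T x) y)) ->
  exists N, forall n, (N <= n)%N -> U (u n).
Proof.
move=> [Q oQ <-] QT uT.
pose PT := prod_topology (fun _ : H * H => (C^o : topologicalType)).
have cv : ((@matrix_coef R H) \o u : nat -> PT) @ \oo --> (matrix_coef T : PT).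
  apply/cvg_sup => -[x y] A /=.
  move=> [B [[W oW <-] /= WT] BA].
  have : nbhs (inner (T x) y : C^o) W by exact: open_nbhs_nbhs.
  move=> /nbhs_ballP[r /= r0 rW]; have [N hN] := uT x y r r0.
  exists N => // n Nn; apply: BA; apply: rW; rewrite -ball_normE /= distrC.
  exact: hN.
have /cv [N _ hN] : nbhs (matrix_coef T : PT) Q by exact: open_nbhs_nbhs.
by exists N => n Nn; exact: hN.
Qed.

End WeakTopology.

Section WeakBorelOperators.
Context (R : realType) (H : hilbertType R) (d : nat -> H).
Notation C := R[i].
Hypothesis d_dense : forall x (eps : C), 0 < eps -> exists n, `|x - d n| < eps.

Definition qC (k : nat) : C := Qi_embed R (odflt 0 (choice.unpickle k : option rat[i])).

Lemma qC_dense (z : C) (eps : C) : 0 < eps -> exists k, `|z - qC k| < eps.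
Proof.
move=> e0; have [q qz] := Qi_dense z; have [N hN] := qz _ e0.
exists (choice.pickle (q N)); rewrite /qC choice.pickleK /= distrC.
exact: hN.
Qed.

(** A code [(n, N, l)] consists of a norm bound, a resolution that fixes both the number of dense
    vectors and the tolerance, and a matrix of names of Q(i)-values. There are countably many codes,
    and each box is a Borel condition. *)
Definition weak_box (c : nat * nat * seq (seq nat)) : set (BH H) :=
  [set T : BH H | `|T| < c.1.1%:R /\ forall i j, (i <= c.1.2)%N -> (j <= c.1.2)%N ->
    `|inner (T (d i)) (d j) - qC (nth 0%N (nth [::] c.2 i) j)| < c.1.2.+1%:R^-1].

Lemma op_sub (T : BH H) x y : T (x - y) = T x - T y.
Proof. exact: linearB. Qed.

Lemma natr_gt (z : C) : 0 <= z -> exists n, z < n%:R.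
Proof.
move=> z0; have zE : z = (complex.Re z)%:C by rewrite RRe_real// ger0_real.
have : 0 <= complex.Re z by rewrite -lecR -zE.
move=> /archi_boundP h; exists (Num.bound (complex.Re z)).
by rewrite {1}zE -(rmorph_nat (real_complex R)) ltcR.
Qed.

Lemma weak_tends (n : nat) (T : BH H) (u : nat -> BH H) : `|T| <= n%:R ->
  (forall N, `|u N| <= n%:R) ->
  (forall N i j, (i <= N)%N -> (j <= N)%N ->
    `|inner (u N (d i)) (d j) - inner (T (d i)) (d j)| <= N.+1%:R^-1 + N.+1%:R^-1) ->
  forall x y, tends (fun N => inner (u N x) y) (inner (T x) y).
Proof.
move=> Tn un uT x y eps e0.
have [nx hx] := dense_tends d_dense x; have [ny hy] := dense_tends d_dense y.
pose w k := (n%:R + n%:R) * (`|d (nx k) - x| * `|y|)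
  + (n%:R + n%:R) * (`|d (nx k)| * `|d (ny k) - y|) : C.
have w0 : tends w 0.
  rewrite -(addr0 0); apply: tendsD; apply: tends_mul0.
    rewrite -(mul0r `|y|); apply: tendsM; last exact: tends_cst.
    exact: tends_dist.
  rewrite -(mulr0 `|x|); apply: tendsM; first exact: tends_norm.
  exact: tends_dist.
have e2 : 0 < eps / 2 by rewrite divr_gt0.
have e4 : 0 < eps / 2 / 2 by rewrite divr_gt0.
have [k0 hk0] := w0 _ e2; have {hk0} := hk0 k0 (leqnn _).
rewrite subr0; have wk0 : 0 <= w k0 by rewrite addr_ge0// mulr_ge0// ?addr_ge0// mulr_ge0.
rewrite ger0_norm// => wk.
have [K hK] := archi_inv e4.
exists (maxn K (maxn (nx k0) (ny k0))) => N.
rewrite !geq_max => /and3P[KN xN yN].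
set a := d (nx k0) in wk *; set b := d (ny k0) in wk *.
have Sn : `|u N - T| <= n%:R + n%:R.
  by apply: le_trans (ler_normB _ _) _; exact: lerD.
(* Replace [x] and [y] by the dense vectors [a] and [b]. The two correction terms are controlled by
   the common norm bound [n], the last one by the hypothesis on dense vectors. *)
have -> : inner (u N x) y - inner (T x) y =
    - inner ((u N - T) (a - x)) y - inner ((u N - T) a) (b - y)
    + (inner (u N a) b - inner (T a) b).
  rewrite !opBE !op_sub !(innerBl, innerBr).
  by ring.
apply: (@le_lt_trans _ _ (w k0 + (N.+1%:R^-1 + N.+1%:R^-1))).
  apply: le_trans (ler_normD _ _) _; apply: lerD; last exact: uT.
  apply: le_trans (ler_normB _ _) _; rewrite normrN; apply: lerD.
    apply: le_trans (inner_le _ _) _; rewrite mulrA ler_wpM2r//.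
    by apply: le_trans (op_le _ _) _; rewrite ler_wpM2r.
  apply: le_trans (inner_le _ _) _; rewrite mulrA ler_wpM2r//.
  by apply: le_trans (op_le _ _) _; rewrite ler_wpM2r.
have hN : (N.+1%:R^-1 : C) < eps / 2 / 2.
  by apply: le_lt_trans hK; rewrite lef_pV2 ?posrE// ler_nat ltnS.
by rewrite [ltRHS](splitr eps) ltrD// [ltRHS](splitr (eps / 2)) ltrD.
Qed.

(** Norm-bounded sets are second countable in the weak topology, hence every
    weakly open set is a countable union of the boxes [weak_box c]. *)
Lemma weak_box_ex (U : set (BH H)) (T : BH H) : @open (BH_weak H) U -> U T ->
  exists c, weak_box c T /\ weak_box c `<=` U.
Proof.
move=> oU UT; have [n Tn] := natr_gt (normr_ge0 T).
have /choice[l lP] N : exists l, weak_box (n, N, l) T.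
  have /choice[q qP] ij : exists k,
      `|inner (T (d ij.1)) (d ij.2) - qC k| < N.+1%:R^-1.
    by apply: qC_dense; rewrite invr_gt0.
  exists (mkseq (fun i => mkseq (fun j => q (i, j)) N.+1) N.+1); split=> //= i j iN jN.
  by rewrite nth_mkseq// nth_mkseq//; exact: (qP (i, j)).
(* If no box fits, then for each [N] the box of resolution [N] around [T] contains some [u N]
   outside [U]. These operators converge weakly to [T], so they eventually lie in the open set
   [U]. *)
apply: contrapT => h.
have /choice[u uP] N : exists T', weak_box (n, N, l N) T' /\ ~ U T'.
  apply: contrapT => h2; apply: h; exists (n, N, l N); split=> // T' bT'.
  by apply: contrapT => nU; apply: h2; exists T'.
have ut : forall x y, tends (fun N => inner (u N x) y) (inner (T x) y).
  apply: (@weak_tends n); first exact: ltW.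
    by move=> N; have [[/ltW]] := uP N.
  move=> N i j iN jN; have [[_ /(_ i j iN jN) h1] _] := uP N.
  have [_ /(_ i j iN jN) h2] := lP N; rewrite /= in h1 h2.
  rewrite -(subrKA (qC (nth 0%N (nth [::] (l N) i) j))).
  apply: le_trans (ler_normD _ _) _; apply: lerD; first exact: ltW.
  by rewrite distrC ltW.
have [N hN] := weak_open_tends oU UT ut.
by have [_] := uP N; apply; exact: hN.
Qed.

Context (S : Type) (bor : set (set S)).
Hypothesis hbor : sigma_algebra [set: S] bor.

(** [U] is the union of the countably many boxes contained in it, so its preimage is a countable
    union of Borel sets. *)
Lemma bor_weak_open (X : S -> BH H) (U : set (BH H)) : opmeas bor X ->
  @open (BH_weak H) U -> bor [set s | U (X s)].
Proof.
move=> Xm oU; pose c k := odflt (0%N, 0%N, [::])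
  (choice.unpickle k : option (nat * nat * seq (seq nat))).
apply: (bor_eq (P := fun s => exists k, weak_box (c k) `<=` U /\ weak_box (c k) (X s))).
  apply: (bor_ex hbor) => k; apply: (bor_and hbor); first exact: (bor_cst hbor).
  apply: (bor_and hbor); first exact: (bor_opnorm_lt d_dense hbor).
  apply: (bor_all hbor) => i; apply: (bor_all hbor) => j.
  apply: (bor_imp hbor); first exact: (bor_cst hbor).
  apply: (bor_imp hbor); first exact: (bor_cst hbor).
  apply: (bor_norm_lt hbor); apply: (smeasB hbor); last exact: (smeas_cst hbor).
  by apply: (smeas_inner hbor) => //; exact: (smeas_cst hbor).
move=> s; split=> [[k [kU /kU]]//|Us].
have [b [bX bU]] := weak_box_ex oU Us; exists (choice.pickle b).
by rewrite /c choice.pickleK.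
Qed.

(** Conditions [|inner (T x) y - q| < r] are weakly open, so all matrix coefficients are measurable,
    and weak measurability of the vectors [X s x] suffices. *)
Lemma opmeas_weak_open (X : S -> BH H) :
  (forall U, @open (BH_weak H) U -> bor [set s | U (X s)]) -> opmeas bor X.
Proof.
move=> XU; apply: (opmeas_weak d_dense hbor) => x y.
apply: (smeas_dense hbor qC_dense) => n k.
exact: (XU _ (weak_open_coef x y (qC n) k.+1%:R^-1)).
Qed.

End WeakBorelOperators.

(** * Generated and trace sigma-algebras *)

Section Trace.

Lemma bor_gsigma (S T : Type) (bor : set (set S)) (G : set (set T)) (f : S -> T) :
  sigma_algebra [set: S] bor -> (forall A, G A -> bor (f @^-1` A)) ->
  forall A, <<s G >> A -> bor (f @^-1` A).
Proof.
move=> [b0 bC bU] Gb A sA; apply: (sA [set Y | bor (f @^-1` Y)]).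
split=> //; split=> /=.
- by rewrite preimage_set0.
- by move=> Y bY; rewrite setTD preimage_setC -setTD; exact: bC.
- by move=> Y bY; rewrite preimage_bigcup; exact: bU.
Qed.

Lemma measurable_coordinate d (T : measurableType d) (i : nat) (A : set T) :
  measurable A -> measurable [set u : pow_nat T | A (u i)].
Proof.
move=> mA; apply: sub_sigma_algebra; exists i => //; exists A => //.
by rewrite setTI.
Qed.

Context d (T : measurableType d) (D : set T).

Definition trace_borel : set (set D) :=
  [set A | exists2 X : set T, measurable X & A = set_val @^-1` X].

Lemma trace_sigma : sigma_algebra [set: D] trace_borel.
Proof.
split.
- by exists set0 => //; rewrite preimage_set0.
- move=> _ [X mX ->]; exists (~` X); first exact: measurableC.
  by rewrite setTD preimage_setC.
- move=> A hA.
  have /choice[X XP] k : exists X, measurable X /\ A k = set_val @^-1` X.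
    by have [X mX AX] := hA k; exists X.
  exists (\bigcup_k X k).
    by apply: bigcupT_measurable => k; have [] := XP k.
  by rewrite preimage_bigcup; apply: eq_bigcupr => k _; have [] := XP k.
Qed.

Lemma trace_borel_fun d' (T' : measurableType d') (g : T -> T') (A : set T') :
  measurable_fun [set: T] g -> measurable A ->
  trace_borel [set s : D | A (g (set_val s))].
Proof.
move=> mg mA; exists (g @^-1` A) => //.
by rewrite -[X in measurable X]setTI; exact: mg.
Qed.

End Trace.

(** * The direct limit as a Borel function of the system *)

Section DirectedSystems.
Context (R : realType) (H : hilbertType R).
Context (p : nat -> starpoly).
Hypothesis p_enum : forall P : starpoly, exists j, p j = P.
Context (d : nat -> H).
Hypothesis d_dense : forall x (eps : R[i]), 0 < eps -> exists n, `|x - d n| < eps.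
Notation C := R[i].
Notation S := (Rdir H p).

Let bor : set (set S) := @trace_borel _ _ (Rdir H p).

Let hbor : sigma_algebra [set: S] bor.
Proof. exact: trace_sigma. Qed.

Definition sys_gen (s : S) (n : nat) : nat -> BH H := (set_val s).1 n.

Definition sys_code (s : S) (n : nat) : nat -> nat -> nat := (set_val s).2 n.

Definition sys_alg (s : S) (n : nat) : set (BH H) := Cstar (sys_gen s n).

Definition sys_map (s : S) (n : nat) : BH H -> BH H :=
  hat p (sys_gen s n) (sys_gen s n.+1) (sys_code s n).

Definition sys_poly (s : S) (n m : nat) : BH H := eval (sys_gen s n) (p m).

Lemma sys_Rhom s n : Rhom p (sys_gen s n) (sys_gen s n.+1) (sys_code s n).
Proof. exact: (set_valP s n). Qed.

Lemma sys_map_hom s n : star_hom_on (sys_alg s n) (sys_alg s n.+1) (sys_map s n).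
Proof. exact: (hat_hom p_enum (sys_Rhom s n)). Qed.

Lemma sys_alg_closed s n : star_closed (sys_alg s n).
Proof. exact: Cstar_star_closed. Qed.

Lemma sys_poly_in s n m : sys_alg s n (sys_poly s n m).
Proof. by apply: evals_Cstar; apply/(evals_enum p_enum); exists m. Qed.

Lemma opmeas_gen n k : opmeas bor (fun s => sys_gen s n k).
Proof.
apply: (opmeas_weak_open d_dense hbor) => U oU.
have mU : measurable (U : set (BH_borel H)) by exact: sub_sigma_algebra.
have := trace_borel_fun (Rdir H p) (@measurable_fst _ _ _ _)
  (measurable_coordinate n (measurable_coordinate k mU)).
exact.
Qed.

Lemma nmeas_code n m k : nmeas bor (fun s => sys_code s n m k).
Proof.
move=> j; have mj : measurable [set j] by [].
have := trace_borel_fun (Rdir H p) (@measurable_snd _ _ _ _)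
  (measurable_coordinate n (measurable_coordinate m (measurable_coordinate k mj))).
exact.
Qed.

Lemma opmeas_eval n (P : starpoly) : opmeas bor (fun s => eval (sys_gen s n) P).
Proof.
have let_m l : opmeas bor (fun s => eval_letter (sys_gen s n) l).
  rewrite /eval_letter; case: l.2; last exact: opmeas_gen.
  exact: (opmeasS d_dense hbor (opmeas_gen n l.1)).
have word_m w : opmeas bor (fun s => eval_word (sys_gen s n) w).
  case: w => a t; rewrite /eval_word /=; elim/last_ind: t => [|t b IH]; first exact: let_m.
  apply: (@opmeas_eq _ _ _ _ (fun s => amul
    (foldl (fun T l => amul T (eval_letter (sys_gen s n) l)) (eval_letter (sys_gen s n) a) t)
    (eval_letter (sys_gen s n) b))); last by move=> s; rewrite foldl_rcons.
  exact: (opmeasM hbor IH (let_m b)).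
move=> x; pose F w s := (Qi_embed R (P w) *: eval_word (sys_gen s n) w) x.
apply: (@smeas_eq _ _ _ _ (fun s => \sum_(w <- finsupp P) F w s)).
  apply: (smeas_sum hbor) => w _; exact: (opmeasZ hbor _ (word_m w)).
by move=> s; rewrite /eval op_sumE.
Qed.

(** Both [Y] and the map vary with [s]. Approximate [Y s] by *-polynomials with indices found by
    search; on these the map is a limit of evaluations named by the code, and contractivity carries
    the approximation through the map. *)
Lemma opmeas_sys_map n (Y : S -> BH H) : (forall s, sys_alg s n (Y s)) ->
  opmeas bor Y -> opmeas bor (fun s => sys_map s n (Y s)).
Proof.
move=> AY Ym; pose Q r m s := `|sys_poly s n m - Y s| < r.+1%:R^-1.
pose c r s := least (Q r ^~ s).
have cm r : nmeas bor (c r).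
  apply: (nmeas_least hbor) => m; apply: (bor_opnorm_lt d_dense hbor).
  by apply: (opmeasB hbor) => //; exact: opmeas_eval.
have cP s : tends (fun r => sys_poly s n (c r s)) (Y s).
  apply: (@tends_le _ _ _ (fun r => r.+1%:R^-1)); last exact: tends_inv.
  move=> r; rewrite ltW//; apply: (@leastP (Q r ^~ s)).
  have [m mY] := Cstar_enum p_enum (AY s).
  have [N hN] := mY r.+1%:R^-1 ltac:(by rewrite invr_gt0).
  by exists (m N); exact: hN.
apply: (opmeas_lim hbor (X := fun r s => sys_map s n (sys_poly s n (c r s)))); last first.
  move=> s; apply: (tends_star_hom (@sys_alg_closed s n) (sys_map_hom s n) _ (cP s)).
  by move=> r; exact: sys_poly_in.
move=> r; apply: (opmeas_glue hbor (X := fun m s => sys_map s n (sys_poly s n m))) => // m.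
apply: (opmeas_lim hbor (X := fun k s => eval (sys_gen s n.+1) (p (sys_code s n m k)))).
  move=> k; apply: (opmeas_glue hbor (n := fun s => sys_code s n m k)
    (X := fun j s => eval (sys_gen s n.+1) (p j))); first exact: nmeas_code.
  by move=> j; exact: opmeas_eval.
move=> s; rewrite /sys_map (hat_eval p_enum (sys_Rhom s n)).
by apply: code_lim_tends; have [] := sys_Rhom s n.
Qed.

Definition transport (s : S) (n : nat) : nat -> BH H -> BH H :=
  iter_map (sys_map s) n.

Lemma transport_hom s n i :
  star_hom_on (sys_alg s n) (sys_alg s (n + i)%N) (transport s n i).
Proof.
elim: i => [|i IH]; first by rewrite addn0.
rewrite addnS; have [fA fD fZ fM fS] := IH.
have [gA gD gZ gM gS] := sys_map_hom s (n + i)%N.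
have E x : transport s n i.+1 x = sys_map s (n + i)%N (transport s n i x) by [].
split=> [x Ax|x y Ax Ay|c x Ax|x y Ax Ay|x Ax]; rewrite !E.
- by apply: gA; exact: fA.
- by rewrite fD// gD//; exact: fA.
- by rewrite fZ// gZ//; exact: fA.
- by rewrite fM// gM//; exact: fA.
- by rewrite fS// gS//; exact: fA.
Qed.

Lemma transport_in s n i x : sys_alg s n x -> sys_alg s (n + i)%N (transport s n i x).
Proof. by have [h _ _ _ _] := transport_hom s n i; exact: h. Qed.

Lemma transportS s n i x : transport s n i.+1 x = transport s n.+1 i (sys_map s n x).
Proof.
elim: i => [|i IH]; first by rewrite /transport /= addn0.
rewrite [RHS]/transport /= -/(transport s n.+1 i) -IH /transport /=.
by rewrite addSnnS.
Qed.

Lemma opmeas_transport n i m : opmeas bor (fun s => transport s n i (sys_poly s n m)).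
Proof.
elim: i => [|i IH]; first exact: opmeas_eval.
apply: opmeas_sys_map => // s; apply: transport_in; exact: sys_poly_in.
Qed.

(** The [X_j(n,m)] of the construction, with [(n, m) = unpair a]. Before stage [n] there is no
    image; the value [0] keeps the norm bound and does not affect eventual relations. *)
Definition stage_op (s : S) (a j : nat) : BH H :=
  if ((unpair a).1 <= j)%N then
    transport s (unpair a).1 (j - (unpair a).1) (sys_poly s (unpair a).1 (unpair a).2)
  else 0.

Lemma stage_op_le s a j :
  `|stage_op s a j| <= `|sys_poly s (unpair a).1 (unpair a).2|.
Proof.
rewrite /stage_op; case: ifP => _; last by rewrite normr0.
apply: (star_hom_contractive (@sys_alg_closed s _) (transport_hom s _ _)).
exact: sys_poly_in.
Qed.

Lemma stage_opE s n m i :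
  stage_op s (choice.pickle (n, m)) (n + i)%N = transport s n i (sys_poly s n m).
Proof. by rewrite /stage_op pairK /= leq_addr addKn. Qed.

Lemma opmeas_stage_op a j : opmeas bor (fun s => stage_op s a j).
Proof.
rewrite /stage_op; case: ((unpair a).1 <= j)%N; first exact: opmeas_transport.
exact: (opmeas_cst hbor).
Qed.

Lemma evtl_shift (P : nat -> Prop) n : (forall i, P (n + i)%N) -> evtl P.
Proof. by move=> h; exists n => j nj; rewrite -(subnKC nj). Qed.

Section Limit.
Context (T : S -> nat -> BH H).
Hypothesis TD : forall s a b c,
  evtl (fun j => stage_op s a j + stage_op s b j = stage_op s c j) ->
  T s a + T s b = T s c.
Hypothesis TZ : forall s a b z,
  evtl (fun j => stage_op s a j = z *: stage_op s b j) -> T s a = z *: T s b.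
Hypothesis TM : forall s a b c,
  evtl (fun j => amul (stage_op s a j) (stage_op s b j) = stage_op s c j) ->
  amul (T s a) (T s b) = T s c.
Hypothesis TS : forall s a b,
  evtl (fun j => astar (stage_op s a j) = stage_op s b j) -> astar (T s a) = T s b.
Hypothesis TK : forall s a K, 0 <= K -> evtl (fun j => `|stage_op s a j| <= K) ->
  `|T s a| <= K.
Hypothesis Tdist : forall s a b K, 0 <= K ->
  evtl (fun j => `|stage_op s a j - stage_op s b j| <= K) -> `|T s a - T s b| <= K.
Hypothesis Tlow : forall s a K, 0 <= K -> evtl (fun j => K <= `|stage_op s a j|) ->
  K <= 4 * `|T s a|.
Context (v : nat -> nat).
Hypothesis vP : forall k (gamma : nat -> BH H), eval gamma (p (v k)) = gamma k.

(** Constant in [k] and the same for all systems: the image of the [m]-th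
    *-polynomial of stage [n] is a generator of the limit. *)
Definition lim_code (n m k : nat) : nat := v (choice.pickle (n, m)).

Local Notation tau s n m := (T s (choice.pickle (n, m))).

Lemma lim_code_tends s n m : tends (code_seq p (T s) (lim_code n) m) (tau s n m).
Proof. by apply: tends_eq (tends_cst _) _ => k; rewrite /code_seq vP. Qed.

Lemma lim_codeE s n m : code_lim p (T s) (lim_code n) m = tau s n m.
Proof. by apply: code_lim_eq; exact: lim_code_tends. Qed.

(** Each clause starts from a relation at stage [n], which the *-homomorphisms [transport s n i]
    preserve at all later stages; the asymptotic properties of [T] then apply. *)
Lemma lim_Rhom s n : Rhom p (sys_gen s n) (T s) (lim_code n).
Proof.
split=> [m|m m' k q].
  by apply/cauchy_cauchys; exact: tends_cauchys (lim_code_tends s n m).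
rewrite !lim_codeE -!/(sys_poly s n _).
have h i := transport_hom s n i.
have Ain := @sys_poly_in s n.
split=> [E|E|E|E|].
- apply: TD; apply: (evtl_shift (n := n)) => i; rewrite !stage_opE -E.
  by have [_ -> ] := h i.
- apply: TZ; apply: (evtl_shift (n := n)) => i; rewrite !stage_opE E.
  by have [_ _ ->] := h i.
- apply: TM; apply: (evtl_shift (n := n)) => i; rewrite !stage_opE -E.
  by have [_ _ _ ->] := h i.
- apply: TS; apply: (evtl_shift (n := n)) => i; rewrite !stage_opE -E.
  by have [_ _ _ _ ->] := h i.
- apply: TK => //; apply: (evtl_shift (n := n)) => i; rewrite stage_opE.
  exact: (star_hom_contractive (@sys_alg_closed s n) (h i)).
Qed.

Definition lim_map s n : BH H -> BH H := hat p (sys_gen s n) (T s) (lim_code n).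

Lemma lim_map_hom s n : star_hom_on (sys_alg s n) (Cstar (T s)) (lim_map s n).
Proof. exact: (hat_hom p_enum (lim_Rhom s n)). Qed.

Lemma lim_map_poly s n m : lim_map s n (sys_poly s n m) = tau s n m.
Proof. by rewrite /lim_map (hat_eval p_enum (lim_Rhom s n)) lim_codeE. Qed.

Lemma sys_poly_dense s n x : sys_alg s n x ->
  exists m : nat -> nat, tends (fun r => sys_poly s n (m r)) x.
Proof. exact: Cstar_enum. Qed.

(** The image of a *-polynomial under [sys_map] need not be a *-polynomial of stage [n + 1], so it
    is compared with *-polynomials converging to it: [Tdist] and contractivity bound the distance of
    their images in the limit. Density then covers all [x]. *)
Lemma lim_map_compat s n x : sys_alg s n x ->
  lim_map s n.+1 (sys_map s n x) = lim_map s n x.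
Proof.
have Apoly k m := @sys_poly_in s k m.
have Acl k := @sys_alg_closed s k.
have Amap k y : sys_alg s k y -> sys_alg s k.+1 (sys_map s k y).
  by have [+ _ _ _ _] := sys_map_hom s k; apply.
have onpoly m : lim_map s n.+1 (sys_map s n (sys_poly s n m)) =
    lim_map s n (sys_poly s n m).
  set y := sys_map s n _; have Ay : sys_alg s n.+1 y by exact: Amap.
  have [c cy] := sys_poly_dense Ay.
  apply: tends_unique (tends_star_hom (Acl _) (lim_map_hom s n.+1) _ cy) _ => //.
  apply: (@tends_le _ _ _ (fun r => `|sys_poly s n.+1 (c r) - y|)); last exact: tends_dist.
  move=> r; rewrite !lim_map_poly; apply: Tdist => //.
  apply: (evtl_shift (n := n.+1)) => i; rewrite stage_opE addSnnS stage_opE transportS.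
  rewrite -(star_homB (Acl _) (transport_hom s n.+1 i))//.
  apply: (star_hom_contractive (Acl _) (transport_hom s n.+1 i)).
  exact: (star_closedB (@sys_alg_closed s _)).
move=> Ax; have [c cx] := sys_poly_dense Ax.
have cy := tends_star_hom (Acl _) (sys_map_hom s n) (fun r => Apoly n (c r)) cx.
have h1 := tends_star_hom (Acl _) (lim_map_hom s n.+1)
  (fun r => Amap _ _ (Apoly n (c r))) cy.
have h2 := tends_star_hom (Acl _) (lim_map_hom s n) (fun r => Apoly n (c r)) cx.
by apply: tends_unique h1 _; apply: tends_eq h2 _ => r; rewrite onpoly.
Qed.

Lemma lim_map_lower s n x : sys_alg s n x -> forall eps : C, 0 < eps ->
  exists i, `|transport s n i x| <= 4 * `|lim_map s n x| + eps.
Proof.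
move=> Ax eps e0; apply: contrapT => h.
have Acl := @sys_alg_closed s n.
have hgt i : 4 * `|lim_map s n x| + eps < `|transport s n i x|.
  rewrite real_ltNge ?normr_real//; last by rewrite ger0_real// addr_ge0// ?mulr_ge0// ltW.
  by apply/negP => le; apply: h; exists i.
(* Replacing [x] by a *-polynomial [y] costs [eps / 10] on the transported side and [4 eps / 10] in
   the limit, which together stay below [eps]. The contradiction hypothesis supplies the lower bound
   at all stages, as [Tlow] demands. *)
have d0 : 0 < eps / 10 by rewrite divr_gt0.
have [c cx] := sys_poly_dense Ax; have [N hN] := cx _ d0.
have {hN} := hN N (leqnn _); set y := sys_poly s n (c N) => yx.
have Ay : sys_alg s n y by exact: sys_poly_in.
pose K := 4 * `|lim_map s n x| + eps - eps / 10.
have dK : eps - eps / 10 = 9 / 10 * eps by field.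
have K0 : 0 <= K by rewrite /K -addrA dK addr_ge0// mulr_ge0// ltW.
have K4 : K <= 4 * `|tau s n (c N)|.
  apply: Tlow => //; apply: (evtl_shift (n := n)) => i; rewrite stage_opE -/y.
  rewrite /K lerBlDr; apply: le_trans (ltW (hgt i)) _.
  rewrite -{1}(subrK (transport s n i y) (transport s n i x)).
  apply: le_trans (ler_normD _ _) _; rewrite addrC lerD2l.
  rewrite -(star_homB Acl (transport_hom s n i))//.
  apply: le_trans (star_hom_contractive Acl (transport_hom s n i) _) _.
    exact: (star_closedB (@sys_alg_closed s _)).
  by rewrite distrC ltW.
have : `|tau s n (c N)| <= `|lim_map s n x| + eps / 10.
  rewrite -lim_map_poly -/y -{1}(subrK (lim_map s n x) (lim_map s n y)).
  apply: le_trans (ler_normD _ _) _; rewrite addrC lerD2l.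
  rewrite -(star_homB Acl (lim_map_hom s n))//.
  apply: le_trans (star_hom_contractive Acl (lim_map_hom s n) _) _.
    exact: (star_closedB (@sys_alg_closed s _)).
  exact: ltW.
rewrite -(ler_pM2l (_ : 0 < 4))// => /(le_trans K4).
rewrite /K mulrDr -addrA lerD2l dK => le.
have : 9 / 10 * eps < 9 / 10 * eps; last by rewrite ltxx.
apply: le_lt_trans le _.
have -> : 4 * (eps / 10) = 4 / 10 * eps by field.
by rewrite ltr_pM2r// ltr_pM2r ?invr_gt0// ltr_nat.
Qed.

(** By compatibility the images of the stages form an increasing union, closed under the operations.
    Its closure is a C*-algebra by [graph_dom_closed], and it contains every generator [T s k]. *)
Lemma lim_map_dense s y : Cstar (T s) y -> exists u : nat -> BH H,
  (forall k, exists n x, sys_alg s n x /\ u k = lim_map s n x) /\ tends u y.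
Proof.
pose G (x z : BH H) := x = z /\ exists n w, sys_alg s n w /\ x = lim_map s n w.
have common (Q : BH H -> BH H -> Prop) :
    (forall n x z, sys_alg s n x -> sys_alg s n z -> Q (lim_map s n x) (lim_map s n z)) ->
    forall n m x z, sys_alg s n x -> sys_alg s m z -> Q (lim_map s n x) (lim_map s m z).
  move=> hQ n m x z Ax Az.
  have comp k i w : sys_alg s k w ->
      lim_map s (k + i)%N (transport s k i w) = lim_map s k w.
    move=> Aw; apply: (iter_map_cocone (sys_map_hom s)) => //.
    by move=> k' w' Aw'; exact: lim_map_compat.
  rewrite -(comp n m x Ax) -(comp m n z Az) (addnC m n); apply: hQ.
    exact: transport_in.
  by rewrite addnC; exact: transport_in.
have Gcl : star_closed (graph_dom G).
  apply: (@graph_dom_closed _ _ _ G).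
  - split=> //; exists 0%N, 0; have [[A0 _ _ _ _] _] := @sys_alg_closed s 0%N.
    split=> //; have [_ _ fZ _ _] := lim_map_hom s 0.
    by have := fZ 0 _ A0; rewrite !scale0r.
  - move=> x z x' z' [<- [n [w [Aw ->]]]] [<- [n' [w' [Aw' ->]]]]; split=> //.
    apply: (common (fun a b => exists k u, sys_alg s k u /\ a + b = lim_map s k u)) => //.
    move=> k a b Aa Ab; exists k, (a + b); have [_ fD _ _ _] := lim_map_hom s k.
    by have [[_ AD _ _ _] _] := @sys_alg_closed s k; split; [exact: AD|rewrite fD].
  - move=> q x z [<- [n [w [Aw ->]]]]; split=> //; exists n, (Qi_embed R q *: w).
    have [_ _ fZ _ _] := lim_map_hom s n; have [[_ _ AZ _ _] _] := @sys_alg_closed s n.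
    by split; [exact: AZ|rewrite fZ].
  - move=> x z x' z' [<- [n [w [Aw ->]]]] [<- [n' [w' [Aw' ->]]]]; split=> //.
    apply: (common (fun a b => exists k u, sys_alg s k u /\ amul a b = lim_map s k u)) => //.
    move=> k a b Aa Ab; exists k, (amul a b); have [_ _ _ fM _] := lim_map_hom s k.
    by have [[_ _ _ AM _] _] := @sys_alg_closed s k; split; [exact: AM|rewrite fM].
  - move=> x z [<- [n [w [Aw ->]]]]; split=> //; exists n, (astar w).
    have [_ _ _ _ fS] := lim_map_hom s n; have [[_ _ _ _ AS] _] := @sys_alg_closed s n.
    by split; [exact: AS|rewrite fS].
have Gtau (n m : nat) : G (tau s n m) (tau s n m).
  split=> //; exists n, (sys_poly s n m); rewrite lim_map_poly.
  by split=> //; exact: sys_poly_in.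
move=> /(Cstar_min Gcl)[k|u [w [Guw uy]]]; last first.
  by exists u; split=> // k; have [_] := Guw k.
(* An index [k] may differ from the code of its pair when decoding falls back to the default. Both
   name the same [stage_op], so [Tdist] with bound 0 identifies the operators. *)
have Tsame : T s k = tau s (unpair k).1 (unpair k).2.
  suff : `|T s k - tau s (unpair k).1 (unpair k).2| <= 0.
    by rewrite normr_le0 subr_eq0 => /eqP.
  apply: Tdist => //; apply: (evtl_shift (n := 0)) => i.
  by rewrite /stage_op pairK subrr normr0.
by apply: graph_fun_dom; rewrite Tsame; exact: Gtau.
Qed.

Lemma lim_isomorphic s :
  isomorphic_to_direct_limit (sys_alg s) (sys_map s) (Cstar (T s)).
Proof.
apply: (@direct_limit_criterion R (BH H) (BH H) (sys_alg s) (sys_map s)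
  (Cstar (T s)) (lim_map s) 4 (ler0n _ 4) (@sys_alg_closed s) (@Cstar_star_closed _ _ _)
  (sys_map_hom s) (lim_map_hom s)).
- by move=> n x; exact: lim_map_compat.
- by move=> y; exact: lim_map_dense.
- by move=> n x Ax; exact: lim_map_lower.
Qed.

End Limit.

End DirectedSystems.

Theorem proposition3p5 (R : realType) (H : hilbertType R)
    (Hsep : separable H) (Hinf : infinite_dimensional H)
    (p : nat -> starpoly) (p_enum : forall P : starpoly, exists j, p j = P) :
  exists (LIM : Rdir H p -> Gamma H) (Psi : nat -> Rdir H p -> codes),
    [/\ borel_on LIM,
        forall i, borel_on (Psi i) &
        forall s : Rdir H p,
          let gamma := (set_val s).1 in
          let Phi := (set_val s).2 in
          [/\ isomorphic_to_direct_limit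
                (fun i => Cstar (gamma i))
                (fun i => hat p (gamma i) (gamma i.+1) (Phi i))
                (Cstar (LIM s)),
              forall n, Rhom p (gamma n) (LIM s) (Psi n s) &
              forall n x, Cstar (gamma n) x ->
                hat p (gamma n.+1) (LIM s) (Psi n.+1 s)
                  (hat p (gamma n) (gamma n.+1) (Phi n) x) =
                hat p (gamma n) (LIM s) (Psi n s) x]].
Proof.
have [d d_dense] := separable_dense_seq Hsep.
have [e he] := orthonormal_ex Hinf.
have hbor := @trace_sigma _ _ (Rdir H p).
have [T [[Tm TD TZ TM TS] [TK Tdist Tlow]]] := asymptotic_representation d_dense he hbor
  (opmeas_stage_op p_enum d_dense) (@stage_op_le _ _ _ p_enum).
have /choice[v vP] k : exists j, forall gamma : nat -> BH H, eval gamma (p j) = gamma k.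
  have [P PE] := eval_variable H k; have [j jP] := p_enum P.
  by exists j => gamma; rewrite jP PE.
exists T, (fun n _ => lim_code v n); split.
(* Two reductions to generators: first from the product structure to one coordinate, then from Borel
   sets of operators to weakly open ones. *)
- move=> Y mY; suff : trace_borel ((T : Rdir H p -> Gamma H) @^-1` Y) by [].
  move: Y mY; apply: bor_gsigma => // _ [i _ [B mB <-]]; rewrite setTI.
  suff : trace_borel ((fun s => T s i) @^-1` B) by [].
  move: B mB; apply: bor_gsigma => // U oU.
  exact: (bor_weak_open d_dense hbor (Tm i) oU).
(* The code is constant in [s], so a preimage is everything or empty. *)
- move=> n Y mY; have [Yn|nY] := pselect (Y (lim_code v n)).
    by exists setT => //; apply/seteqP; split.
  by exists set0 => //; apply/seteqP; split.
move=> s; split.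
- exact: (lim_isomorphic p_enum TD TZ TM TS TK Tdist Tlow vP s).
- move=> n; exact: (lim_Rhom p_enum TD TZ TM TS TK vP s n).
- move=> n x; exact: (lim_map_compat p_enum TD TZ TM TS TK Tdist vP).
Qed.
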